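(* Assume that there exist $L,L'\in(0,\infty)$ such that for all $\theta\in\mathbb{R}^d$ \[ \langle\theta-\theta^*,f(\theta)\rangle\le -L\|\theta-\theta^*\|^2\quad\text{and}\quad \langle\theta-\theta^*,f(\theta)\rangle\le -L'\|f(\theta)\|^2 , \] and assume that there exist measurable functions $\Gamma_1,\Gamma_2\colon\mathbb{R}^d\to(0,\infty)$ and constants $M\in(1,\infty)$, $K,K_1,\alpha,\beta\in(0,\infty)$ with $\alpha\ge\beta$ and a constant $\beta_1$, with $\beta_1\in[0,\min(\beta,1/2)]$ if $\beta\ne 1/2$ and $\beta_1\in[0,1/2)$ if $\beta=1/2$, such that for all $k\in\mathbb{N}$ and all $\theta\in\mathbb{R}^d$ (i) $\mathbb{E}\bigl[\|F_k(\theta,U)-F_{k-1}(\theta,U)-\mathbb{E}[F_k(\theta,U)-F_{k-1}(\theta,U)]\|^p\bigr]^{1/p}\le\Gamma_1(\theta)M^{-k\beta}$, (ii) $\|\mathbb{E}[F_k(\theta,U)-F(\theta,U)]\|\le\Gamma_2(\theta)M^{-k\alpha}$, (iii) $C_k\le KM^k$, (iv) $\Gamma_1(\theta)\le K_1(1+\|\theta\|)^{\beta_1p}$ and $\Gamma_2(\theta)\le K_1(1+\|\theta\|)^{\alpha p}$. Let $\theta_0\in\mathbb{R}^d$, $r\in(-1,\infty)$, $\gamma_0\in\bigl(\frac{1+r}{2L},\infty\bigr)$, $\sigma_0,\varepsilon_0\in(0,\infty)$, put $\rho=\frac12(1+r)$, and for all $n\in\mathbb{N}$ let \[ \gamma_n=\gamma_0\frac1n,\qquad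 \sigma_n^2=\sigma_0^2\frac1{n^r},\qquad \varepsilon_n=\varepsilon_0\frac1{n^\rho}. \] Let $(\theta_n)_{n\in\mathbb{N}_0}$ be the multilevel Robbins-Monro scheme with these parameters and $\mathrm{cost}_n$ its computational cost (both defined in the context). Then for all $\eta\in(0,\rho)$ there exists $\kappa\in(0,\infty)$ such that for all $n\in\mathbb{N}$ \[ \mathbb{E}\Bigl[\sup_{k\ge n}k^{\eta p}\|\theta_k-\theta^*\|^p\Bigr]^{1/p}\le\kappa\,n^{-(\rho-\eta)} . \] In particular, for all $\delta\in(0,\infty)$ we have $\lim_{n\to\infty}n^{\rho-\delta}\|\theta_n-\theta^*\|=0$ almost surely. If additionally $\alpha>\beta\wedge\frac12$ and $r>\frac{\beta\wedge 1/2}{\alpha-\beta\wedge 1/2}$, then there exists $\kappa'\in(0,\infty)$ such that for all $n\in\mathbb{N}$ \[ \mathrm{cost}_n\le\kappa'\begin{cases}n^{2\rho},&\text{if }\beta>1/2,\\ n^{2\rho}(\ln(n+1))^2,&\text{if }\beta=1/2,\\ n^{2\rho\left(1+\frac{1-2\beta}{2\alpha}\right)},&\text{if }\beta<1/2.\end{cases} \]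
   Context: Fix $p\in[2,\infty)$, a probability space $(\Omega,\mathcal{F},P)$, a scalar product $\langle\cdot,\cdot\rangle$ on $\mathbb{R}^d$ with induced norm $\|\cdot\|$, a non-empty set $\mathcal{U}$ equipped with a $\sigma$-field, a random variable $U\colon\Omega\to\mathcal{U}$ and a product-measurable function $F\colon\mathbb{R}^d\times\mathcal{U}\to\mathbb{R}^d$ such that $F(\theta,U)$ is integrable for every $\theta\in\mathbb{R}^d$. Put $f(\theta)=\mathbb{E}[F(\theta,U)]$ and assume that $f\colon\mathbb{R}^d\to\mathbb{R}^d$ has a unique zero $\theta^*\in\mathbb{R}^d$. Let $F_1,F_2,\ldots\colon\mathbb{R}^d\times\mathcal{U}\to\mathbb{R}^d$ be product-measurable with $F_k(\theta,U)$ integrable for all $\theta$ and $k$, put $F_0=0$, and let $C_k\in(0,\infty)$, $k\in\mathbb{N}$ (the cost assigned to one simulation of $F_k(\theta,U)-F_{k-1}(\theta,U)$). Notation: $a\wedge b=\min(a,b)$, $a\vee b=\max(a,b)$, $x_+=\max(x,0)$. Multilevel Robbins-Monro scheme. Given $\Gamma_1,\Gamma_2,M,\alpha,\beta$, an initial vector $\theta_0\in\mathbb{R}^d$ and sequences $(\gamma_n),(\varepsilon_n),(\sigma_n)$ in $(0,\infty)$, put for $n\in\mathbb{N}$, $\theta\in\mathbb{R}^d$ \[ m_n(\theta)=1\vee\Bigl\lceil\tfrac1\alpha\log_M\Bigl(\tfrac{\Gamma_2(\theta)}{\varepsilon_n}\Bigr)\Bigr\rceil,\qquad \kappa_n(\theta)=\begin{cases}(\Gamma_1(\theta)/\sigma_n)^2M^{m_n(\theta)(\frac12-\beta)_+},&\beta\ne1/2,\\(\Gamma_1(\theta)/\sigma_n)^2m_n(\theta),&\beta=1/2,\end{cases}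 \] and $N_{n,k}(\theta)=\lceil\kappa_n(\theta)M^{-k(\beta+1/2)}\rceil$ for $k=1,\dots,m_n(\theta)$. Let $(U_{n,k,\ell})_{n,k,\ell\in\mathbb{N}}$ be independent copies of $U$, \[ Z_n(\theta)=\sum_{k=1}^{m_n(\theta)}\frac1{N_{n,k}(\theta)}\sum_{\ell=1}^{N_{n,k}(\theta)}\bigl(F_k(\theta,U_{n,k,\ell})-F_{k-1}(\theta,U_{n,k,\ell})\bigr), \] and define $\theta_n=\theta_{n-1}+\gamma_nZ_n(\theta_{n-1})$ for $n\in\mathbb{N}$. The computational cost is \[ \mathrm{cost}_n=\mathbb{E}\Bigl[\sum_{j=1}^n\sum_{k=1}^{m_j(\theta_{j-1})}N_{j,k}(\theta_{j-1})\,C_k\Bigr]. \] *)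

(* Defs.v *)
From HB Require Import structures.
From mathcomp Require Import all_boot all_order all_algebra finmap.
From mathcomp Require Import all_classical all_reals all_analysis.
Import Order.TTheory GRing.Theory Num.Theory.
Import numFieldNormedType.Exports.

Set Implicit Arguments.
Unset Strict Implicit.
Unset Printing Implicit Defensive.

Local Open Scope classical_set_scope.
Local Open Scope ring_scope.

(* R^d is 'rV[R]_d with the d-fold product sigma-field, built as for n.-tuple T;
   rV_measurable_borel shows that it is the Borel sigma-field of R^d. *)
Definition measure_rV_display : measure_display -> measure_display.
Proof. exact. Qed.

Section measurable_rV.
Context {d} {T : sigmaRingType d}.
Variable n : nat.

Let coors : 'I_n -> 'rV[T]_n -> T := fun i x => x ord0 i.

Let rV_set0 : g_sigma_preimage coors set0.
Proof. exact: sigma_algebra0. Qed.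

Let rV_setC A : g_sigma_preimage coors A -> g_sigma_preimage coors (~` A).
Proof. exact: sigma_algebraC. Qed.

Let rV_bigcup (F : _^nat) : (forall i, g_sigma_preimage coors (F i)) ->
  g_sigma_preimage coors (\bigcup_i (F i)).
Proof. exact: sigma_algebra_bigcup. Qed.

HB.instance Definition _ := @isMeasurable.Build (measure_rV_display d)
  'rV[T]_n (g_sigma_preimage coors) rV_set0 rV_setC rV_bigcup.

End measurable_rV.

Lemma measurable_rV_coord (d : measure_display) (T : sigmaRingType d) (n : nat)
    (i : 'I_n) : measurable_fun [set: 'rV[T]_n] (fun x => x ord0 i).
Proof.
move=> _ A mA; rewrite setTI.
apply: sub_sigma_algebra; rewrite (bigD1 i)//=; left.
by exists A => //; rewrite setTI.
Qed.

Lemma rV_measurable_borel (R : realType) (n : nat) :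
  (measurable : set (set 'rV[R]_n)) = <<s @open 'rV[R]_n >>.
Proof.
apply/seteqP; split.
- apply: smallest_sub; first exact: smallest_sigma_algebra.
  move=> B.
  elim/big_rec : _ => // i S _ IH [|//] [A mA <-]; rewrite setTI.
  pose c (x : 'rV[R]_n) := x ord0 i.
  have mc : sigma_algebra setT [set A : set R | <<s @open 'rV[R]_n >> (c @^-1` A)].
    split => /=.
    + by rewrite preimage_set0; exact: sigma_algebra0.
    + by move=> X mX; rewrite setTD preimage_setC; exact: sigma_algebraC.
    + by move=> X mX; rewrite preimage_bigcup; exact: sigma_algebra_bigcup.
  have {}mA : (@ocitv R).-sigma.-measurable A by [].
  rewrite measurable_realfun.RGenOpens.measurableE in mA.
  apply: (smallest_sub mc _ mA) => X -[a [b ->]] /=.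
  apply: sub_sigma_algebra; apply: open_comp; last exact: interval_open.
  by move=> x _; exact: coord_continuous.
- apply: smallest_sub; first exact: sigma_algebra_measurable.
  move=> U oU.
  pose B (qk : 'rV[rat]_n * nat) : set 'rV[R]_n :=
    ball (map_mx ratr qk.1 : 'rV[R]_n) (qk.2.+1%:R^-1).
  have -> : U = \bigcup_(i in [set i | B i `<=` U]) B i.
    apply/seteqP; split; last by move=> x [i Bi] /Bi.
    move=> x Ux.
    have /nbhs_ballP[e /= e0 eU] : nbhs x U by exact: open_nbhs_nbhs.
    have [k ke] : exists k : nat, k.+1%:R^-1 < e / 2.
      have [k _ /(_ k (leqnn _))] := near_infty_natSinv_lt (PosNum (divr_gt0 e0 (ltr0Sn R 1))).
      by exists k.
    have k0 : (0 : R) < k.+1%:R^-1 by rewrite invr_gt0.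
    have /choice[q qx] : forall i : 'I_n, exists q : rat,
        `|x ord0 i - ratr q| < k.+1%:R^-1.
      move=> i; have [|q] := @rat_in_itvoo R (x ord0 i - k.+1%:R^-1) (x ord0 i + k.+1%:R^-1).
        by rewrite ltrD2l gtrN.
      rewrite in_itv/= => /andP[xq qx]; exists q.
      by rewrite ltr_distlC xq qx.
    have xB : B (\row_i q i, k) x.
      split=> // i j; rewrite !mxE (ord1 i) /ball/= distrC; exact: qx.
    exists (\row_i q i, k) => //= y By; apply: eU.
    apply: le_ball (ball_triangle (ball_sym xB) By).
    by rewrite (splitr e) lerD// ltW.
  rewrite bigcup_mkcond; apply: countable_bigcupT_measurable => [|[q k]].
    exact: countableP.
  case: ifP => // _.
  have -> : B (q, k) = \big[setI/setT]_(i < n)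
      ((fun x : 'rV[R]_n => x ord0 i) @^-1` ball (ratr (q ord0 i) : R) k.+1%:R^-1).
    rewrite -bigcap_seq; apply/seteqP; split.
      by move=> x [_ xB] i _ /=; have := xB ord0 i; rewrite mxE.
    move=> x xB; split; first by rewrite invr_gt0.
    by move=> i j; rewrite (ord1 i) mxE; apply: xB; rewrite /= mem_index_enum.
  apply: bigsetI_measurable => i _; rewrite -[X in measurable X]setTI.
  by apply: measurable_rV_coord => //; exact: measurable_realfun.measurable_ball.
Qed.

Section random_vectors.
Context {dO} {Omega : measurableType dO} {R : realType}.
Variables (P : probability Omega R) (d : nat).
Implicit Type X : Omega -> 'rV[R]_d.

Definition vintegrable X : Prop :=
  forall i, P.-integrable [set: Omega] (fun w => (X w ord0 i)%:E).

Definition vexpectation X : 'rV[R]_d :=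
  \row_i fine ('E_P[fun w => X w ord0 i])%E.

End random_vectors.

(* The norm induced by an arbitrary scalar product; `|x| on 'rV[R]_d is the
   sup norm. *)
Definition dot_norm (R : realType) (d : nat) (dot : {dot 'rV[R]_d for idfun})
  (x : 'rV[R]_d) : R := Num.sqrt (dot x x).

Section independence.
Context {dO dV} {Omega : measurableType dO} {V : measurableType dV}
  {R : realType}.
Variable P : probability Omega R.

Definition independent_RVs (I : choiceType) (D : set I)
    (X : I -> {RV P >-> V}) : Prop :=
  forall s : {fset I}, [set` s] `<=` D ->
  forall A : I -> set V, (forall i, measurable (A i)) ->
  P (\bigcap_(i in [set` s]) (X i @^-1` A i)) =
    (\prod_(i <- s) P (X i @^-1` A i))%E.

Definition same_distribution (X Y : {RV P >-> V}) : Prop :=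
  forall A, measurable A -> distribution P X A = distribution P Y A.

(* Indices start at 1; members of the family with a zero index are
   unconstrained and never used. *)
Definition independent_copies (U : {RV P >-> V})
    (Uc : nat -> nat -> nat -> {RV P >-> V}) : Prop :=
  (forall n k l, (0 < n)%N -> (0 < k)%N -> (0 < l)%N ->
     same_distribution (Uc n k l) U) /\
  independent_RVs
    [set i : nat * nat * nat | [&& (0 < i.1.1)%N, (0 < i.1.2)%N & (0 < i.2)%N]]
    (fun i => Uc i.1.1 i.1.2 i.2).

End independence.

(* Below, G1 and G2 are the functions Gamma_1 and Gamma_2, and the sequences
   gam, eps, sig are used at indices n >= 1 only. *)
Section multilevel_robbins_monro.
Context {R : realType} {d : nat}.
Variables (G1 G2 : 'rV[R]_d -> R) (M alpha beta : R) (eps sig : nat -> R).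
Implicit Type t : 'rV[R]_d.

Definition ml_level (n : nat) t : nat :=
  `|Num.max (1 : int) (Num.ceil (alpha^-1 * (ln (G2 t / eps n) / ln M)))|%N.

Definition ml_kappa (n : nat) t : R :=
  if beta == 1 / 2 then (G1 t / sig n) ^+ 2 * (ml_level n t)%:R
  else (G1 t / sig n) ^+ 2 *
       M `^ ((ml_level n t)%:R * Num.max (1 / 2 - beta) 0).

Definition ml_reps (n k : nat) t : nat :=
  `|Num.ceil (ml_kappa n t * M `^ (- (k%:R * (beta + 1 / 2))))|%N.

Context {V Omega : Type}.
Variables (F : nat -> 'rV[R]_d -> V -> 'rV[R]_d)
  (U : nat -> nat -> nat -> Omega -> V).

Definition ml_estimator (n : nat) t (w : Omega) : 'rV[R]_d :=
  \sum_(1 <= k < (ml_level n t).+1)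
    ((ml_reps n k t)%:R^-1 *:
      \sum_(1 <= l < (ml_reps n k t).+1)
        (F k t (U n k l w) - F k.-1 t (U n k l w))).

Variables (gam : nat -> R) (theta0 : 'rV[R]_d).

Fixpoint ml_robbins_monro (n : nat) (w : Omega) : 'rV[R]_d :=
  if n is n'.+1 then
    ml_robbins_monro n' w +
      gam n *: ml_estimator n (ml_robbins_monro n' w) w
  else theta0.

End multilevel_robbins_monro.

Definition ml_cost {dO} {Omega : measurableType dO} {R : realType}
    (P : probability Omega R) (d : nat)
    (G1 G2 : 'rV[R]_d -> R) (M alpha beta : R) (eps sig : nat -> R)
    (C : nat -> R) (theta : nat -> Omega -> 'rV[R]_d) (n : nat) : \bar R :=
  ('E_P[fun w =>
     (\sum_(1 <= j < n.+1)
       \sum_(1 <= k < (ml_level G2 M alpha eps j (theta j.-1 w)).+1)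
         (ml_reps G1 G2 M alpha beta eps sig j k (theta j.-1 w))%:R * C k)%R])%E.

(* Main.v *)
(* Conditionally on the past, i.e. with theta_(n-1) frozen, Z_n has bias at most
   epsilon_n by the choice of m_n, and its centered part has p-th moment of order
   sigma_n.  The latter comes from the second-order estimate
   E (|x + Y|^2 + c)^(p/2) <= (|x|^2 + c + C tau^2)^(p/2) for centered Y with
   E |Y|^p <= tau^p, iterated over the independent samples; the factor Gamma_1
   cancels because kappa_n is normalised by it.  Monotonicity of f makes the
   drift contract |theta - theta*|^2 by a factor 1 - b/n with b > 2 rho up to a
   bias of order n^(-1-2 rho), and the same estimate for the noise then gives
   E |theta_n - theta*|^p <= B n^(-rho p) by induction.

   On a dyadic block [N, 2N] the recursion is unrolled and the martingale part is
   controlled by Doob's inequality, so that the maximal error on the block is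
   again of order N^(-rho p); summing over blocks gives the supremum bound, and
   hence almost sure convergence.

   For the cost, M^(m_n(theta)) is at most a constant times
   n^(rho/alpha) (1 + |theta|)^p, and the exponents in (iv) are chosen such that
   the expected cost of a step only involves p-th moments of theta. *)

Require Import Defs.
From HB Require Import structures.
From mathcomp Require Import all_boot all_order all_algebra finmap.
From mathcomp Require Import all_classical all_reals all_analysis.
From mathcomp Require Import measurable_realfun ring lra.
Import Order.TTheory GRing.Theory Num.Theory.
Import numFieldNormedType.Exports.

Set Implicit Arguments.
Unset Strict Implicit.
Unset Printing Implicit Defensive.

Local Open Scope classical_set_scope.
Local Open Scope ring_scope.

(** * Real inequalities *)

(** No multiplicative constant is affordable: a factor above 1 in front of |x|^p would compound over
    the samples of a step and over the steps. Hence moment bounds are stated for (|x|^2 + c)^(p/2),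
    where noise only enlarges the additive c, and the drift is handled on squares. The condition on
    gamma_0 reads 2 L gamma_0 > 2 rho; the room between these numbers pays for the second-order part
    of the drift, the bias and the noise. Conditional expectations never appear. The past and the
    samples of the current step generate independent sigma-fields, and integrals of nonnegative
    functions are frozen at the past by Tonelli's theorem for a product of two laws. Since the
    numbers of levels and samples depend on theta, the noise is one function, jointly measurable in
    the parameter and in the sample point, the latter carrying the sigma-field of the current
    samples. Doob's inequality comes from a potential function instead of stopping times. *)

Section real_inequalities.
Context {R : realType}.
Implicit Types a b c q s t w x y z : R.

(** The tangent of the convex function x^q at m lies below its graph, obtained from Young's
    inequality with exponents q and q / (q - 1). For q = 1 the conjugate exponent is infinite, hence
    the separate case. *)
Lemma powR_tangent q a m : 1 <= q -> 0 <= a -> 0 <= m ->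
  q * m `^ (q - 1) * a <= a `^ q + (q - 1) * m `^ q.
Proof.
move=> q1 a0 m0; have q0 : 0 < q by lra.
have [->|qn1] := eqVneq q 1.
  by rewrite subrr powRr0 mul0r !powRr1// addr0 !mul1r.
have q1' : 0 < q - 1 by rewrite lt_neqAle eq_sym subr_eq0 qn1 subr_ge0.
have := @conjugate_powR _ a (m `^ (q - 1)) q (q / (q - 1)) a0 (powR_ge0 _ _) q0.
rewrite divr_gt0// => /(_ isT).
have -> : q^-1 + (q / (q - 1))^-1 = 1 by field; rewrite !gt_eqF.
move=> /(_ erefl); rewrite -powRrM.
have -> : (q - 1) * (q / (q - 1)) = q by field; rewrite !gt_eqF.
move=> /(ler_wpM2l (ltW q0)).
rewrite mulrDr [q * (a `^ q / q)]mulrC divfK ?gt_eqF//.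
have -> : q * (m `^ q / (q / (q - 1))) = (q - 1) * m `^ q by field; rewrite !gt_eqF.
by rewrite [a * _]mulrC mulrA.
Qed.

Lemma powR_superadd q x y : 1 <= q -> 0 <= x -> 0 <= y ->
  x `^ q + y `^ q <= (x + y) `^ q.
Proof.
move=> q1 x0 y0; have q0 : 0 < q by lra.
rewrite -(mulr_powRB1 x0 q0) -(mulr_powRB1 y0 q0) -(mulr_powRB1 _ q0) ?addr_ge0//.
rewrite mulrDl lerD// ler_wpM2l// ge0_ler_powR ?subr_ge0// ?nnegrE ?addr_ge0//.
  by rewrite lerDl.
by rewrite lerDr.
Qed.

(** From expR (- s) >= 1 - s one gets expR s (1 - s) <= 1, while (1 + s + 2 s^2) (1 - s) = 1 + s^2
    (1 - 2 s) >= 1. *)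
Lemma expR_le_quad s : s <= 1 / 2 -> expR s <= 1 + s + 2 * s ^+ 2.
Proof.
move=> s1; have := expR_ge1Dx (- s); rewrite expRN => h.
have : 1 <= expR s * (1 + s + 2 * s ^+ 2) * (1 - s) * (expR s)^-1 + 0.
  rewrite addr0 mulrAC [expR s * _]mulrC mulfK ?gt_eqF ?expR_gt0//; nra.
rewrite addr0 -mulrA -mulrA => h2.
have e0 := expR_gt0 s.
have : expR s * (1 - s) <= 1.
  by have := ler_wpM2l (ltW e0) h; rewrite divff ?gt_eqF.
nra.
Qed.

Lemma powR_le_quad q t : 0 < q -> - 1 < t -> q * t <= 1 / 2 ->
  (1 + t) `^ q <= 1 + q * t + 2 * (q * t) ^+ 2.
Proof.
move=> q0 t1 qt; apply: le_trans (expR_le_quad qt).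
rewrite /powR gt_eqF; last lra.
by rewrite ler_expR ler_pM2l// le_ln1Dx.
Qed.

(** The summand 19 q^2 = 2 * 9 q^2 + q^2 comes from the Taylor regime of [powR_second_order], and 49
    = 36 + 12 + 1 from the regime where w dominates. *)
Definition moment_const q : R := 19 * q ^+ 2 + (49 * q ^+ 2) `^ q.

Lemma moment_const_ge1 q : 1 <= q -> 1 <= moment_const q.
Proof.
by move=> q1; rewrite /moment_const; have := powR_ge0 (49 * q ^+ 2) q; nra.
Qed.

(* Applied with a = |x|^2 + c, z = <x, y> and w = |y|. *)
Lemma powR_second_order q a w z : 1 <= q -> 0 <= a -> 0 <= w ->
  `|z| <= Num.sqrt a * w ->
  (a + 2 * z + w ^+ 2) `^ q <= a `^ q + 2 * q * a `^ (q - 1) * z +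
    moment_const q * (a `^ (q - 1) * w ^+ 2 + (w ^+ 2) `^ q).
Proof.
move=> q1 a0 w0 zaw.
have q0 : 0 < q by lra.
pose r := Num.sqrt a; have r0 : 0 <= r by exact: sqrtr_ge0.
have ra : r ^+ 2 = a by rewrite sqr_sqrtr.
have {zaw} : `|z| <= r * w by [].
rewrite ler_norml => /andP[z1 z2].
have P0 := powR_ge0 a (q - 1).
have W0 := powR_ge0 (w ^+ 2) q.
have W2 : 0 <= w ^+ 2 by exact: sqr_ge0.
have K0 := powR_ge0 (49 * q ^+ 2) q.
(* For w < r / (6 q) the relative change t of a satisfies |q t| <= 1/2 and the quadratic expansion
   applies; otherwise the new square is at most 49 q^2 w^2. *)
have [wr|rw] := ltP (6 * q * w) r.
- have r_gt0 : 0 < r by nra.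
  have a_gt0 : 0 < a by rewrite -ra; nra.
  pose h := 2 * z + w ^+ 2; pose t := h / a.
  have wr1 : 6 * w <= r by nra.
  have h2 : h <= 3 * (r * w) by rewrite /h; nra.
  have h1 : - (3 * (r * w)) <= h by rewrite /h; nra.
  have hh : h ^+ 2 <= 9 * a * w ^+ 2 by rewrite -ra; nra.
  have qw : 6 * (q * (r * w)) <= a by rewrite -ra expr2; nra.
  have hle : q * h <= a / 2 by nra.
  have hge : - a / 2 <= q * h by nra.
  have -> : a + 2 * z + w ^+ 2 = a * (1 + t).
    by rewrite /t mulrDr mulr1 mulrCA divff ?gt_eqF// mulr1 /h addrA.
  have ta : t * a = h by rewrite /t divfK ?gt_eqF.
  have t1 : -1 < t.
    rewrite /t ltr_pdivlMr//; nra.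
  have qt : q * t <= 1 / 2 by rewrite /t mulrA ler_pdivrMr//; lra.
  have := powR_le_quad q0 t1 qt.
  rewrite powRM ?(ltW a_gt0)//; last lra.
  move=> /(ler_wpM2l (powR_ge0 a q)) /le_trans; apply.
  have aq : a `^ q = a * a `^ (q - 1) by rewrite mulr_powRB1.
  have -> : a `^ q * (1 + q * t + 2 * (q * t) ^+ 2) =
     a `^ q + a `^ (q - 1) * (q * (t * a)) + a `^ (q - 1) * (2 * q ^+ 2 * ((t * a) ^+ 2 / a)).
    by rewrite aq; field; rewrite gt_eqF.
  rewrite ta -[leRHS]addrA -[leLHS]addrA lerD2l.
  have hha : h ^+ 2 / a <= 9 * w ^+ 2.
    by rewrite ler_pdivrMr//; nra.
  have : q * h + 2 * q ^+ 2 * (h ^+ 2 / a) <=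
      2 * q * z + 19 * q ^+ 2 * w ^+ 2.
    have : 2 * q ^+ 2 * (h ^+ 2 / a) <= 2 * q ^+ 2 * (9 * w ^+ 2).
      by rewrite ler_wpM2l// mulr_ge0// sqr_ge0.
    have : q * w ^+ 2 <= q ^+ 2 * w ^+ 2 by rewrite ler_wpM2r//; nra.
    rewrite /h; lra.
  move=> /(ler_wpM2l P0) H; rewrite -mulrDr (le_trans H)//.
  rewrite /moment_const.
  have := mulr_ge0 (mulr_ge0 (ler0n R 19) (sqr_ge0 q)) W0.
  have := mulr_ge0 K0 W0.
  have := mulr_ge0 K0 (mulr_ge0 P0 W2).
  lra.
- have b1 : a + 2 * z + w ^+ 2 <= 49 * q ^+ 2 * w ^+ 2.
    have qw : 0 <= q * w by nra.
    have rw2 : r * w <= 6 * q * w ^+ 2.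
      by have := ler_wpM2r w0 rw; rewrite expr2; lra.
    have r2 : r ^+ 2 <= 36 * q ^+ 2 * w ^+ 2.
      have : r ^+ 2 <= (6 * q * w) ^+ 2 by rewrite ler_pXn2r// nnegrE//; lra.
      lra.
    have : q * w ^+ 2 <= q ^+ 2 * w ^+ 2 by rewrite ler_wpM2r//; nra.
    have : w ^+ 2 <= q * w ^+ 2 by nra.
    rewrite -ra; lra.
  have b0 : 0 <= a + 2 * z + w ^+ 2.
    by have := sqr_ge0 (r - w); rewrite -ra; lra.
  have H1 : (a + 2 * z + w ^+ 2) `^ q <= (49 * q ^+ 2) `^ q * (w ^+ 2) `^ q.
    rewrite -powRM ?sqr_ge0//; last by rewrite mulr_ge0// sqr_ge0.
    rewrite ge0_ler_powR ?nnegrE//; first lra.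
    by rewrite mulr_ge0// mulr_ge0// sqr_ge0.
  (* The linear term may be negative; its lower bound is paid for by 19 q^2 >= 12 q^2 in
     [moment_const]. *)
  have H2 : - (12 * q ^+ 2 * (a `^ (q - 1) * w ^+ 2)) <= 2 * q * a `^ (q - 1) * z.
    have -> : - (12 * q ^+ 2 * (a `^ (q - 1) * w ^+ 2)) =
       2 * q * a `^ (q - 1) * (- (6 * q * w * w)) by ring.
    rewrite ler_wpM2l ?mulr_ge0//; first lra.
    have := ler_wpM2r w0 rw; lra.
  have aq0 := powR_ge0 a q.
  rewrite /moment_const.
  have := mulr_ge0 K0 (mulr_ge0 P0 W2).
  have := mulr_ge0 (mulr_ge0 (ler0n R 19) (sqr_ge0 q)) W0.
  have := mulr_ge0 (sqr_ge0 q) (mulr_ge0 P0 W2).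
  lra.
Qed.

(** Moves an additive error into the base of the power. One C t takes up the term a^(q-1) t by the
    tangent at a, the other takes up t^q by superadditivity; hence the factor 2. *)
Lemma powR_absorb q C a t : 1 <= q -> 1 <= C -> 0 <= a -> 0 <= t ->
  a `^ q + C * (a `^ (q - 1) * t + t `^ q) <= (a + 2 * C * t) `^ q.
Proof.
move=> q1 C1 a0 t0; have q0 : 0 < q by lra.
have Ct : 0 <= C * t by nra.
have -> : a + 2 * C * t = (a + C * t) + C * t by ring.
apply: le_trans (powR_superadd q1 _ Ct); last by rewrite addr_ge0.
have := powR_tangent q1 (addr_ge0 a0 Ct) a0.
have -> : q * a `^ (q - 1) * (a + C * t) = q * (a * a `^ (q - 1)) + q * (C * (a `^ (q - 1) * t)) by ring.
rewrite mulr_powRB1//.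
have : C * t `^ q <= (C * t) `^ q.
  by rewrite le1r_powRZ.
have : C * (a `^ (q - 1) * t) <= q * (C * (a `^ (q - 1) * t)).
  have := mulr_ge0 (ltW (lt_le_trans ltr01 C1)) (mulr_ge0 (powR_ge0 a (q-1)) t0).
  nra.
lra.
Qed.

(** Averages the tangent inequality taken at the mean m. *)
Lemma powR_jensen (I : eqType) (r : seq I) (w a : I -> R) q : 1 <= q ->
  (forall i, i \in r -> 0 <= w i) -> (forall i, i \in r -> 0 <= a i) ->
  \sum_(i <- r) w i = 1 ->
  (\sum_(i <- r) w i * a i) `^ q <= \sum_(i <- r) w i * a i `^ q.
Proof.
move=> q1 w0 a0 w1; set m := \sum_(i <- r) w i * a i.
have m0 : 0 <= m.
  by rewrite /m big_seq sumr_ge0// => i ir; rewrite mulr_ge0 ?w0 ?a0.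
have q0 : 0 < q by lra.
have : \sum_(i <- r) w i * (q * m `^ (q - 1) * a i) <=
       \sum_(i <- r) w i * (a i `^ q + (q - 1) * m `^ q).
  rewrite big_seq [leRHS]big_seq ler_sum// => i ir.
  by rewrite ler_wpM2l ?w0// powR_tangent ?a0.
have -> : \sum_(i <- r) w i * (q * m `^ (q - 1) * a i) = q * m `^ q.
  rewrite -(mulr_powRB1 m0 q0) {2}/m mulrCA big_distrl/=; apply: eq_bigr => i _.
  ring.
under [leRHS]eq_bigr do rewrite mulrDr.
rewrite big_split/= -[X in _ <= _ + X]big_distrl/= w1.
lra.
Qed.

(** Chains 1 - b/(n+1) <= 1 - s/n <= exp(- s ln(1 + 1/n)); the first inequality needs s <= (b - s)
    n, hence s < b and large n. The ratios on the right telescope to the decay n^(-s). *)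
Lemma powR_contraction s b : 0 < s -> s < b ->
  exists2 n0 : nat, (0 < n0)%N & forall n : nat, (n0 <= n)%N ->
    b / n.+1%:R <= 1 /\ 1 - b / n.+1%:R <= (n%:R / n.+1%:R) `^ s.
Proof.
move=> s0 sb.
exists (Num.truncn (b / (b - s) + b)).+2 => // n nn.
have b0 : 0 < b by lra.
have bn : b / (b - s) + b <= n%:R.
  have x0 : 0 <= b / (b - s) + b by rewrite addr_ge0 ?divr_ge0//; lra.
  have /andP[_ /ltW h] := truncn_itv x0.
  by apply: (le_trans h); rewrite ler_nat ltnW.
have bs0 : 0 <= b / (b - s) by rewrite divr_ge0//; lra.
have n_gt0 : 0 < n%:R :> R by rewrite ltr0n (leq_trans _ nn).
have n1 : n.+1%:R = n%:R + 1 :> R by rewrite -natr1.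
split; first by rewrite ler_pdivrMr ?ltr0n// mul1r n1; lra.
have bsn : b <= (b - s) * n%:R.
  by rewrite mulrC -ler_pdivrMr; lra.
have nn0 : n.+1%:R != 0 :> R by rewrite pnatr_eq0.
apply: (@le_trans _ _ (1 - s / n%:R)).
  rewrite lerD2l lerN2 ler_pdivrMr// mulrAC ler_pdivlMr ?ltr0n// n1; lra.
rewrite /powR mulf_eq0 invr_eq0 (negbTE nn0) (gt_eqF n_gt0)/=.
apply: le_trans (expR_ge1Dx _); rewrite lerD2l -mulrN ler_pM2l//.
rewrite -[leRHS]opprK lerN2 -lnV ?posrE ?divr_gt0 ?ltr0n ?(leq_trans _ nn)//.
rewrite invf_div n1 mulrDl divff ?gt_eqF// mul1r.
by apply: le_ln1Dx; rewrite (lt_trans (ltrN10 R))// invr_gt0.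
Qed.

End real_inequalities.

(** * Independence and freezing *)

Section independent_pair.
Context {dO} {Omega : measurableType dO} {R : realType} (P : probability Omega R).

(** Replaces conditioning on X: the joint law is the product law because both agree on rectangles,
    and Tonelli's theorem integrates Y out first with X frozen. *)
Lemma ge0_integral_independent d1 d2 (T1 : measurableType d1)
    (T2 : measurableType d2) (X : Omega -> T1) (Y : Omega -> T2)
    (g : T1 * T2 -> \bar R) :
  measurable_fun setT X -> measurable_fun setT Y ->
  (forall A B, measurable A -> measurable B ->
     P (X @^-1` A `&` Y @^-1` B) = (P (X @^-1` A) * P (Y @^-1` B))%E) ->
  measurable_fun [set: T1 * T2] g -> (forall z, 0 <= g z)%E ->
  (measurable_fun setT (fun w => \int[P]_w' g (X w, Y w')) /\
  \int[P]_w g (X w, Y w) = \int[P]_w \int[P]_w' g (X w, Y w'))%E.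
Proof.
move=> mX mY XY mg g0.
pose X' : {RV P >-> T1} := HB.pack X (isMeasurableFun.Build _ _ _ _ X mX).
pose Y' : {RV P >-> T2} := HB.pack Y (isMeasurableFun.Build _ _ _ _ Y mY).
have mXY : measurable_fun setT (fun w => (X w, Y w)).
  by apply: measurable_fun_pair.
pose XY' : {RV P >-> (T1 * T2)%type} :=
  HB.pack (fun w => (X w, Y w)) (isMeasurableFun.Build _ _ _ _ _ mXY).
have gE w : (\int[P]_w' g (X w, Y w') =
    fubini_F (distribution P Y') g (X w))%E.
  rewrite /fubini_F ge0_integral_distribution//.
  by apply: measurableT_comp mg _; exact: measurable_pair1.
have mF := measurable_fun_fubini_tonelli_F (m2 := distribution P Y') g mg g0.
split.
  under eq_fun do rewrite gE.
  by apply: measurableT_comp mF mX.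
transitivity (\int[distribution P XY']_z g z)%E.
  by rewrite ge0_integral_distribution.
transitivity (\int[distribution P X' \x distribution P Y']_z g z)%E.
  apply: eq_measure_integral => A mA _.
  apply/esym/(product_measure_unique (m' := distribution P XY')) => // B C mB mC; exact: XY.
rewrite fubini_tonelli1// ge0_integral_distribution//.
  by apply: eq_integral => w _; rewrite gE.
by move=> t; exact: integral_ge0.
Qed.

(** For fixed B, the finite measures A -> P (A [&] B) and A -> P B * P A agree on the pi-system G,
    hence on the sigma-field that it generates. *)
Lemma independent_g_sigma1 (G : set (set Omega)) (B : set Omega) :
  G setT -> setI_closed G -> G `<=` measurable -> measurable B ->
  (forall A, G A -> P (A `&` B) = (P A * P B)%E) ->
  forall A, <<s G >> A -> P (A `&` B) = (P A * P B)%E.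
Proof.
move=> GT GI mG mB GB A sA.
have PB0 : 0 <= fine (P B) by rewrite fine_ge0.
have PBE : P B = (fine (P B))%:E by rewrite fineK// fin_num_measure.
have cT : \bigcup_(k in [set: nat]) [set: Omega] = setT.
  by rewrite -subTset => w _; exists 0%N.
have := @g_sigma_algebra_measure_unique _ R Omega G mG (fun=> setT) (fun=> GT)
  cT (mrestr P mB) (mscale (NngNum PB0) P) GI.
move=> /(_ _ _ A sA) /= PE.
rewrite -[LHS]/(mrestr P mB A) PE.
- by rewrite /mscale/= muleC -PBE.
- by move=> C GC; rewrite /mrestr /mscale/= GB// muleC; congr (_ * _)%E.
- by move=> _; rewrite /mrestr setTI ltey_eq fin_num_measure.
Qed.

Lemma independent_g_sigma (G H : set (set Omega)) :
  G setT -> setI_closed G -> G `<=` measurable ->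
  H setT -> setI_closed H -> H `<=` measurable ->
  (forall A B, G A -> H B -> P (A `&` B) = (P A * P B)%E) ->
  forall A B, <<s G >> A -> <<s H >> B -> P (A `&` B) = (P A * P B)%E.
Proof.
move=> GT GI mG HT HI mH GH A B sA sB.
have mB : measurable B by exact: (smallest_sub (@sigma_algebra_measurable _ Omega) mH).
apply: (independent_g_sigma1 GT GI mG mB _ sA) => C GC.
rewrite setIC muleC; apply: (independent_g_sigma1 HT HI mH _ _ sB) => //.
  exact: mG.
by move=> D HD; rewrite setIC muleC GH.
Qed.

End independent_pair.

Section generated_by_family.
Context {dO dV} {Omega : measurableType dO} {V : measurableType dV}
  {R : realType} {P : probability Omega R} {I : choiceType}.
Variable X : I -> {RV P >-> V}.

Definition cylinder (s : {fset I}) (A : I -> set V) : set Omega :=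
  \bigcap_(i in [set` s]) (X i @^-1` A i).

Definition cylinders (J : set I) : set (set Omega) :=
  [set B | exists s : {fset I}, [set` s] `<=` J /\
     exists2 A : I -> set V, (forall i, measurable (A i)) & B = cylinder s A].

(** The sample space with the sigma-field generated by the X i, i in J. As it is a measurable type,
    adaptedness is plain measurability from [family_sigma J]. *)
Definition family_sigma (J : set I) := g_sigma_algebraType (cylinders J).

Lemma cylindersT J : cylinders J setT.
Proof.
exists fset0; split; first by rewrite set_fset0; exact: sub0set.
exists (fun=> setT) => //.
by rewrite /cylinder set_fset0 bigcap_set0.
Qed.

(** Coordinates absent from one of the index sets are padded with the full space. *)
Lemma cylinder_fsetU (s t : {fset I}) A B :
  cylinder s A `&` cylinder t B =
  cylinder (s `|` t)%fset (fun i => (if i \in s then A i else setT) `&`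
                                    (if i \in t then B i else setT)).
Proof.
apply/seteqP; split => [w [sA tB] i /=|w st].
  rewrite in_fsetU => _; split; case: ifPn => // h; [exact: sA|exact: tB].
split=> i /= h; have := st i; rewrite /= in_fsetU h ?orbT => /(_ isT)[] //.
Qed.

Lemma cylinders_setI J : setI_closed (cylinders J).
Proof.
move=> _ _ [s [sJ [A mA ->]]] [t [tJ [B mB ->]]].
exists (s `|` t)%fset; split.
  by move=> i /=; rewrite in_fsetU => /orP[/sJ|/tJ].
rewrite cylinder_fsetU; eexists; last by reflexivity.
by move=> i; apply: measurableI; case: ifPn.
Qed.

Lemma cylinders_measurable J : cylinders J `<=` measurable.
Proof.
move=> _ [s [sJ [A mA ->]]]; rewrite /cylinder bigcap_fset.
rewrite big_seq; apply: bigsetI_measurable => i _.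
by rewrite -[X in measurable X]setTI; exact: measurable_funPT.
Qed.

Lemma family_sigma_measurable J (A : set Omega) :
  <<s cylinders J >> A -> measurable A.
Proof.
exact: (smallest_sub (@sigma_algebra_measurable _ Omega) (@cylinders_measurable J)).
Qed.

Lemma measurable_fun_family d (T : measurableType d) (J : set I)
    (f : Omega -> T) :
  measurable_fun [set: family_sigma J] f -> measurable_fun [set: Omega] f.
Proof.
move=> mf _ Y mY; apply: (@family_sigma_measurable J).
exact: (mf measurableT Y mY).
Qed.

Lemma measurable_fun_familyS d (T : measurableType d) (J K : set I)
    (f : Omega -> T) : J `<=` K ->
  measurable_fun [set: family_sigma J] f -> measurable_fun [set: family_sigma K] f.
Proof.
move=> JK mf _ Y mY; have : <<s cylinders J >> (setT `&` f @^-1` Y).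
  exact: (mf measurableT Y mY).
apply: sub_sigma_algebra2 => B [s [sJ h]]; exists s; split => //.
exact: subset_trans JK.
Qed.

Lemma measurable_family_coord (J : set I) i : J i ->
  measurable_fun [set: family_sigma J] (X i : family_sigma J -> V).
Proof.
move=> Ji _ Y mY; rewrite setTI; apply: sub_sigma_algebra.
exists [fset i]%fset; split; first by move=> j /=; rewrite inE => /eqP ->.
exists (fun=> Y) => //; apply/seteqP; split => [w Yw j/=|w].
  by rewrite inE => /eqP ->.
by apply => /=; rewrite inE.
Qed.

(** Disjointness of J and K makes the finite index sets of two cylinders disjoint, so the product
    over their union splits; cylinders form a pi-system. *)
Lemma independent_family (D J K : set I) : independent_RVs D X ->
  J `<=` D -> K `<=` D -> (forall i, J i -> K i -> False) ->
  forall A B, <<s cylinders J >> A -> <<s cylinders K >> B ->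
  P (A `&` B) = (P A * P B)%E.
Proof.
move=> iX JD KD JK; apply: independent_g_sigma; try exact: cylindersT;
  try exact: cylinders_setI; try exact: cylinders_measurable.
move=> _ _ [s [sJ [A mA ->]]] [t [tK [B mB ->]]].
have st i : i \in s -> i \notin t.
  by move=> /sJ Ji; apply/negP => /tK Ki; exact: (JK i).
rewrite cylinder_fsetU iX; last 2 first.
- by move=> i /=; rewrite in_fsetU => /orP[/sJ/JD|/tK/KD].
- by move=> i; apply: measurableI; case: ifPn.
have -> : P (cylinder s A) = (\prod_(i <- s) P (X i @^-1` A i))%E.
  by apply: iX => //; exact: subset_trans JD.
have -> : P (cylinder t B) = (\prod_(i <- t) P (X i @^-1` B i))%E.
  by apply: iX => //; exact: subset_trans KD.
have pst : perm_eq (s `|` t)%fset (enum_fset s ++ enum_fset t).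
  apply: uniq_perm; first exact: fset_uniq.
    rewrite cat_uniq !fset_uniq/= andbT; apply/hasPn => i it.
    by apply/negP => /st; rewrite it.
  by move=> i; rewrite mem_cat in_fsetU.
rewrite (perm_big _ pst)/= big_cat/=; congr (_ * _)%E.
  rewrite big_seq [RHS]big_seq; apply: eq_bigr => i si.
  by rewrite si (negbTE (st i si)) setIT.
rewrite big_seq [RHS]big_seq; apply: eq_bigr => i ti.
have -> : (i \in s) = false by apply/negP => /st; rewrite ti.
by rewrite ti setTI.
Qed.

Lemma ge0_integral_family (D J K : set I) d1 d2 (T1 : measurableType d1)
    (T2 : measurableType d2) (Y : Omega -> T1) (Z : Omega -> T2)
    (g : T1 * T2 -> \bar R) : independent_RVs D X ->
  J `<=` D -> K `<=` D -> (forall i, J i -> K i -> False) ->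
  measurable_fun [set: family_sigma J] Y ->
  measurable_fun [set: family_sigma K] Z ->
  measurable_fun [set: T1 * T2] g -> (forall z, 0 <= g z)%E ->
  (measurable_fun setT (fun w => \int[P]_w' g (Y w, Z w')) /\
  \int[P]_w g (Y w, Z w) = \int[P]_w \int[P]_w' g (Y w, Z w'))%E.
Proof.
move=> iX JD KD JK mY mZ mg g0.
apply: ge0_integral_independent => //.
- exact: measurable_fun_family mY.
- exact: measurable_fun_family mZ.
move=> A B mA mB; apply: (independent_family iX JD KD JK).
- by have := mY measurableT _ mA; rewrite setTI.
- by have := mZ measurableT _ mB; rewrite setTI.
Qed.

End generated_by_family.

(** * Geometry of an arbitrary scalar product *)

Section scalar_product.
Context {R : realType} {d : nat} (dot : {dot 'rV[R]_d for idfun}).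
Implicit Types x y z : 'rV[R]_d.
Local Notation nm := (dot_norm dot).

Lemma dotC x y : dot x y = dot y x.
Proof. by have := hermC dot x y; rewrite /= expr0 mul1r. Qed.

Lemma dotDl x y z : dot (x + y) z = dot x z + dot y z.
Proof. exact: linearDl. Qed.

Lemma dotDr x y z : dot z (x + y) = dot z x + dot z y.
Proof. exact: linearDr. Qed.

Lemma dotZl a x z : dot (a *: x) z = a * dot x z.
Proof. exact: linearZl_LR. Qed.

Lemma dotZr a x z : dot z (a *: x) = a * dot z x.
Proof. exact: linearZr_LR. Qed.

Lemma dot0l x : dot 0 x = 0. Proof. exact: linear0l. Qed.
Lemma dot0r x : dot x 0 = 0. Proof. exact: linear0r. Qed.

Lemma dot_suml (I : Type) (r : seq I) (Q : pred I) (F : I -> 'rV[R]_d) x :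
  dot (\sum_(i <- r | Q i) F i) x = \sum_(i <- r | Q i) dot (F i) x.
Proof. by elim/big_rec2: _ => [|i a b _ <-]; rewrite ?dot0l ?dotDl. Qed.

Lemma dot_sumr (I : Type) (r : seq I) (Q : pred I) (F : I -> 'rV[R]_d) x :
  dot x (\sum_(i <- r | Q i) F i) = \sum_(i <- r | Q i) dot x (F i).
Proof. by rewrite dotC dot_suml; apply: eq_bigr => i _; rewrite dotC. Qed.

Lemma dot_ge0 x : 0 <= dot x x.
Proof.
have [->|x0] := eqVneq x 0; first by rewrite dot0l.
by rewrite ltW// neq0_dnorm_gt0.
Qed.

Lemma dot_norm_ge0 x : 0 <= nm x. Proof. exact: sqrtr_ge0. Qed.

Lemma dot_norm_sqr x : nm x ^+ 2 = dot x x.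
Proof. by rewrite sqr_sqrtr// dot_ge0. Qed.

Lemma dot_norm0 : nm 0 = 0.
Proof. by rewrite /dot_norm dot0l sqrtr0. Qed.

Lemma dot_normZ a x : nm (a *: x) = `|a| * nm x.
Proof.
by rewrite /dot_norm dotZl dotZr mulrA -expr2 sqrtrM ?sqr_ge0// sqrtr_sqr.
Qed.

(** Expands the square of <y,y> x - <x,y> y, which avoids dividing by <y,y>. *)
Lemma dot_cauchy_schwarz x y : `|dot x y| <= nm x * nm y.
Proof.
have [->|y0] := eqVneq y 0; first by rewrite dot0r normr0 dot_norm0 mulr0.
have yy : 0 < dot y y by exact: neq0_dnorm_gt0.
have := dot_ge0 (dot y y *: x - dot x y *: y).
rewrite -scaleNr !(dotDl, dotDr, dotZl, dotZr) (dotC y x) => h.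
have {}h : dot x y ^+ 2 <= dot x x * dot y y.
  rewrite -(ler_pM2l yy); nra.
rewrite /dot_norm -sqrtrM ?dot_ge0// -sqrtr_sqr ler_wsqrtr//.
Qed.

Lemma dot_le x y : dot x y <= nm x * nm y.
Proof. exact: le_trans (ler_norm _) (dot_cauchy_schwarz x y). Qed.

Lemma dot_norm_triangle x y : nm (x + y) <= nm x + nm y.
Proof.
rewrite -(ler_pXn2r (ltn0Sn 1)) ?nnegrE ?addr_ge0 ?dot_norm_ge0//.
rewrite dot_norm_sqr dotDl !dotDr (dotC y x).
have := dot_le x y; have := dot_norm_sqr x; have := dot_norm_sqr y.
rewrite !expr2 => <- <-; nra.
Qed.

Lemma dot_norm_sum (I : Type) (r : seq I) (Q : pred I) (F : I -> 'rV[R]_d) :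
  nm (\sum_(i <- r | Q i) F i) <= \sum_(i <- r | Q i) nm (F i).
Proof.
elim/big_rec2: _ => [|i a b _ h]; first by rewrite dot_norm0.
by rewrite (le_trans (dot_norm_triangle _ _))// lerD2l.
Qed.

(** Expansion by the Gram matrix; it reduces measurability of the scalar product to that of the
    coordinates. *)
Lemma dot_coords x y : dot x y =
  \sum_(i < d) \sum_(j < d) x ord0 i * y ord0 j *
    dot (delta_mx 0 i) (delta_mx 0 j).
Proof.
rewrite {1}(row_sum_delta x) dot_suml; apply: eq_bigr => i _.
rewrite {1}(row_sum_delta y) dot_sumr; apply: eq_bigr => j _.
by rewrite dotZl dotZr mulrA.
Qed.

End scalar_product.

(** * Measurability of vector-valued maps and of random indices *)

Section measurability.
Context {dT} {T : measurableType dT} {R : realType} {d : nat}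
  (dot : {dot 'rV[R]_d for idfun}).
Implicit Types (f g : T -> 'rV[R]_d) (a b : T -> R).
Local Notation nm := (dot_norm dot).

Lemma measurable_fun_rV f :
  (forall i, measurable_fun [set: T] (fun t => f t ord0 i)) ->
  measurable_fun [set: T] f.
Proof.
move=> mf _ A mA; rewrite setTI.
have mS : sigma_algebra setT [set A : set 'rV[R]_d | measurable (f @^-1` A)].
  split => /=.
  - by rewrite preimage_set0.
  - by move=> X mX; rewrite setTD preimage_setC; exact: measurableC.
  - by move=> X mX; rewrite preimage_bigcup; exact: bigcupT_measurable.
apply: (smallest_sub mS _ mA) => B.
elim/big_rec : _ => // i S _ IH [[C mC <-]|/IH//] /=.
by rewrite setTI; have := mf i measurableT _ mC; rewrite setTI.
Qed.

Lemma measurable_fun_coord f i : measurable_fun [set: T] f ->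
  measurable_fun [set: T] (fun t => f t ord0 i).
Proof. exact: measurableT_comp (measurable_rV_coord _). Qed.

Lemma measurable_rV_add f g : measurable_fun [set: T] f ->
  measurable_fun [set: T] g -> measurable_fun [set: T] (fun t => f t + g t).
Proof.
move=> mf mg; apply: measurable_fun_rV => i; under eq_fun do rewrite mxE.
by apply: measurable_funD; exact: measurable_fun_coord.
Qed.

Lemma measurable_rV_scale a f : measurable_fun [set: T] a ->
  measurable_fun [set: T] f -> measurable_fun [set: T] (fun t => a t *: f t).
Proof.
move=> ma mf; apply: measurable_fun_rV => i; under eq_fun do rewrite mxE.
by apply: measurable_funM => //; exact: measurable_fun_coord.
Qed.

Lemma measurable_rV_opp f : measurable_fun [set: T] f ->
  measurable_fun [set: T] (fun t => - f t).
Proof.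
move=> mf; under eq_fun do rewrite -scaleN1r.
exact: measurable_rV_scale.
Qed.

Lemma measurable_rV_sub f g : measurable_fun [set: T] f ->
  measurable_fun [set: T] g -> measurable_fun [set: T] (fun t => f t - g t).
Proof.
by move=> mf mg; apply: measurable_rV_add => //; exact: measurable_rV_opp.
Qed.

Lemma measurable_rV_sum (I : eqType) (r : seq I) (F : I -> T -> 'rV[R]_d) :
  (forall i, i \in r -> measurable_fun [set: T] (F i)) ->
  measurable_fun [set: T] (fun t => \sum_(i <- r) F i t).
Proof.
elim: r => [_|i r IH mF].
  by under eq_fun do rewrite big_nil; exact: measurable_cst.
under eq_fun do rewrite big_cons; apply: measurable_rV_add.
  by apply: mF; rewrite mem_head.
by apply: IH => j jr; apply: mF; rewrite in_cons jr orbT.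
Qed.

Lemma measurable_dot f g : measurable_fun [set: T] f ->
  measurable_fun [set: T] g -> measurable_fun [set: T] (fun t => dot (f t) (g t)).
Proof.
move=> mf mg; under eq_fun do rewrite dot_coords.
apply: measurable_sum => i; apply: measurable_sum => j.
by apply: measurable_funM => //; apply: measurable_funM; exact: measurable_fun_coord.
Qed.

Lemma measurable_dot_norm f : measurable_fun [set: T] f ->
  measurable_fun [set: T] (fun t => nm (f t)).
Proof.
move=> mf; rewrite /dot_norm.
under eq_fun do rewrite -powR12_sqrt ?dot_ge0//.
apply: (measurableT_comp (measurable_powR _)).
exact: measurable_dot.
Qed.

(** Handles sums whose length depends on the parameter, such as the number of levels or of samples:
    the domain is cut into the countably many sets where N is constant. *)
Lemma measurable_nat_choice dY (Y : measurableType dY) (N : T -> nat)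
    (h : nat -> T -> Y) :
  measurable_fun [set: T] N -> (forall n, measurable_fun [set: T] (h n)) ->
  measurable_fun [set: T] (fun t => h (N t) t).
Proof.
move=> mN mh _ A mA; rewrite setTI.
have -> : (fun t => h (N t) t) @^-1` A =
    \bigcup_n (N @^-1` [set n] `&` h n @^-1` A).
  by apply/seteqP; split => [t At|t [n _ [/= <-]]//]; exists (N t).
apply: bigcupT_measurable => n; apply: measurableI.
  by rewrite -[X in measurable X]setTI; exact: mN.
by rewrite -[X in measurable X]setTI; exact: mh.
Qed.

Lemma measurable_fun_nat (N : T -> nat) :
  (forall n, measurable (N @^-1` [set n])) -> measurable_fun [set: T] N.
Proof.
move=> mN _ A _; rewrite setTI.
have -> : N @^-1` A = \bigcup_(n in A) (N @^-1` [set n]).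
  by apply/seteqP; split => [t At|t [n An /= ->]//]; exists (N t).
exact: bigcup_measurable.
Qed.

(** The fibres of a monotone function are intervals; this covers roundings. *)
Lemma measurable_fun_monotone_nat (phi : R -> nat) a :
  {homo phi : x y / x <= y >-> (x <= y)%N} -> measurable_fun [set: T] a ->
  measurable_fun [set: T] (phi \o a).
Proof.
move=> ndphi ma; apply: measurable_fun_nat => n.
rewrite -[X in measurable X]setTI comp_preimage; apply: ma => //.
apply: is_interval_measurable => x y /= <- pyn z /andP[xz zy].
by apply/eqP; rewrite eqn_leq -{1}pyn !ndphi.
Qed.

End measurability.

(** * Power inequalities for the recursion and for Doob's argument *)

Section recursion_inequalities.
Context {R : realType}.
Implicit Types (p q x y : R).

Lemma le_powR q x y : 0 <= q -> 0 <= x -> x <= y -> x `^ q <= y `^ q.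
Proof.
by move=> q0 x0 xy; apply: ge0_ler_powR; rewrite ?nnegrE// (le_trans x0).
Qed.

Lemma le_powRN a x y : 0 <= a -> 0 < x -> x <= y -> y `^ (- a) <= x `^ (- a).
Proof.
move=> a0 x0 xy; rewrite !powRN lef_pV2 ?posrE ?powR_gt0 ?(lt_le_trans x0)//.
exact: le_powR (ltW x0) xy.
Qed.

Lemma powR_ge1 a x : 1 <= x -> 0 <= a -> 1 <= x `^ a.
Proof. by move=> x1 a0; have := ler_powR x1 a0; rewrite powRr0. Qed.

Lemma powRV a x : 0 <= x -> x^-1 `^ a = (x `^ a)^-1.
Proof. by move=> x0; rewrite -powR_inv1// -powRrM mulN1r powRN. Qed.

(** Jensen's inequality with weights that need not sum to 1. The moment recursion uses it with w1 +
    w2 < 1, where (w1 + w2)^(q-1) is part of the contraction and must be kept. *)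
Lemma powR_weighted2 q w1 w2 x y : 1 <= q -> 0 <= w1 -> 0 <= w2 -> 0 < w1 + w2 ->
  0 <= x -> 0 <= y ->
  (w1 * x + w2 * y) `^ q <= (w1 + w2) `^ (q - 1) * (w1 * x `^ q + w2 * y `^ q).
Proof.
move=> q1 w10 w20 W0 x0 y0; have q0 : 0 < q by exact: lt_le_trans q1.
pose W := w1 + w2.
have := @powR_jensen R bool [:: true; false] (fun b => (if b then w1 else w2) / W)
  (fun b => if b then x else y) q q1.
rewrite !big_cons !big_nil !addr0 /=.
have h (a : R) : 0 <= a -> 0 <= a / W by move=> a0; rewrite divr_ge0// ltW.
have hw b : b \in [:: true; false] -> 0 <= (if b then w1 else w2) / W.
  by move=> _; apply: h; case: b.
have ha b : b \in [:: true; false] -> 0 <= if b then x else y by case: b.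
move=> /(_ hw ha); rewrite -mulrDl divff ?gt_eqF// => /(_ erefl).
have -> : w1 * x + w2 * y = W * (w1 / W * x + w2 / W * y).
  by rewrite /W; field; rewrite gt_eqF.
have z0 : 0 <= w1 / W * x + w2 / W * y by rewrite addr_ge0// mulr_ge0// h.
rewrite powRM// ?(ltW W0)// => /(ler_wpM2l (powR_ge0 W q)) /le_trans; apply.
rewrite -(mulr_powRB1 (ltW W0) q0) le_eqVlt; apply/orP; left; apply/eqP.
by rewrite -/W; field; rewrite gt_eqF.
Qed.

Lemma powR_add_le q x y : 1 <= q -> 0 <= x -> 0 <= y ->
  (x + y) `^ q <= 2 `^ (q - 1) * (x `^ q + y `^ q).
Proof.
move=> q1 x0 y0; have := powR_weighted2 q1 ler01 ler01 (addr_gt0 ltr01 ltr01) x0 y0.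
by rewrite !mul1r.
Qed.

(* With [m] the running maximum of a nonnegative submartingale and [s] its next
   value, this makes E[(p-1)/p m^p - m^(p-1) s] nonincreasing in time, from
   which Doob's maximal inequality follows by [doob_young]. *)
Lemma doob_step p m s : 1 < p -> 0 <= m -> 0 <= s ->
  (p - 1) / p * Num.max m s `^ p + m `^ (p - 1) * s <=
  (p - 1) / p * m `^ p + Num.max m s `^ (p - 1) * s.
Proof.
move=> p1 m0 s0; have p0 : 0 < p by lra.
have [sm|ms] := leP m s; last by [].
rewrite [s `^ (p - 1) * s]mulrC (mulr_powRB1 s0 p0).
rewrite -subr_ge0.
have -> : (p - 1) / p * m `^ p + s `^ p - ((p - 1) / p * s `^ p + m `^ (p - 1) * s) =
    p^-1 * (s `^ p + (p - 1) * m `^ p - p * m `^ (p - 1) * s).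
  by field; rewrite gt_eqF.
by rewrite mulr_ge0 ?invr_ge0 ?(ltW p0)// subr_ge0 powR_tangent// ltW.
Qed.

(** The tangent at m is evaluated at 2 s and halved. The doubling leaves only (p - 1) / 2 in front
    of m^p, half of what the potential argument provides, so this term can be absorbed. *)
Lemma doob_young p m s : 1 < p -> 0 <= m -> 0 <= s ->
  p * m `^ (p - 1) * s <= 2 `^ (p - 1) * s `^ p + (p - 1) / 2 * m `^ p.
Proof.
move=> p1 m0 s0; have p0 : 0 < p by lra.
have := powR_tangent (ltW p1) (mulr_ge0 (ler0n R 2) s0) m0.
rewrite powRM// -(mulr_powRB1 (ler0n R 2) p0); lra.
Qed.

End recursion_inequalities.

(** * Drift of a single step *)

Section drift.
Context {R : realType} {d : nat} (dot : {dot 'rV[R]_d for idfun}).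
Variables (f : 'rV[R]_d -> 'rV[R]_d) (ts : 'rV[R]_d) (L L' : R).
Hypotheses (L0 : 0 < L) (L'0 : 0 < L')
  (f_mon : forall t, dot (t - ts) (f t) <= - L * dot_norm dot (t - ts) ^+ 2)
  (f_bnd : forall t, dot (t - ts) (f t) <= - L' * dot_norm dot (f t) ^+ 2).
Local Notation nm := (dot_norm dot).

(** L' |f|^2 <= - <t - ts, f> <= |t - ts| |f|, divided by |f|. *)
Lemma drift_lipschitz t : nm (f t) <= nm (t - ts) / L'.
Proof.
rewrite ler_pdivlMr//.
have [->|f0] := eqVneq (nm (f t)) 0; first by rewrite mul0r dot_norm_ge0.
have f_gt0 : 0 < nm (f t) by rewrite lt_neqAle eq_sym f0 dot_norm_ge0.
have := dot_cauchy_schwarz dot (t - ts) (f t).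
rewrite ler_norml => /andP[+ _].
have := f_bnd t => h1 h2; rewrite -(ler_pM2r f_gt0); lra.
Qed.

Lemma dot_norm_sqr_add x y e : 0 < e ->
  nm (x + y) ^+ 2 <= (1 + e) * nm x ^+ 2 + (1 + e^-1) * nm y ^+ 2.
Proof.
move=> e0; rewrite !dot_norm_sqr dotDl !dotDr (dotC _ y x).
have h : dot (e *: x - y) (e *: x - y) =
    e * (e * dot x x - 2 * dot x y + e^-1 * dot y y).
  rewrite -scaleN1r !(dotDl, dotDr, dotZl, dotZr) (dotC _ y x).
  by field; rewrite gt_eqF.
have := dot_ge0 dot (e *: x - y); rewrite h pmulr_rge0//.
lra.
Qed.

(** Valid for every step size, hence also for the early steps that [drift_contraction] leaves out;
    it serves to show that all moments are finite. *)
Lemma drift_crude g t h e : 0 <= g -> nm (h - f t) <= e ->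
  nm (t - ts + g *: h) <= (1 + g / L') * nm (t - ts) + g * e.
Proof.
move=> g0 he; apply: le_trans (dot_norm_triangle _ _ _) _.
rewrite mulrDl mul1r -addrA lerD2l dot_normZ ger0_norm// -mulrA -mulrDr ler_wpM2l//.
have -> : h = f t + (h - f t) by rewrite addrC subrK.
apply: le_trans (dot_norm_triangle _ _ _) _; apply: lerD => //.
by rewrite mulrC drift_lipschitz.
Qed.

(** The unbiased step contracts squares at rate 2 L g0 / n up to order n^(-2). The slack D between
    that rate and b pays for this correction and for Young's inequality, which splits off the
    bias. *)
Lemma drift_contraction g0 b : 0 < g0 -> b < 2 * L * g0 ->
  exists2 c : R, 0 <= c & exists n0 : nat, forall n : nat, (n0 <= n)%N ->
    forall t h e, nm (h - f t) <= e ->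
    nm (t - ts + (g0 / n.+1%:R) *: h) ^+ 2 <=
      (1 - b / n.+1%:R) * nm (t - ts) ^+ 2 + c * (e ^+ 2 / n.+1%:R).
Proof.
move=> g00 bA; pose D := 2 * L * g0 - b; have D0 : 0 < D by rewrite subr_gt0.
pose K := L / L' * g0 ^+ 2; have K0 : 0 < K by rewrite mulr_gt0 ?divr_gt0 ?exprn_gt0.
(* Equals (1 + 1/dl) g0^2 x, for the weight dl = D x / 4 chosen below, with x <= 1 inserted. *)
exists ((1 + 4 / D) * g0 ^+ 2).
  by rewrite mulr_ge0 ?sqr_ge0// addr_ge0// divr_ge0// ltW.
(* The three summands ensure K x <= 1, 2 K x <= D and g0 x <= L' for x = 1/(n+1). *)
exists (Num.truncn (K + 2 * K / D + g0 / L')) => n nn t h e he.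
have KD0 : 0 <= 2 * K / D by apply/ltW/divr_gt0 => //; exact: mulr_gt0.
have gL0 : 0 <= g0 / L' by apply/ltW/divr_gt0.
have nB : K + 2 * K / D + g0 / L' <= n.+1%:R.
  have := truncn_itv (x := K + 2 * K / D + g0 / L').
  have -> : 0 <= K + 2 * K / D + g0 / L'.
    by rewrite addr_ge0// addr_ge0// ltW.
  move=> /(_ isT)/andP[_ hlt]; apply: ltW; apply: lt_le_trans hlt _.
  by rewrite ler_nat ltnS.
set x := n.+1%:R^-1 : R.
have n_gt0 : 0 < n.+1%:R :> R by rewrite ltr0n.
have x0 : 0 < x by rewrite invr_gt0.
have nx : n.+1%:R * x = 1 by rewrite divff ?gt_eqF.
have x1 : x <= 1 by rewrite invf_le1// ler1n.
have Kx : K * x <= 1.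
  by rewrite -[leRHS]nx ler_pM2r//; lra.
have Kx2 : 2 * (K * x) <= D.
  have : 2 * K / D * x <= 1 by rewrite -[leRHS]nx ler_pM2r//; lra.
  by rewrite mulrAC ler_pdivrMr// mul1r mulrA.
have gx : g0 * x <= L'.
  have : g0 / L' * x <= 1 by rewrite -[leRHS]nx ler_pM2r//; lra.
  by rewrite mulrAC ler_pdivrMr// mul1r.
pose g := g0 * x; have g_gt0 : 0 < g by rewrite mulr_gt0.
set s := nm (t - ts) ^+ 2; have s0 : 0 <= s by exact: sqr_ge0.
have z_le : nm (t - ts + g *: f t) ^+ 2 <= (1 - 2 * L * g0 * x + K * x ^+ 2) * s.
  have -> : nm (t - ts + g *: f t) ^+ 2 =
      s + 2 * g * dot (t - ts) (f t) + g ^+ 2 * nm (f t) ^+ 2.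
    rewrite /s !dot_norm_sqr; move: (t - ts) (f t) => a y.
    by rewrite !(dotDl, dotDr, dotZl, dotZr) (dotC _ y a); ring.
  (* The second condition on f trades |f|^2 for the scalar product, at the price of a small part of
     its coefficient 2 g, which stays nonnegative since g <= L'. *)
  have h1 : g ^+ 2 * nm (f t) ^+ 2 <= - (g ^+ 2 / L') * dot (t - ts) (f t).
    have -> : - (g ^+ 2 / L') * dot (t - ts) (f t) =
      g ^+ 2 * (- dot (t - ts) (f t) / L') by ring.
    rewrite ler_wpM2l ?sqr_ge0// ler_pdivlMr//.
    by have := f_bnd t; lra.
  have h2 : (2 * g - g ^+ 2 / L') * dot (t - ts) (f t) <=
            (2 * g - g ^+ 2 / L') * (- L * s).
    apply: ler_wpM2l; last exact: f_mon.
    rewrite subr_ge0 ler_pdivrMr//.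
    have : g * g <= g * L' by rewrite ler_wpM2l// ltW.
    have : 0 < g * L' by rewrite mulr_gt0.
    lra.
  have -> : (1 - 2 * L * g0 * x + K * x ^+ 2) * s =
    s + (2 * g - g ^+ 2 / L') * (- L * s).
    by rewrite /K /g; field; rewrite gt_eqF.
  lra.
(* The slack D x is spent as D x / 4 on dl itself, D x / 2 on K x^2 and D x / 4 on their product. *)
pose dl := D * x / 4; have dl0 : 0 < dl by rewrite divr_gt0 ?mulr_gt0.
have -> : t - ts + (g0 / n.+1%:R) *: h = (t - ts + g *: f t) + g *: (h - f t).
  by rewrite scalerBr -[RHS]addrA [X in _ = _ + X]addrC subrK.
apply: le_trans (dot_norm_sqr_add _ _ dl0) _; apply: lerD.
  apply: le_trans (ler_wpM2l _ z_le) _; first by rewrite addr_ge0// ltW.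
  rewrite mulrA ler_wpM2r// -/x /dl.
  have -> : b = 2 * L * g0 - D by rewrite /D; ring.
  have := mulr_ge0 (mulr_ge0 (ltW D0) (ltW x0)) (mulr_ge0 (mulr_ge0 (ltW L0) (ltW g00)) (ltW x0)).
  have : D * x * (K * x * x) <= D * x * 1.
    apply: ler_wpM2l; first by apply: mulr_ge0; exact: ltW.
    by apply: mulr_ile1 => //; [apply: mulr_ge0; exact: ltW|exact: ltW].
  have := ler_wpM2r (ltW x0) Kx2.
  lra.
rewrite dot_normZ (gtr0_norm g_gt0) exprMn.
have hh : nm (h - f t) ^+ 2 <= e ^+ 2.
  by rewrite ler_pXn2r// ?nnegrE ?dot_norm_ge0// (le_trans (dot_norm_ge0 _ _) he).
have -> : (1 + dl^-1) * (g ^+ 2 * nm (h - f t) ^+ 2) =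
    (x + 4 / D) * g0 ^+ 2 * (nm (h - f t) ^+ 2 * x).
  by rewrite /dl /g; field; rewrite !gt_eqF.
apply: ler_pM.
- by rewrite mulr_ge0 ?sqr_ge0// addr_ge0 ?divr_ge0// ltW.
- by rewrite mulr_ge0 ?sqr_ge0// ltW.
- by rewrite ler_wpM2r ?sqr_ge0// lerD2r.
- by rewrite ler_wpM2r// ltW.
Qed.

End drift.

(** * Moments of centered random vectors *)

Section vector_expectation.
Context {dO} {Omega : measurableType dO} {R : realType}
  (P : probability Omega R) {d : nat}.
Implicit Types X Y : Omega -> 'rV[R]_d.

Lemma vintegrable_cst (x : 'rV[R]_d) : vintegrable P (fun=> x).
Proof. by move=> i; exact: finite_measure_integrable_cst. Qed.

Lemma vintegrableD X Y : vintegrable P X -> vintegrable P Y ->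
  vintegrable P (fun w => X w + Y w).
Proof.
move=> iX iY i; under eq_fun do rewrite mxE EFinD.
by apply: integrableD.
Qed.

Lemma vintegrableZ a X : vintegrable P X -> vintegrable P (fun w => a *: X w).
Proof.
move=> iX i; under eq_fun do rewrite mxE EFinM.
by apply: integrableZl => //; exact: iX.
Qed.

Lemma vintegrableB X Y : vintegrable P X -> vintegrable P Y ->
  vintegrable P (fun w => X w - Y w).
Proof.
move=> iX iY; apply: vintegrableD => //.
by under eq_fun do rewrite -scaleN1r; exact: vintegrableZ.
Qed.

Lemma vexpectation_cst (x : 'rV[R]_d) : vexpectation P (fun=> x) = x.
Proof.
by apply/rowP => i; rewrite mxE (expectation_cst P (x ord0 i)).
Qed.

Lemma vexpectationD X Y : vintegrable P X -> vintegrable P Y ->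
  vexpectation P (fun w => X w + Y w) = vexpectation P X + vexpectation P Y.
Proof.
move=> iX iY; apply/rowP => i; rewrite !mxE unlock.
under eq_integral do rewrite mxE EFinD.
rewrite integralD// 1?fineD//; by apply: integrable_fin_num.
Qed.

Lemma vexpectationZ a X : vintegrable P X ->
  vexpectation P (fun w => a *: X w) = a *: vexpectation P X.
Proof.
move=> iX; apply/rowP => i; rewrite !mxE unlock.
under eq_integral do rewrite mxE EFinM.
by rewrite integralZl// 1?fineM//; exact: integrable_fin_num.
Qed.

Lemma vexpectationB X Y : vintegrable P X -> vintegrable P Y ->
  vexpectation P (fun w => X w - Y w) = vexpectation P X - vexpectation P Y.
Proof.
move=> iX iY; under eq_fun do rewrite -scaleN1r.
by rewrite vexpectationD ?vexpectationZ ?scaleN1r//; exact: vintegrableZ.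
Qed.

Definition centered Y := vintegrable P Y /\ vexpectation P Y = 0.

Lemma centeredZ a Y : centered Y -> centered (fun w => a *: Y w).
Proof.
move=> [iY Y0]; split; first exact: vintegrableZ.
by rewrite vexpectationZ// Y0 scaler0.
Qed.

Lemma centeredD X Y : centered X -> centered Y ->
  centered (fun w => X w + Y w).
Proof.
move=> [iX X0] [iY Y0]; split; first exact: vintegrableD.
by rewrite vexpectationD// X0 Y0 addr0.
Qed.

Lemma centered_sum (I : eqType) (r : seq I) (Y : I -> Omega -> 'rV[R]_d) :
  (forall i, i \in r -> centered (Y i)) ->
  centered (fun w => \sum_(i <- r) Y i w).
Proof.
elim: r => [_|i r IH cY].
  under eq_fun do rewrite big_nil.
  by split; [exact: vintegrable_cst|rewrite vexpectation_cst].
under eq_fun do rewrite big_cons; apply: centeredD.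
  by apply: cY; rewrite mem_head.
by apply: IH => j jr; apply: cY; rewrite in_cons jr orbT.
Qed.

Variable dot : {dot 'rV[R]_d for idfun}.
Local Notation nm := (dot_norm dot).

Lemma vintegrable_measurable Y : vintegrable P Y -> measurable_fun [set: Omega] Y.
Proof.
move=> iY; apply: measurable_fun_rV => i.
by have /measurable_int/measurable_EFinP := iY i.
Qed.

Lemma integrable_dot x Y : vintegrable P Y ->
  P.-integrable setT (fun w => (dot x (Y w))%:E).
Proof.
move=> iY; under eq_fun do rewrite (row_sum_delta (Y _)) dot_sumr -sumEFin.
apply: integrable_sum => // i _; under eq_fun do rewrite dotZr mulrC EFinM.
by apply: integrableZl => //; exact: iY.
Qed.

Lemma integral_dot x Y : vintegrable P Y ->
  (\int[P]_w (dot x (Y w))%:E = (dot x (vexpectation P Y))%:E)%E.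
Proof.
move=> iY; under eq_integral do rewrite (row_sum_delta (Y _)) dot_sumr -sumEFin.
rewrite integral_sum//; last first.
  move=> i; under eq_fun do rewrite dotZr mulrC EFinM.
  by apply: integrableZl => //; exact: iY.
rewrite (row_sum_delta (vexpectation P Y)) dot_sumr -sumEFin; apply: eq_bigr => i _.
under eq_integral do rewrite dotZr mulrC EFinM.
rewrite integralZl; [|exact: measurableT|exact: iY].
by rewrite dotZr mulrC EFinM mxE unlock fineK// integrable_fin_num.
Qed.

Lemma integrable_dot_norm Y : vintegrable P Y ->
  P.-integrable setT (fun w => (nm (Y w))%:E).
Proof.
move=> iY.
have iS : P.-integrable setT (fun w => (\sum_(i < d) `|Y w ord0 i| * nm (delta_mx 0 i))%:E).
  under eq_fun do rewrite -sumEFin.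
  apply: integrable_sum => // i _; under eq_fun do rewrite mulrC EFinM.
  apply: integrableZl => //.
  by have := integrable_abse (iY i).
apply: le_integrable iS => //.
  by apply/measurable_EFinP/measurable_dot_norm/vintegrable_measurable.
move=> w _; rewrite !abse_EFin lee_fin ger0_norm ?dot_norm_ge0//.
apply: le_trans (ler_norm _); rewrite {1}(row_sum_delta (Y w)).
apply: le_trans (dot_norm_sum _ _ _ _) _.
by apply: ler_sum => i _; rewrite dot_normZ.
Qed.

(** Jensen's inequality for the norm by duality: |x|^2 = E <x, x + Y> <= |x| E |x + Y|. It is the
    source of the submartingale property in Doob's inequality. *)
Lemma centered_dot_norm_le x Y : centered Y ->
  ((nm x)%:E <= \int[P]_w (nm (x + Y w))%:E)%E.
Proof.
move=> [iY Y0].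
have ixY : vintegrable P (fun w => x + Y w).
  by apply: vintegrableD => //; exact: vintegrable_cst.
have [->|x0] := eqVneq (nm x) 0.
  by apply: integral_ge0 => w _; rewrite lee_fin dot_norm_ge0.
have x_gt0 : 0 < nm x by rewrite lt_neqAle eq_sym x0 dot_norm_ge0.
rewrite -(@lee_pmul2l _ (nm x)%:E) ?lte_fin// -ge0_integralZl//; first last.
- by rewrite lee_fin dot_norm_ge0.
- by move=> w _; rewrite lee_fin dot_norm_ge0.
- by apply/measurable_EFinP/measurable_dot_norm/vintegrable_measurable.
have -> : ((nm x)%:E * (nm x)%:E = \int[P]_w (dot x (x + Y w))%:E)%E.
  rewrite integral_dot// vexpectationD//; last exact: vintegrable_cst.
  by rewrite vexpectation_cst Y0 addr0 -dot_norm_sqr expr2 EFinM.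
apply: le_integral => //.
- exact: integrable_dot.
- by apply: integrableZl => //; exact: integrable_dot_norm.
by move=> w _; rewrite -EFinM lee_fin dot_le.
Qed.

Variable q : R.
Hypothesis q1 : 1 <= q.
Let q0 : 0 < q. Proof. exact: lt_le_trans q1. Qed.

(* The constant [c] absorbs the variance proxies of the terms already treated,
   so that the bound can be iterated over a sum of independent terms. *)
Lemma centered_moment_step x c Y tau : 0 <= c -> 0 < tau -> centered Y ->
  (\int[P]_w ((nm (Y w) ^+ 2) `^ q)%:E <= (tau `^ q)%:E)%E ->
  (\int[P]_w ((nm (x + Y w) ^+ 2 + c) `^ q)%:E <=
   ((nm x ^+ 2 + c + 2 * moment_const q * tau) `^ q)%:E)%E.
Proof.
move=> c0 tau0 [iY Y0] Ytau; have mY := vintegrable_measurable iY.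
pose C := moment_const q; have C1 : 1 <= C by exact: moment_const_ge1.
pose a := nm x ^+ 2 + c; have a0 : 0 <= a by rewrite addr_ge0// sqr_ge0.
pose W w : R := (nm (Y w) ^+ 2) `^ q.
have W0 w : 0 <= W w by exact: powR_ge0.
have mW : measurable_fun setT W.
  apply: (measurableT_comp (measurable_powR _)); apply: measurable_funX.
  exact: measurable_dot_norm.
have iW : P.-integrable setT (EFin \o W).
  apply/integrableP; split; first exact/measurable_EFinP.
  under eq_integral do rewrite /= ger0_norm//.
  exact: le_lt_trans Ytau (ltry _).
pose t1 := tau `^ (q - 1); have t10 : 0 < t1 by exact: powR_gt0.
have tt1 : tau * t1 = tau `^ q by rewrite mulr_powRB1// ltW.
(* Coefficients of a pointwise bound k + l <x, Y> + b |Y|^(2q). The square |Y|^2 is replaced by its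
   tangent bound at tau, so only the q-th moment of |Y|^2 is needed; the choice of tau makes the
   integrated bound match [powR_absorb] exactly. *)
pose k := a `^ q + C * (a `^ (q - 1) * ((q - 1) * tau / q)).
pose l := 2 * q * a `^ (q - 1).
pose b := C * (a `^ (q - 1) / (q * t1) + 1).
have b0 : 0 <= b.
  rewrite mulr_ge0//; first exact: le_trans C1.
  by rewrite addr_ge0// divr_ge0 ?powR_ge0// mulr_ge0// ltW.
have pw w : (nm (x + Y w) ^+ 2 + c) `^ q <= k + l * dot x (Y w) + b * W w.
  have -> : nm (x + Y w) ^+ 2 + c = a + 2 * dot x (Y w) + nm (Y w) ^+ 2.
    by rewrite /a !dot_norm_sqr dotDl !dotDr (dotC _ (Y w) x); ring.
  have zle : `|dot x (Y w)| <= Num.sqrt a * nm (Y w).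
    apply: le_trans (dot_cauchy_schwarz _ _ _) _; rewrite ler_wpM2r ?dot_norm_ge0//.
    by rewrite -[leLHS]ger0_norm ?dot_norm_ge0// -sqrtr_sqr ler_wsqrtr// lerDl.
  apply: le_trans (powR_second_order q1 a0 (dot_norm_ge0 dot _) zle) _.
  rewrite -/C -/(W w) /k /l /b.
  have := powR_tangent q1 (sqr_ge0 (nm (Y w))) (ltW tau0).
  rewrite -/(W w) -tt1 -/t1 => h.
  have {}h : nm (Y w) ^+ 2 <= W w / (q * t1) + (q - 1) * tau / q.
    rewrite -(ler_pM2l (mulr_gt0 q0 t10)) (le_trans h)// mulrDr.
    rewrite [_ * (W w / _)]mulrC divfK ?gt_eqF ?mulr_gt0// lerD2l.
    by rewrite le_eqVlt; apply/orP; left; apply/eqP; field; rewrite gt_eqF.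
  have := ler_wpM2l (mulr_ge0 (le_trans ler01 C1) (powR_ge0 a (q - 1))) h.
  lra.
have iD := integrable_dot x iY.
have mL : measurable_fun setT (fun w => (nm (x + Y w) ^+ 2 + c) `^ q).
  apply: (measurableT_comp (measurable_powR _)); apply: measurable_funD => //.
  by apply: measurable_funX; apply: measurable_dot_norm; exact: measurable_rV_add.
apply: (@le_trans _ _ (\int[P]_w (k%:E + (l%:E * (dot x (Y w))%:E + b%:E * (W w)%:E)))%E).
  apply: ge0_le_integral => //.
  - by move=> w _; rewrite lee_fin powR_ge0.
  - exact/measurable_EFinP.
  - apply: emeasurable_funD => //; apply: emeasurable_funD; apply: measurable_funeM.
      exact: measurable_int iD.
    exact/measurable_EFinP.
  - by move=> w _; rewrite -!EFinM -!EFinD lee_fin addrA.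
have ik : P.-integrable setT (fun=> k%:E) by exact: finite_measure_integrable_cst.
have i1 := integrableZl measurableT l iD.
have i2 := integrableZl measurableT b iW.
rewrite integralD//; last exact: integrableD.
rewrite integralD// integral_cst// integralZl// integralZl// integral_dot//.
rewrite Y0 dot0r mule0 add0e /= probability_setT mule1.
apply: (@le_trans _ _ (k%:E + b%:E * (tau `^ q)%:E)%E).
  by rewrite leeD2l// lee_pmul2l// lte_fin// mulr_gt0// ?(lt_le_trans _ C1)//;
    rewrite ltr_wpDl// divr_ge0 ?powR_ge0// mulr_ge0// ltW.
rewrite -EFinM -EFinD lee_fin.
apply: le_trans (powR_absorb q1 C1 a0 (ltW tau0)).
rewrite /k /b -tt1 le_eqVlt; apply/orP; left; apply/eqP.
by field; rewrite !gt_eqF.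
Qed.

End vector_expectation.

(** * Expectations depending on a parameter, and equality in law *)

Section expectation_parameter.
Context {dO dV} {Omega : measurableType dO} {V : measurableType dV}
  {R : realType} (P : probability Omega R).

(** Tonelli's theorem is applied to the positive and the negative part separately, so no
    integrability is assumed. *)
Lemma measurable_expectation_param d1 (T : measurableType d1)
    (U : {RV P >-> V}) (g : T * V -> R) :
  measurable_fun [set: T * V] g ->
  measurable_fun setT (fun t => fine (\int[P]_w (g (t, U w))%:E)).
Proof.
move=> mg.
have mfine : measurable_fun [set: \bar R] (fine : \bar R -> R) by exact: fine_measurable.
apply: (measurableT_comp mfine).
have mgE : measurable_fun [set: T * V] (EFin \o g) by exact/measurable_EFinP.
have mD (h : T * V -> \bar R) : measurable_fun [set: T * V] h ->
    (forall z, 0 <= h z)%E -> measurable_fun setT (fun t => \int[P]_w h (t, U w))%E.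
  move=> mh h0.
  have := measurable_fun_fubini_tonelli_F (m2 := distribution P U) h mh h0.
  apply: eq_measurable_fun => t _.
  rewrite /fubini_F ge0_integral_distribution//.
  exact: measurableT_comp mh (measurable_pair1 _).
under eq_fun do rewrite integralE.
apply: emeasurable_funB.
  apply: eq_measurable_fun (mD _ (measurable_funepos mgE) (funepos_ge0 _)) => t _.
  by apply: eq_integral => w _; rewrite unlock.
apply: eq_measurable_fun (mD _ (measurable_funeneg mgE) (funeneg_ge0 _)) => t _.
by apply: eq_integral => w _; rewrite unlock.
Qed.

Lemma ge0_integral_same_distribution (X Y : {RV P >-> V}) (h : V -> \bar R) :
  same_distribution X Y -> measurable_fun setT h -> (forall v, 0 <= h v)%E ->
  (\int[P]_w h (X w) = \int[P]_w h (Y w))%E.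
Proof.
move=> XY mh h0.
rewrite -[LHS](ge0_integral_distribution X mh h0).
rewrite -[RHS](ge0_integral_distribution Y mh h0).
by apply: eq_measure_integral => A mA _; exact: XY.
Qed.

Lemma integrable_same_distribution (X Y : {RV P >-> V}) (h : V -> R) :
  same_distribution X Y -> measurable_fun setT h ->
  P.-integrable setT (fun w => (h (Y w))%:E) ->
  P.-integrable setT (fun w => (h (X w))%:E) /\
  (\int[P]_w (h (X w))%:E = \int[P]_w (h (Y w))%:E)%E.
Proof.
move=> XY mh iY.
have mhE : measurable_fun setT (EFin \o h) by exact/measurable_EFinP.
have iX : P.-integrable setT (fun w => (h (X w))%:E).
  apply/integrableP; split.
    by apply/measurable_EFinP; exact: measurableT_comp.
  have /integrableP[_] := iY.
  rewrite (ge0_integral_same_distribution (h := fun v => `|(h v)%:E|%E) XY)//.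
  exact: measurableT_comp mhE.
split=> //; rewrite -[LHS](integral_distribution mhE iX)//.
rewrite -[RHS](integral_distribution mhE iY)//.
by apply: eq_measure_integral => A mA _; exact: XY.
Qed.

Lemma centered_same_distribution d (X Y : {RV P >-> V}) (y : V -> 'rV[R]_d) :
  same_distribution X Y -> measurable_fun setT y ->
  centered P (y \o Y) -> centered P (y \o X).
Proof.
move=> XY my [iY Y0].
have h i := integrable_same_distribution XY (measurable_fun_coord i my) (iY i).
split; first by move=> i; exact: (h i).1.
rewrite -Y0; apply/rowP => i; rewrite !mxE unlock.
by congr fine; exact: (h i).2.
Qed.

End expectation_parameter.

(** * Sums of independent centered vectors, and conditioning on the past *)

Section independent_sums.
Context {dO dV} {Omega : measurableType dO} {V : measurableType dV}
  {R : realType} {P : probability Omega R} {I : choiceType}.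
Variables (X : I -> {RV P >-> V}) (D : set I) (d : nat)
  (dot : {dot 'rV[R]_d for idfun}) (q : R).
Hypotheses (iX : independent_RVs D X) (q1 : 1 <= q).
Local Notation nm := (dot_norm dot).

Let measurable_moment d1 (T : measurableType d1) (f : T -> 'rV[R]_d) (c : T -> R) :
  measurable_fun setT f -> measurable_fun setT c ->
  measurable_fun setT (fun t => (nm (f t) ^+ 2 + c t) `^ q).
Proof.
move=> mf mc; apply: (measurableT_comp (measurable_powR _)).
by apply: measurable_funD => //; apply: measurable_funX; exact: measurable_dot_norm.
Qed.

(** Induction with c general. The variance proxies merely add up, so the constant does not depend on
    the number of summands. *)
Lemma centered_moment_sum (s : seq I) (y : I -> V -> 'rV[R]_d) (tau : I -> R)
    (x : 'rV[R]_d) (c : R) :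
  0 <= c -> uniq s -> (forall i, i \in s -> D i) ->
  (forall i, i \in s -> measurable_fun setT (y i)) ->
  (forall i, i \in s -> centered P (y i \o X i)) ->
  (forall i, i \in s -> 0 < tau i) ->
  (forall i, i \in s ->
    (\int[P]_w ((nm (y i (X i w)) ^+ 2) `^ q)%:E <= (tau i `^ q)%:E)%E) ->
  (\int[P]_w ((nm (x + \sum_(i <- s) y i (X i w)) ^+ 2 + c) `^ q)%:E <=
   ((nm x ^+ 2 + c + 2 * moment_const q * \sum_(i <- s) tau i) `^ q)%:E)%E.
Proof.
have K0 : 0 <= 2 * moment_const q :> R.
  by rewrite mulr_ge0// (le_trans ler01)// moment_const_ge1.
elim: s c => [|i s IH] c c0.
  move=> _ _ _ _ _ _; rewrite big_nil mulr0 addr0.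
  under eq_integral do rewrite big_nil addr0.
  by rewrite integral_cst//= probability_setT mule1.
move=> /= /andP[iNs us] sD my cy tau0 ytau.
have si : {subset s <= i :: s} by move=> j js; rewrite in_cons js orbT.
have ii : i \in i :: s by rewrite mem_head.
pose S w := \sum_(j <- s) y j (X j w).
have mS : measurable_fun [set: family_sigma X [set` s]] (S : _ -> 'rV[R]_d).
  apply: measurable_rV_sum => j js.
  apply: measurableT_comp; first exact: my (si _ js).
  by apply: (@measurable_family_coord _ _ _ _ _ _ _ X [set` s]).
have mi : measurable_fun [set: family_sigma X [set i]]
    ((y i \o X i) : family_sigma X [set i] -> 'rV[R]_d).
  apply: measurableT_comp; first exact: my ii.
  exact: (@measurable_family_coord _ _ _ _ _ _ _ X [set i]).
pose g (z : 'rV[R]_d * 'rV[R]_d) := ((nm (x + z.1 + z.2) ^+ 2 + c) `^ q)%:E.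
have mg : measurable_fun [set: 'rV[R]_d * 'rV[R]_d] g.
  apply/measurable_EFinP; apply: measurable_moment => //.
  by apply: measurable_rV_add => //; exact: measurable_rV_add.
have g0 z : (0 <= g z)%E by rewrite lee_fin powR_ge0.
have [mgi gE] := ge0_integral_family iX
  (J := [set` s]) (K := [set i]) (fun j js => sD j (si j js))
  (fun j (ji : j = i) => let: erefl := esym ji in sD i ii)
  (fun j js ji => negP iNs (eq_ind j (fun k => k \in s) js i ji)) mS mi mg g0.
have -> : (\int[P]_w ((nm (x + \sum_(j <- i :: s) y j (X j w)) ^+ 2 + c) `^ q)%:E =
    \int[P]_w g (S w, y i (X i w)))%E.
  apply: eq_integral => w _; rewrite big_cons /g /=.
  by congr ((nm _ ^+ 2 + _) `^ _)%:E; rewrite addrA addrAC.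
rewrite [leLHS]gE big_cons; set t := tau i.
(* The head is integrated out with the tail frozen, and its proxy t joins c before the induction
   hypothesis is applied. *)
apply: (@le_trans _ _ (\int[P]_w ((nm (x + S w) ^+ 2 +
    (c + 2 * moment_const q * t)) `^ q)%:E)%E).
  apply: ge0_le_integral => //.
  - by move=> w _; apply: integral_ge0.
  - apply/measurable_EFinP; apply: measurable_moment => //.
    by apply: measurable_rV_add => //; exact: measurable_fun_family mS.
  - move=> w _.
    have := centered_moment_step (dot := dot) q1 (x + S w) c0 (tau0 _ ii) (cy _ ii) (ytau _ ii).
    by rewrite -(addrA _ c).
apply: le_trans (IH _ _ us _ _ _ _ _) _.
- by rewrite addr_ge0// mulr_ge0// ltW// tau0.
- by move=> j /si; exact: sD.
- by move=> j /si; exact: my.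
- by move=> j /si; exact: cy.
- by move=> j /si; exact: tau0.
- by move=> j /si; exact: ytau.
rewrite le_eqVlt; apply/orP; left; apply/eqP; congr ((_ `^ q)%:E); rewrite /t; ring.
Qed.

(* [N t w] is the noise at parameter [t]; it only depends on the variables
   indexed by [K], whereas [theta], [Z], [a] and [c] depend on those in [J]. *)
Variables (J K : set I) (N : 'rV[R]_d -> Omega -> 'rV[R]_d).
Hypotheses (JD : J `<=` D) (KD : K `<=` D) (JK : forall i, J i -> K i -> False).
Hypothesis mN : measurable_fun [set: 'rV[R]_d * family_sigma X K]
  (fun z => N z.1 z.2).

Let mid : measurable_fun [set: family_sigma X K] (idfun : Omega -> family_sigma X K).
Proof. exact: measurable_id. Qed.

(** The triple (theta, Z, c) is frozen. The second independent component is the sample point itself,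
    carried by the identity into [family_sigma X K]; thus the samples need not be collected in a
    vector. *)
Lemma conditional_moment (delta : R) (theta Z : Omega -> 'rV[R]_d) (c : Omega -> R) :
  (forall t x c, 0 <= c ->
    (\int[P]_w ((nm (x + N t w) ^+ 2 + c) `^ q)%:E <=
     ((nm x ^+ 2 + c + delta) `^ q)%:E)%E) ->
  (forall w, 0 <= c w) ->
  measurable_fun [set: family_sigma X J] theta ->
  measurable_fun [set: family_sigma X J] Z ->
  measurable_fun [set: family_sigma X J] c ->
  (\int[P]_w ((nm (Z w + N (theta w) w) ^+ 2 + c w) `^ q)%:E <=
   \int[P]_w ((nm (Z w) ^+ 2 + c w + delta) `^ q)%:E)%E.
Proof.
move=> Nle c0 mtheta mZ mc.
pose T1 := ('rV[R]_d * 'rV[R]_d * R)%type.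
pose g (z : T1 * family_sigma X K) :=
  ((nm (z.1.1.2 + N z.1.1.1 z.2) ^+ 2 + z.1.2) `^ q)%:E.
have mg : measurable_fun [set: T1 * family_sigma X K] g.
  apply/measurable_EFinP; apply: measurable_moment => /=; last first.
    exact: measurableT_comp measurable_snd measurable_fst.
  apply: measurable_rV_add.
    apply: measurableT_comp measurable_snd _.
    exact: measurableT_comp measurable_fst measurable_fst.
  apply: (measurableT_comp mN (measurable_fun_pair _ measurable_snd)).
  apply: measurableT_comp measurable_fst _.
  exact: measurableT_comp measurable_fst measurable_fst.
have g0 z : (0 <= g z)%E by rewrite lee_fin powR_ge0.
have mT : measurable_fun [set: family_sigma X J] (fun w => (theta w, Z w, c w)).
  by apply: measurable_fun_pair => //; exact: measurable_fun_pair.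
have [mgi gE] := ge0_integral_family iX JD KD JK mT mid mg g0.
rewrite [leLHS]gE; apply: ge0_le_integral => //.
- by move=> w _; apply: integral_ge0.
- apply/measurable_EFinP; apply: (measurable_fun_family (J := J)).
  under eq_fun do rewrite -addrA.
  by apply: (measurable_moment mZ); apply: measurable_funD.
- by move=> w _; exact: Nle.
Qed.

Lemma conditional_norm (theta Z : Omega -> 'rV[R]_d) (a : Omega -> R) :
  (forall t, centered P (N t)) -> (forall w, 0 <= a w) ->
  measurable_fun [set: family_sigma X J] theta ->
  measurable_fun [set: family_sigma X J] Z ->
  measurable_fun [set: family_sigma X J] a ->
  (\int[P]_w (a w * nm (Z w))%:E <=
   \int[P]_w (a w * nm (Z w + N (theta w) w))%:E)%E.
Proof.
move=> cN a0 mtheta mZ ma.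
pose T1 := ('rV[R]_d * 'rV[R]_d * R)%type.
(* Tonelli's theorem wants g nonnegative everywhere, whereas a is nonnegative only along its values;
   the truncation at 0 changes nothing there. *)
pose g (z : T1 * family_sigma X K) :=
  (Num.max z.1.2 0 * nm (z.1.1.2 + N z.1.1.1 z.2))%:E.
have mg : measurable_fun [set: T1 * family_sigma X K] g.
  apply/measurable_EFinP; apply: measurable_funM => /=.
    apply: measurable_maxr => //.
    exact: measurableT_comp measurable_snd measurable_fst.
  apply: measurable_dot_norm; apply: measurable_rV_add.
    apply: measurableT_comp measurable_snd _.
    exact: measurableT_comp measurable_fst measurable_fst.
  apply: (measurableT_comp mN (measurable_fun_pair _ measurable_snd)).
  apply: measurableT_comp measurable_fst _.
  exact: measurableT_comp measurable_fst measurable_fst.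
have g0 z : (0 <= g z)%E.
  by rewrite lee_fin mulr_ge0 ?dot_norm_ge0// le_max lexx orbT.
have mT : measurable_fun [set: family_sigma X J] (fun w => (theta w, Z w, a w)).
  by apply: measurable_fun_pair => //; exact: measurable_fun_pair.
have [mgi gE] := ge0_integral_family iX JD KD JK mT mid mg g0.
have -> : (\int[P]_w (a w * nm (Z w + N (theta w) w))%:E =
           \int[P]_w g (theta w, Z w, a w, w))%E.
  by apply: eq_integral => w _; rewrite /g/= max_l.
rewrite [leRHS]gE; apply: ge0_le_integral => //.
- by move=> w _; rewrite lee_fin mulr_ge0 ?dot_norm_ge0.
- apply/measurable_EFinP; apply: (measurable_fun_family (X := X) (J := J)).
  by apply: measurable_funM => //; exact: (measurable_dot_norm dot mZ).
- move=> w _; rewrite /g/= max_l//.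
  under eq_integral do rewrite EFinM.
  rewrite ge0_integralZl//.
  + by rewrite EFinM; apply: lee_wpmul2l; [rewrite lee_fin|exact: centered_dot_norm_le].
  + apply/measurable_EFinP/measurable_dot_norm/measurable_rV_add => //.
    exact: vintegrable_measurable (cN _).1.
  + by move=> w' _; rewrite lee_fin dot_norm_ge0.
  by rewrite lee_fin.
Qed.

End independent_sums.

(** * The multilevel estimator *)

Section levels.
Context {R : realType}.
Implicit Types (y M alpha beta : R).

Lemma geometric_sum_le y n : 0 < y -> y != 1 ->
  \sum_(1 <= k < n.+1) y ^+ k <= y / `|y - 1| * Num.max 1 y ^+ n.
Proof.
move=> y0 y1; have y10 : y - 1 != 0 by rewrite subr_eq0.
have -> : \sum_(1 <= k < n.+1) y ^+ k = (y * y ^+ n - y) / (y - 1).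
  elim: n => [|n IH]; first by rewrite big_geq// expr0 mulr1 subrr mul0r.
  by rewrite big_nat_recr//= IH exprS; field.
have yn : 0 <= y ^+ n by rewrite exprn_ge0// ltW.
have [y_gt1|y_le1] := ltP 1 y.
  rewrite gtr0_norm ?subr_gt0// mulrAC ler_pM2r ?invr_gt0 ?subr_gt0//.
  by rewrite gerBl ltW.
have {}y_le1 : y < 1 by rewrite lt_neqAle y1.
rewrite expr1n mulr1 ltr0_norm ?subr_lt0// -[y * y ^+ n - y]opprB mulNr -mulrN.
rewrite -invrN ler_pM2r ?invr_gt0 ?opprB ?subr_gt0//.
by rewrite gerBl mulr_ge0// ltW.
Qed.

Variables (M alpha beta : R).
Hypotheses (M1 : 1 < M) (alpha0 : 0 < alpha).
Let M0 : 0 < M. Proof. exact: lt_trans ltr01 M1. Qed.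

(** Order in m of the sum over k <= m of M^(k (1/2 - beta)), to which both the variance and the cost
    of a step reduce; it is the factor by which [ml_kappa] compensates. *)
Definition level_weight (m : nat) : R :=
  if beta == 1 / 2 then m%:R else M `^ (m%:R * Num.max (1 / 2 - beta) 0).

Lemma level_weight_gt0 m : (0 < m)%N -> 0 < level_weight m.
Proof.
by move=> m0; rewrite /level_weight; case: ifPn; rewrite ?ltr0n ?powR_gt0.
Qed.

Definition level_const : R :=
  if beta == 1 / 2 then 1 else M `^ (1 / 2 - beta) / `|M `^ (1 / 2 - beta) - 1|.

Let powRM_neq1 : beta != 1 / 2 -> M `^ (1 / 2 - beta) != 1.
Proof.
move=> b; rewrite powR_eq1 !negb_or gt_eqF//= -leNgt (ltW M0)/=.
by rewrite subr_eq0 eq_sym.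
Qed.

Lemma level_const_gt0 : 0 < level_const.
Proof.
rewrite /level_const; case: ifPn => // b.
by rewrite divr_gt0 ?powR_gt0// normr_gt0 subr_eq0 powRM_neq1.
Qed.

Lemma powR_natl x k : M `^ (k%:R * x) = (M `^ x) ^+ k.
Proof. by rewrite mulrC powRrM powR_mulrn// powR_ge0. Qed.

Lemma level_sum_le m :
  \sum_(1 <= k < m.+1) M `^ (k%:R * (1 / 2 - beta)) <= level_const * level_weight m.
Proof.
under eq_bigr do rewrite powR_natl.
rewrite /level_const /level_weight; case: ifPn => [/eqP ->|b].
  rewrite subrr powRr0; under eq_bigr do rewrite expr1n.
  by rewrite sumr_const_nat subn1/= mul1r.
apply: le_trans (geometric_sum_le _ (powR_gt0 _ M0) (powRM_neq1 b)) _.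
rewrite ler_pM2l ?divr_gt0 ?powR_gt0 ?normr_gt0 ?subr_eq0 ?powRM_neq1//.
rewrite powR_natl le_eqVlt; apply/orP; left; apply/eqP; congr (_ ^+ _).
have [b0|b0] := leP (1 / 2 - beta) 0; rewrite ?powRr0.
  by apply/max_l; have := ler_powR (ltW M1) b0; rewrite powRr0.
by apply/max_r; have := ler_powR (ltW M1) (ltW b0); rewrite powRr0.
Qed.

(** Cost of the extra sample per level that rounding up may cause. *)
Lemma cost_sum_le m :
  \sum_(1 <= k < m.+1) M ^+ k <= M / (M - 1) * M ^+ m.
Proof.
apply: le_trans (geometric_sum_le _ M0 _) _; first by rewrite gt_eqF.
by rewrite gtr0_norm ?subr_gt0// max_r// ltW.
Qed.

Context {d : nat} (G2 : 'rV[R]_d -> R) (eps : nat -> R).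
Implicit Type t : 'rV[R]_d.
Local Notation level := (ml_level G2 M alpha eps).

Lemma ml_level_real n t : (level n t)%:R =
  Num.max 1 (Num.ceil (alpha^-1 * (ln (G2 t / eps n) / ln M)))%:~R :> R.
Proof.
rewrite /ml_level natr_absz ger0_norm; last by rewrite le_max ler01.
have [h|h] := leP (1 : int) _.
  by rewrite max_r// -[1]/(1%:~R) ler_int.
by rewrite max_l// -[1]/(1%:~R) ler_int ltW.
Qed.

Lemma ml_level_gt0 n t : (0 < level n t)%N.
Proof. by rewrite -(ltr_nat R) ml_level_real lt_max ltr01. Qed.

Lemma ml_level_bias n t : 0 < G2 t -> 0 < eps n ->
  G2 t * M `^ (- ((level n t)%:R * alpha)) <= eps n.
Proof.
move=> G20 e0; have lM : 0 < ln M by rewrite ln_gt0.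
have x_gt0 : 0 < G2 t / eps n by rewrite divr_gt0.
have h : ln (G2 t / eps n) <= (level n t)%:R * alpha * ln M.
  have : alpha^-1 * (ln (G2 t / eps n) / ln M) <= (level n t)%:R.
    by rewrite ml_level_real le_max ceil_ge orbT.
  by rewrite ler_pdivrMl// ler_pdivrMr// [alpha * _]mulrC.
rewrite -ler_pdivlMl// [_^-1 * _]mulrC -[eps n / _]invf_div powRN.
rewrite lef_pV2 ?posrE ?powR_gt0// -[leLHS]lnK ?posrE// /powR gt_eqF// ler_expR.
exact: h.
Qed.

End levels.

(** Without the maximum with 1, the absolute value of negative integers would destroy
    monotonicity. *)
Lemma homo_max1_ceil (R : realType) :
  {homo (fun x : R => `|Num.max (1 : int) (Num.ceil x)|%N) :
    x y / x <= y >-> (x <= y)%N}.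
Proof.
move=> x y xy; have ge0 (z : int) : 0 <= Num.max 1 z by rewrite le_max.
rewrite -lez_nat !gez0_abs// ge_max le_max lexx/= le_max.
by apply/orP; right; exact: le_ceil_tmp.
Qed.

(** * Mean and noise of one multilevel estimate *)

Section multilevel_step.
Context {R : realType} {d : nat} {dO dV : measure_display}
  {Omega : measurableType dO} {P : probability Omega R}
  {V : measurableType dV}.
Variables (U : {RV P >-> V}) (dot : {dot 'rV[R]_d for idfun}) (p : R)
  (Fk : nat -> 'rV[R]_d -> V -> 'rV[R]_d) (G1 G2 : 'rV[R]_d -> R)
  (M alpha beta : R) (eps sig : nat -> R)
  (Uc : nat -> nat -> nat -> {RV P >-> V}).
Hypotheses (hp : 2 <= p) (Fk0 : forall t u, Fk 0%N t u = 0)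
  (Fk_meas : forall k, (0 < k)%N ->
     measurable_fun [set: 'rV[R]_d * V] (fun x => Fk k x.1 x.2))
  (Fk_int : forall k t, (0 < k)%N -> vintegrable P (fun w => Fk k t (U w)))
  (G1_meas : measurable_fun [set: 'rV[R]_d] G1)
  (G2_meas : measurable_fun [set: 'rV[R]_d] G2)
  (G1_gt0 : forall t, 0 < G1 t) (G2_gt0 : forall t, 0 < G2 t)
  (M1 : 1 < M) (alpha_gt0 : 0 < alpha)
  (eps_gt0 : forall n, (0 < n)%N -> 0 < eps n)
  (sig_gt0 : forall n, (0 < n)%N -> 0 < sig n)
  (cond_i : forall k t, (0 < k)%N ->
     (('E_P[fun w =>
        (dot_norm dot
          (Fk k t (U w) - Fk k.-1 t (U w)
           - vexpectation P (fun w' => Fk k t (U w') - Fk k.-1 t (U w'))) `^ p)%R])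
        `^ p^-1 <= (G1 t * M `^ (- (k%:R * beta)))%:E)%E)
  (Uc_iid : independent_copies U Uc).
Local Notation nm := (dot_norm dot).
Local Notation lvl := (ml_level G2 M alpha eps).
Local Notation rep := (ml_reps G1 G2 M alpha beta eps sig).
Local Notation kap := (ml_kappa G1 G2 M alpha beta eps sig).
Local Notation idx := (nat * nat * nat)%type.

Definition copies (i : idx) : {RV P >-> V} := Uc i.1.1 i.1.2 i.2.

Definition copies_dom : set idx :=
  [set i : idx | [&& (0 < i.1.1)%N, (0 < i.1.2)%N & (0 < i.2)%N]].

Definition copies_upto (n : nat) : set idx :=
  [set i : idx | copies_dom i /\ (i.1.1 <= n)%N].

Definition copies_at (n : nat) : set idx :=
  [set i : idx | copies_dom i /\ i.1.1 = n].

Definition level_mean (k : nat) (t : 'rV[R]_d) : 'rV[R]_d :=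
  vexpectation P (fun w => Fk k t (U w)).

Definition level_noise (k : nat) (t : 'rV[R]_d) (v : V) : 'rV[R]_d :=
  Fk k t v - Fk k.-1 t v - (level_mean k t - level_mean k.-1 t).

Definition ml_noise (n : nat) (t : 'rV[R]_d) (w : Omega) : 'rV[R]_d :=
  \sum_(1 <= k < (lvl n t).+1) ((rep n k t)%:R^-1 *:
    \sum_(1 <= l < (rep n k t).+1) level_noise k t (Uc n k l w)).

Let Fk_int' k t : vintegrable P (fun w => Fk k t (U w)).
Proof.
case: k => [|k]; last exact: Fk_int.
by under eq_fun do rewrite Fk0; exact: vintegrable_cst.
Qed.

Let Fk_meas' k : measurable_fun [set: 'rV[R]_d * V] (fun x => Fk k x.1 x.2).
Proof.
case: k => [|k]; last exact: Fk_meas.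
by under eq_fun do rewrite Fk0; exact: measurable_cst.
Qed.

Let level_mean0 t : level_mean 0 t = 0.
Proof.
rewrite /level_mean; under eq_fun do rewrite Fk0.
exact: vexpectation_cst.
Qed.

Let M0 : 0 < M. Proof. exact: lt_trans M1. Qed.

Lemma ml_kappaE n t :
  kap n t = (G1 t / sig n) ^+ 2 * level_weight M beta (lvl n t).
Proof. by rewrite /ml_kappa /level_weight; case: ifPn. Qed.

Lemma ml_kappa_gt0 n t : (0 < n)%N -> 0 < kap n t.
Proof.
move=> n0; rewrite ml_kappaE mulr_gt0// ?exprn_gt0 ?divr_gt0 ?sig_gt0//.
by rewrite level_weight_gt0 ?ml_level_gt0.
Qed.

Lemma ml_reps_real n k t : (0 < n)%N ->
  (rep n k t)%:R = (Num.ceil (kap n t * M `^ (- (k%:R * (beta + 1 / 2)))))%:~R :> R.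
Proof.
move=> n0; rewrite /ml_reps natr_absz ger0_norm//.
rewrite ceil_ge0 (lt_trans (ltrN10 R))// mulr_gt0 ?powR_gt0//.
exact: ml_kappa_gt0.
Qed.

Lemma ml_reps_ge n k t : (0 < n)%N ->
  kap n t * M `^ (- (k%:R * (beta + 1 / 2))) <= (rep n k t)%:R.
Proof. by move=> n0; rewrite ml_reps_real// ceil_ge. Qed.

Lemma ml_reps_le n k t : (0 < n)%N ->
  (rep n k t)%:R <= kap n t * M `^ (- (k%:R * (beta + 1 / 2))) + 1.
Proof.
move=> n0; rewrite ml_reps_real// -lerBlDr ltW//.
by have /andP[] := ceil_itv (kap n t * M `^ (- (k%:R * (beta + 1 / 2)))); rewrite intrB.
Qed.

Lemma ml_reps_gt0 n k t : (0 < n)%N -> (0 < rep n k t)%N.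
Proof.
move=> n0; rewrite -(ltr_nat R); apply: lt_le_trans (ml_reps_ge _ _ n0).
by rewrite mulr_gt0 ?powR_gt0// ml_kappa_gt0.
Qed.

(** The level means telescope, so the mean is that of the finest level alone. *)
Lemma ml_estimatorE n t w : (0 < n)%N ->
  ml_estimator G1 G2 M alpha beta eps sig Fk Uc n t w =
  level_mean (lvl n t) t + ml_noise n t w.
Proof.
move=> n0; have -> : level_mean (lvl n t) t =
    \sum_(1 <= k < (lvl n t).+1) (level_mean k t - level_mean k.-1 t).
  rewrite big_add1/=; under eq_bigr do rewrite /=.
  by rewrite telescope_sumr// level_mean0 subr0.
rewrite -big_split/=; apply: eq_bigr => k _.
set m := level_mean k t - level_mean k.-1 t.
have -> : \sum_(1 <= l < (rep n k t).+1) level_noise k t (Uc n k l w) =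
    \sum_(1 <= l < (rep n k t).+1) (Fk k t (Uc n k l w) - Fk k.-1 t (Uc n k l w)) -
    (rep n k t)%:R *: m.
  by rewrite [LHS]sumrB sumr_const_nat subn1 scaler_nat.
rewrite scalerBr scalerA mulVf; first by rewrite scale1r addrC subrK.
by rewrite pnatr_eq0 -lt0n ml_reps_gt0.
Qed.

Lemma measurable_level_mean k : measurable_fun setT (level_mean k).
Proof.
apply: measurable_fun_rV => i; rewrite /level_mean.
have := measurable_expectation_param U
  (g := fun z : 'rV[R]_d * V => Fk k z.1 z.2 ord0 i)
  (measurable_fun_coord i (@Fk_meas' k)).
by apply: eq_measurable_fun => t _; rewrite mxE unlock.
Qed.

Lemma measurable_level_noise k :
  measurable_fun [set: 'rV[R]_d * V] (fun z => level_noise k z.1 z.2).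
Proof.
apply: measurable_rV_sub; first exact: measurable_rV_sub.
by apply: measurable_rV_sub;
  apply: (measurableT_comp (measurable_level_mean _) measurable_fst).
Qed.

Lemma measurable_ml_level n : measurable_fun setT (lvl n).
Proof.
pose phi (x : R) := `|Num.max (1 : int) (Num.ceil x)|%N.
have -> : lvl n = phi \o (fun t => alpha^-1 * (ln (G2 t / eps n) / ln M)) by [].
apply: measurable_fun_monotone_nat => [x y xy|]; last first.
  apply: measurable_funM => //; apply: measurable_funM => //.
  by apply: measurableT_comp => //; exact: measurable_funM.
exact: homo_max1_ceil.
Qed.

Lemma measurable_level_weight n :
  measurable_fun setT (fun t => level_weight M beta (lvl n t)).
Proof.
apply: (measurableT_comp (f := level_weight M beta)); first by [].
exact: measurable_ml_level.
Qed.

Lemma measurable_ml_kappa n : measurable_fun setT (kap n).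
Proof.
rewrite (_ : kap n =
    fun t => (G1 t / sig n) ^+ 2 * level_weight M beta (lvl n t)); last first.
  by apply/funext => t; exact: ml_kappaE.
apply: measurable_funM; last exact: measurable_level_weight.
by apply: measurable_funX; exact: measurable_funM.
Qed.

Lemma measurable_ml_reps n k : (0 < n)%N -> measurable_fun setT (rep n k).
Proof.
move=> n0.
(* The rounded number is positive, so the maximum in phi is harmless and monotonicity is
   available. *)
pose phi (x : R) := `|Num.max (1 : int) (Num.ceil x)|%N.
have -> : rep n k = phi \o (fun t => kap n t * M `^ (- (k%:R * (beta + 1 / 2)))).
  apply/funext => t; rewrite /phi /= /ml_reps max_r//.
  by rewrite -gtz0_ge1 ceil_gt0 mulr_gt0 ?powR_gt0 ?ml_kappa_gt0.
apply: measurable_fun_monotone_nat => [x y xy|]; last first.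
  by apply: measurable_funM => //; exact: measurable_ml_kappa.
exact: homo_max1_ceil.
Qed.

Lemma copies_at_dom n : copies_at n `<=` copies_dom.
Proof. by move=> i []. Qed.

Lemma copies_upto_dom n : copies_upto n `<=` copies_dom.
Proof. by move=> i []. Qed.

(** Joint measurability, although both summation ranges depend on the parameter: each range is fixed
    in turn by [measurable_nat_choice]. *)
Lemma measurable_ml_noise n : (0 < n)%N ->
  measurable_fun [set: 'rV[R]_d * family_sigma copies (copies_at n)]
    (fun z => ml_noise n z.1 z.2).
Proof.
move=> n0; set T := ('rV[R]_d * family_sigma copies (copies_at n))%type.
have mN (N : 'rV[R]_d -> nat) : measurable_fun setT N ->
    measurable_fun [set: T] (fun z => N z.1).
  by move=> h; apply: measurableT_comp h measurable_fst.
rewrite /ml_noise.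
apply: (@measurable_nat_choice _ T _ _ (fun z => lvl n z.1) (fun m z =>
  \sum_(1 <= k < m.+1) ((rep n k z.1)%:R^-1 *:
    \sum_(1 <= l < (rep n k z.1).+1) level_noise k z.1 (Uc n k l z.2)))).
  by apply: mN; exact: measurable_ml_level.
move=> m; apply: measurable_rV_sum => k; rewrite mem_index_iota => /andP[k0 _].
apply: measurable_rV_scale.
  apply: (measurableT_comp (f := fun j : nat => j%:R^-1 : R)) => //.
  by apply: mN; exact: measurable_ml_reps.
apply: (@measurable_nat_choice _ T _ _ (fun z => rep n k z.1) (fun m z =>
  \sum_(1 <= l < m.+1) level_noise k z.1 (Uc n k l z.2))).
  by apply: mN; exact: measurable_ml_reps.
move=> m'; apply: measurable_rV_sum => l; rewrite mem_index_iota => /andP[l0 _].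
apply: (measurableT_comp (g := fun z : T => (z.1, Uc n k l z.2))
  (measurable_level_noise k)).
apply: measurable_fun_pair => //.
apply: (measurableT_comp (f := Uc n k l : family_sigma copies (copies_at n) -> V)
  _ measurable_snd).
apply: (@measurable_family_coord _ _ _ _ _ _ _ copies (copies_at n) (n, k, l)).
by split => //; rewrite /copies_dom/= n0 k0 l0.
Qed.

Lemma centered_level_noise n k l t : (0 < n)%N -> (0 < k)%N -> (0 < l)%N ->
  centered P (level_noise k t \o Uc n k l).
Proof.
move=> n0 k0 l0; apply: (centered_same_distribution (Y := U)).
- exact: Uc_iid.1.
- exact: (measurableT_comp (measurable_level_noise k) (measurable_pair1 t)).
have iD : vintegrable P (fun w => Fk k t (U w) - Fk k.-1 t (U w)).
  exact: vintegrableB.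
split; first by apply: vintegrableB => //; exact: vintegrable_cst.
rewrite /level_noise /comp vexpectationB//; last exact: vintegrable_cst.
by rewrite vexpectationB// vexpectation_cst subrr.
Qed.

Lemma centered_ml_noise n t : (0 < n)%N -> centered P (ml_noise n t).
Proof.
move=> n0; apply: centered_sum => k; rewrite mem_index_iota => /andP[k0 _].
apply: centeredZ; apply: centered_sum => l; rewrite mem_index_iota => /andP[l0 _].
exact: centered_level_noise.
Qed.

(** The hypothesis on the L^p norm at U is raised to the power p and carried over to the copies by
    equality in law. *)
Lemma level_noise_moment n k l t : (0 < n)%N -> (0 < k)%N -> (0 < l)%N ->
  (\int[P]_w ((nm (level_noise k t (Uc n k l w)) ^+ 2) `^ (p / 2))%:E <=
   (((G1 t * M `^ (- (k%:R * beta))) ^+ 2) `^ (p / 2))%:E)%E.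
Proof.
move=> n0 k0 l0; have p0 : 0 < p by exact: lt_le_trans hp.
have sq x : 0 <= x -> (x ^+ 2) `^ (p / 2) = x `^ p.
  by move=> x0; rewrite -powR_mulrn// -powRrM mulrC divfK.
have B0 : 0 <= G1 t * M `^ (- (k%:R * beta)) by rewrite mulr_ge0 ?powR_ge0 ?ltW.
have mL : measurable_fun setT (level_noise k t).
  exact: (measurableT_comp (measurable_level_noise k) (measurable_pair1 t)).
pose h v := ((nm (level_noise k t v) ^+ 2) `^ (p / 2))%:E.
have mh : measurable_fun setT h.
  apply/measurable_EFinP; apply: (measurableT_comp (measurable_powR _)).
  by apply: measurable_funX; exact: measurable_dot_norm.
have h0 v : (0 <= h v)%E by rewrite lee_fin powR_ge0.
rewrite (ge0_integral_same_distribution (Uc_iid.1 _ _ _ n0 k0 l0) mh h0).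
have := cond_i t k0; rewrite unlock vexpectationB// -/(level_mean _ _) -/(level_mean _ _).
set E := (\int[P]_w _)%E => Ele.
have -> : (\int[P]_w h (U w) = E)%E.
  by apply: eq_integral => w _; rewrite /h sq ?dot_norm_ge0.
have E0 : (0 <= E)%E by apply: integral_ge0 => w _; rewrite lee_fin powR_ge0.
rewrite sq// -poweR_EFin.
have -> : E = ((E `^ p^-1) `^ p)%E.
  by rewrite -poweRrM mulVf ?poweRe1// gt_eqF.
apply: gt0_ler_poweR => //; first exact: ltW.
  by rewrite in_itv/= leey poweR_ge0.
by rewrite in_itv/= leey lee_fin andbT.
Qed.

Definition noise_const : R := 2 * moment_const (p / 2) * level_const M beta.

Lemma noise_const_gt0 : 0 < noise_const.
Proof.
rewrite /noise_const !mulr_gt0// ?level_const_gt0//.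
by apply: lt_le_trans (moment_const_ge1 _) => //; rewrite ler_pdivlMr// mul1r.
Qed.

(** The double sum over levels and samples is flattened into one family of independent centered
    terms, so that [centered_moment_sum] applies once. *)
Lemma ml_noise_moment n t x c g : (0 < n)%N -> 0 <= c -> 0 < g ->
  (\int[P]_w ((nm (x + g *: ml_noise n t w) ^+ 2 + c) `^ (p / 2))%:E <=
   ((nm x ^+ 2 + c + noise_const * g ^+ 2 * sig n ^+ 2) `^ (p / 2))%:E)%E.
Proof.
move=> n0 c0 g0; have q1 : 1 <= p / 2 by rewrite ler_pdivlMr// mul1r.
have K0 : 0 <= 2 * moment_const (p / 2) :> R.
  by rewrite mulr_ge0// (le_trans ler01)// moment_const_ge1.
pose s : seq idx := [seq (n, k, l) | k <- index_iota 1 (lvl n t).+1,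
                                     l <- index_iota 1 (rep n k t).+1].
pose h k : R := g * (rep n k t)%:R^-1.
have h0 k : 0 < h k by rewrite mulr_gt0// invr_gt0 ltr0n ml_reps_gt0.
pose y (i : idx) (v : V) := h i.1.2 *: level_noise i.1.2 t v.
(* Square of the L^p bound of one summand, with the weight g / N of its level. *)
pose tau (i : idx) : R := (h i.1.2 * (G1 t * M `^ (- (i.1.2%:R * beta)))) ^+ 2.
have sP i : i \in s -> i.1.1 = n /\ (0 < i.1.2)%N /\ (0 < i.2)%N.
  move=> /allpairsPdep[k [l [+ + ->]]].
  by rewrite !mem_index_iota => /andP[k0 _] /andP[l0 _].
have us : uniq s.
  apply: allpairs_uniq_dep => [|k _|]; try exact: iota_uniq.
  by move=> [k l] [k' l'] _ _ /= [-> ->].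
have tau0 i : 0 < tau i.
  by rewrite exprn_gt0// mulr_gt0// mulr_gt0 ?powR_gt0.
have := @centered_moment_sum _ _ _ _ _ P _ copies copies_dom d dot (p / 2)
  Uc_iid.2 q1 s y tau x c c0 us.
have step1 i : i \in s -> copies_dom i.
  by move=> /sP[i1 [i2 i3]]; rewrite /copies_dom/= i1 n0 i2 i3.
have step2 i : i \in s -> measurable_fun setT (y i).
  move=> _; apply: measurable_rV_scale => //.
  exact: (measurableT_comp (measurable_level_noise _) (measurable_pair1 t)).
have step3 i : i \in s -> centered P (y i \o copies i).
  move=> /sP[i1 [i2 i3]]; rewrite /copies i1; apply: centeredZ.
  exact: centered_level_noise.
have step4 i : i \in s ->
    (\int[P]_w ((nm (y i (copies i w)) ^+ 2) `^ (p / 2))%:E <= (tau i `^ (p / 2))%:E)%E.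
  move=> /sP[i1 [i2 i3]].
  under eq_integral do rewrite /y dot_normZ (gtr0_norm (h0 _)) exprMn
    powRM ?sqr_ge0// EFinM.
  rewrite ge0_integralZl//; last 3 first.
  - apply/measurable_EFinP; apply: (measurableT_comp (measurable_powR _)).
    apply: measurable_funX; apply: measurable_dot_norm.
    apply: measurableT_comp => //.
    exact: (measurableT_comp (measurable_level_noise _) (measurable_pair1 t)).
  - by move=> w _; rewrite lee_fin powR_ge0.
  - by rewrite lee_fin powR_ge0.
  have -> : tau i `^ (p / 2) = (h i.1.2 ^+ 2) `^ (p / 2) *
      ((G1 t * M `^ (- (i.1.2%:R * beta))) ^+ 2) `^ (p / 2).
    by rewrite -powRM ?sqr_ge0// -exprMn.
  rewrite [X in (_ <= X)%E]EFinM; apply: lee_wpmul2l.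
    by rewrite lee_fin powR_ge0.
  by rewrite /copies i1; exact: level_noise_moment.
move=> /(_ step1 step2 step3 (fun i _ => tau0 i) step4).
have -> : (\int[P]_w ((nm (x + \sum_(i <- s) y i (copies i w)) ^+ 2 + c) `^ (p / 2))%:E =
    \int[P]_w ((nm (x + g *: ml_noise n t w) ^+ 2 + c) `^ (p / 2))%:E)%E.
  apply: eq_integral => w _; congr (((nm (x + _)) ^+ 2 + c) `^ (p / 2))%:E.
  rewrite big_allpairs_dep scaler_sumr; apply: eq_bigr => k _.
  by rewrite scalerA scaler_sumr.
move=> /le_trans; apply; rewrite lee_fin; apply: le_powR.
- exact: le_trans q1.
- rewrite !addr_ge0 ?sqr_ge0// mulr_ge0// sumr_ge0// => i _; exact: ltW.
rewrite lerD2l /noise_const -!mulrA ler_wpM2l// ler_wpM2l//.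
  by rewrite (le_trans ler01)// moment_const_ge1.
have kap0 := ml_kappa_gt0 t n0.
have sig0 := sig_gt0 n0.
have -> : \sum_(i <- s) tau i = \sum_(1 <= k < (lvl n t).+1)
    g ^+ 2 * (rep n k t)%:R^-1 * (G1 t * M `^ (- (k%:R * beta))) ^+ 2.
  rewrite big_allpairs_dep; apply: eq_bigr => k _ /=.
  rewrite /tau /= sumr_const_nat subn1/= -mulr_natr /h.
  by field; rewrite pnatr_eq0 -lt0n ml_reps_gt0.
(* The sample count of level k is replaced by its value before rounding up; the exponent beta + 1/2
   in it turns M^(-2 k beta) into M^(k (1/2 - beta)). *)
apply: (@le_trans _ _ (\sum_(1 <= k < (lvl n t).+1)
   (g ^+ 2 * G1 t ^+ 2 / kap n t) * M `^ (k%:R * (1 / 2 - beta)))).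
  apply: ler_sum => k _.
  have r_ge := ml_reps_ge k t n0.
  have r_gt : 0 < (rep n k t)%:R :> R by rewrite ltr0n ml_reps_gt0.
  have r_le : (rep n k t)%:R^-1 <= (kap n t)^-1 * M `^ (k%:R * (beta + 1 / 2)).
    rewrite -[M `^ (k%:R * (beta + 1 / 2))]invrK -powRN -invfM lef_pV2//.
    by rewrite posrE mulr_gt0 ?powR_gt0.
  have -> : M `^ (k%:R * (1 / 2 - beta)) =
      M `^ (k%:R * (beta + 1 / 2)) * M `^ (- (k%:R * beta)) ^+ 2.
    rewrite -powR_mulrn ?powR_ge0// -powRrM -powRD ?(gt_eqF M0) ?implybT//.
    by congr (_ `^ _); ring.
  rewrite exprMn.
  have -> : g ^+ 2 * G1 t ^+ 2 / kap n t *
      (M `^ (k%:R * (beta + 1 / 2)) * M `^ (- (k%:R * beta)) ^+ 2) =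
      g ^+ 2 * ((kap n t)^-1 * M `^ (k%:R * (beta + 1 / 2))) *
      (G1 t ^+ 2 * M `^ (- (k%:R * beta)) ^+ 2) by ring.
  apply: ler_wpM2r; first by rewrite mulr_ge0 ?sqr_ge0.
  by apply: ler_wpM2l => //; exact: sqr_ge0.
rewrite -mulr_sumr.
have A0 : 0 <= g ^+ 2 * G1 t ^+ 2 / kap n t.
  by rewrite divr_ge0 ?mulr_ge0 ?sqr_ge0// ltW.
have := ler_wpM2l A0 (level_sum_le beta M1 (lvl n t)).
move=> /le_trans; apply.
rewrite ml_kappaE le_eqVlt; apply/orP; left; apply/eqP.
field; rewrite !gt_eqF// ?level_weight_gt0 ?ml_level_gt0//.
Qed.

End multilevel_step.

(** * The Robbins-Monro recursion *)

Section nonneg_integrals.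
Context {dO} {Omega : measurableType dO} {R : realType} (P : probability Omega R).
Implicit Types (F G : Omega -> R).

Lemma le_expect F G : (forall w, 0 <= F w) -> measurable_fun setT F ->
  measurable_fun setT G -> (forall w, F w <= G w) ->
  (\int[P]_w (F w)%:E <= \int[P]_w (G w)%:E)%E.
Proof.
move=> F0 mF mG FG; apply: ge0_le_integral => //.
- by move=> w _; rewrite lee_fin.
- exact/measurable_EFinP.
- exact/measurable_EFinP.
- by move=> w _; rewrite lee_fin.
Qed.

Lemma expectD F G : (forall w, 0 <= F w) -> measurable_fun setT F ->
  (forall w, 0 <= G w) -> measurable_fun setT G ->
  (\int[P]_w (F w + G w)%:E = \int[P]_w (F w)%:E + \int[P]_w (G w)%:E)%E.
Proof.
move=> F0 mF G0 mG; under eq_integral do rewrite EFinD.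
rewrite ge0_integralD//.
- by move=> w _; rewrite lee_fin.
- exact/measurable_EFinP.
- by move=> w _; rewrite lee_fin.
- exact/measurable_EFinP.
Qed.

Lemma expectZ k F : 0 <= k -> (forall w, 0 <= F w) -> measurable_fun setT F ->
  (\int[P]_w (k * F w)%:E = k%:E * \int[P]_w (F w)%:E)%E.
Proof.
move=> k0 F0 mF; under eq_integral do rewrite EFinM.
rewrite ge0_integralZl//.
- exact/measurable_EFinP.
- by move=> w _; rewrite lee_fin.
Qed.

Lemma expect_cst (k : R) : (\int[P]_w k%:E = k%:E)%E.
Proof. by rewrite integral_cst//= probability_setT mule1. Qed.

Lemma expect_sum (I : Type) (r : seq I) (F : I -> Omega -> R) :
  (forall i w, 0 <= F i w) -> (forall i, measurable_fun setT (F i)) ->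
  (\int[P]_w (\sum_(i <- r) F i w)%:E = \sum_(i <- r) \int[P]_w (F i w)%:E)%E.
Proof.
move=> F0 mF; under eq_integral do rewrite -sumEFin.
rewrite ge0_integral_sum//.
- by move=> i; exact/measurable_EFinP.
- by move=> i w _; rewrite lee_fin.
Qed.

Lemma expect_ge0 F : (forall w, 0 <= F w) -> (0 <= \int[P]_w (F w)%:E)%E.
Proof. by move=> F0; apply: integral_ge0 => w _; rewrite lee_fin. Qed.

End nonneg_integrals.

Fixpoint running_max {R : realType} (s : nat -> R) (i : nat) : R :=
  if i is i'.+1 then Num.max (running_max s i') (s i) else s 0%N.

(** * Abstract recursion, with noise entering only through [condM] and [condN] *)

Section stochastic_approximation.
Context {R : realType} {d : nat} {dO dV : measure_display}
  {Omega : measurableType dO} {V : measurableType dV} {P : probability Omega R}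
  {I : choiceType}.
Variables (X : I -> {RV P >-> V}) (J : nat -> set I)
  (dot : {dot 'rV[R]_d for idfun}) (theta W : nat -> Omega -> 'rV[R]_d)
  (h : nat -> 'rV[R]_d -> 'rV[R]_d) (f : 'rV[R]_d -> 'rV[R]_d)
  (t0 ts : 'rV[R]_d) (L L' g0 e0 cv rho p : R).
Local Notation nm := (dot_norm dot).
Local Notation q := (p / 2).
Hypotheses (hp : 2 <= p) (L0 : 0 < L) (L'0 : 0 < L') (rho0 : 0 < rho)
  (e00 : 0 <= e0) (cv0 : 0 <= cv) (g0L : rho < L * g0)
  (f_mon : forall t, dot (t - ts) (f t) <= - L * dot_norm dot (t - ts) ^+ 2)
  (f_bnd : forall t, dot (t - ts) (f t) <= - L' * dot_norm dot (f t) ^+ 2).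
(** Order of gamma^2 sigma^2 in the step from n to n.+1: the exponent 2 + r is written as 1 + 2
    rho. *)
Definition noise_var (n : nat) : R := cv * (n.+1%:R^-1 * n.+1%:R `^ (- (2 * rho))).
Hypotheses (JS : forall n, J n `<=` J n.+1)
  (m_theta : forall n, measurable_fun [set: family_sigma X (J n)] (theta n))
  (m_W : forall n, measurable_fun [set: family_sigma X (J n.+1)] (W n.+1))
  (m_h : forall n, measurable_fun setT (h n))
  (theta_0 : forall w, theta 0 w = t0)
  (theta_S : forall n w, theta n.+1 w =
    theta n w + (g0 / n.+1%:R) *: h n.+1 (theta n w) + W n.+1 w)
  (h_f : forall n t, nm (h n.+1 t - f t) <= e0 * n.+1%:R `^ (- rho))
  (condM : forall n (Z : Omega -> 'rV[R]_d) (c : Omega -> R), (forall w, 0 <= c w) ->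
    measurable_fun [set: family_sigma X (J n)] Z ->
    measurable_fun [set: family_sigma X (J n)] c ->
    (\int[P]_w ((nm (Z w + W n.+1 w) ^+ 2 + c w) `^ q)%:E <=
     \int[P]_w ((nm (Z w) ^+ 2 + c w + noise_var n) `^ q)%:E)%E)
  (condN : forall n (Z : Omega -> 'rV[R]_d) (a : Omega -> R), (forall w, 0 <= a w) ->
    measurable_fun [set: family_sigma X (J n)] Z ->
    measurable_fun [set: family_sigma X (J n)] a ->
    (\int[P]_w (a w * nm (Z w))%:E <= \int[P]_w (a w * nm (Z w + W n.+1 w))%:E)%E).

Let q1 : 1 <= q. Proof. by rewrite ler_pdivlMr// mul1r. Qed.
Let q0 : 0 < q. Proof. exact: lt_le_trans q1. Qed.
Let p1 : 1 < p. Proof. by apply: lt_le_trans hp; rewrite ltr1n. Qed.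
Let p0 : 0 < p. Proof. exact: lt_trans p1. Qed.
Let g00 : 0 < g0.
Proof. by rewrite -(pmulr_rgt0 _ L0); apply: lt_trans g0L. Qed.

Let err n w := theta n w - ts.
Let s n w : R := nm (err n w) `^ p.

Let sqr_p x : 0 <= x -> (x ^+ 2) `^ q = x `^ p.
Proof. by move=> x0; rewrite -powR_mulrn// -powRrM mulrC divfK. Qed.

Let m_err n : measurable_fun [set: family_sigma X (J n)] (err n).
Proof. exact: measurable_rV_sub. Qed.

Let m_s n : measurable_fun setT (s n).
Proof.
apply: (measurableT_comp (measurable_powR _)); apply: measurable_dot_norm.
exact: measurable_fun_family (@m_err n).
Qed.

Let s0 n w : 0 <= s n w. Proof. exact: powR_ge0. Qed.

Let noise_var_ge0 n : 0 <= noise_var n.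
Proof. by rewrite !mulr_ge0 ?powR_ge0// invr_ge0. Qed.

Let drifted n w := err n w + (g0 / n.+1%:R) *: h n.+1 (theta n w).

Let errS n w : err n.+1 w = drifted n w + W n.+1 w.
Proof. by rewrite /drifted /err theta_S addrAC (addrAC (theta n w)). Qed.

Let m_drifted n : measurable_fun [set: family_sigma X (J n)] (drifted n).
Proof.
apply: measurable_rV_add => //; apply: measurable_rV_scale => //.
exact: measurableT_comp.
Qed.

Lemma error_step n :
  (\int[P]_w (s n.+1 w)%:E <=
   \int[P]_w ((nm (drifted n w) ^+ 2 + noise_var n) `^ q)%:E)%E.
Proof.
have := condM (c := fun=> 0) (fun=> lexx 0) (@m_drifted n) (measurable_cst _).
under eq_integral do rewrite addr0 -errS sqr_p ?dot_norm_ge0//.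
by under [leRHS]eq_integral do rewrite addr0.
Qed.

Let m_step n : measurable_fun setT (fun w => (nm (drifted n w) ^+ 2 + noise_var n) `^ q).
Proof.
apply: (measurableT_comp (measurable_powR _)); apply: measurable_funD => //.
apply: measurable_funX; apply: measurable_dot_norm.
exact: measurable_fun_family (@m_drifted n).
Qed.

(** Finiteness lets the moments be treated as real numbers in the induction of [error_moment]. *)
Lemma error_moment_lty n : (\int[P]_w (s n w)%:E < +oo)%E.
Proof.
elim: n => [|n IH].
  by rewrite /s /err; under eq_integral do rewrite theta_0; rewrite expect_cst ltry.
apply: le_lt_trans (error_step n) _.
have en0 : 0 <= e0 * n.+1%:R `^ (- rho) by rewrite mulr_ge0 ?powR_ge0.
have gn0 : 0 <= g0 / n.+1%:R by rewrite divr_ge0// ltW.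
pose a := 2 * (1 + g0 / n.+1%:R / L') ^+ 2.
pose b := 2 * (g0 / n.+1%:R * (e0 * n.+1%:R `^ (- rho))) ^+ 2 + noise_var n.
have a0 : 0 <= a by rewrite mulr_ge0// sqr_ge0.
have b0 : 0 <= b by rewrite addr_ge0// mulr_ge0// sqr_ge0.
pose k := 2 `^ (q - 1) * a `^ q.
pose l := 2 `^ (q - 1) * b `^ q.
have k0 : 0 <= k by rewrite mulr_ge0 ?powR_ge0.
have l0 : 0 <= l by rewrite mulr_ge0 ?powR_ge0.
apply: (@le_lt_trans _ _ (\int[P]_w (k * s n w + l)%:E)%E); last first.
  rewrite expectD//; last 2 first.
  - by move=> w; rewrite mulr_ge0.
  - exact: measurable_funM.
  by rewrite expectZ// expect_cst; apply: lte_add_pinfty; rewrite ?ltry// lte_mul_pinfty// lee_fin.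
apply: le_expect => //.
- by move=> w; exact: powR_ge0.
- by apply: measurable_funD => //; exact: measurable_funM.
move=> w; have hd := drift_crude L'0 f_bnd gn0 (h_f n (theta n w)).
have : nm (drifted n w) ^+ 2 + noise_var n <= a * nm (err n w) ^+ 2 + b.
  pose x := (1 + g0 / n.+1%:R / L') * nm (err n w).
  pose y := g0 / n.+1%:R * (e0 * n.+1%:R `^ (- rho)).
  have -> : a * nm (err n w) ^+ 2 + b = 2 * (x ^+ 2 + y ^+ 2) + noise_var n.
    by rewrite /a /b /x /y; ring.
  rewrite lerD2r.
  have : nm (drifted n w) ^+ 2 <= (x + y) ^+ 2.
    rewrite ler_pXn2r// nnegrE ?dot_norm_ge0//.
    exact: le_trans (dot_norm_ge0 _ _) hd.
  have := sqr_ge0 (x - y); lra.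
have ae0 : 0 <= a * nm (err n w) ^+ 2 by rewrite mulr_ge0// sqr_ge0.
move=> hab; apply: le_trans (_ : (a * nm (err n w) ^+ 2 + b) `^ q <= _).
  by apply: le_powR => //; [exact: ltW|rewrite addr_ge0 ?sqr_ge0].
apply: le_trans (powR_add_le q1 ae0 b0) _.
by rewrite mulrDr /k /l lerD2r powRM ?sqr_ge0// sqr_p ?dot_norm_ge0// mulrA.
Qed.

Lemma error_moment : exists2 B : R, 0 < B & forall n,
  (\int[P]_w (s n.+1 w)%:E <= (B * n.+1%:R `^ (- (rho * p)))%:E)%E.
Proof.
pose A := 2 * L * g0.
have A_gt : 2 * rho < A by rewrite /A -mulrA ltr_pM2l.
(* b' and b cut the interval from 2 rho to A in three equal parts: b' > 2 rho yields the decay, b <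
   A the contraction, and b - b' carries bias and noise. *)
pose b := (2 * rho + 2 * A) / 3; pose b' := (2 * rho * 2 + A) / 3.
have b'b : b' < b by rewrite /b /b'; lra.
have rb' : 2 * rho < b' by rewrite /b'; lra.
have bA : b < A by rewrite /b; lra.
have [c c0 [n1 contr]] := drift_contraction L0 L'0 f_mon f_bnd g00 bA.
have [n2 n20 gr] := powR_contraction (mulr_gt0 (ltr0n R 2) rho0) rb'.
have [n3 n30 gr3] := powR_contraction (mulr_gt0 (ltr0n R 2) rho0) (lt_trans rb' b'b).
pose n0 := maxn n1 (maxn n2 n3).
(* Chosen such that (b - b') / N times T equals the squared bias plus the noise variance of the
   step; the inhomogeneity thus becomes a second weighted term. *)
pose T (n : nat) : R := (c * e0 ^+ 2 + cv) / (b - b') * n.+1%:R `^ (- (2 * rho)).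
have bb0 : 0 < b - b' by rewrite subr_gt0.
have K0 : 0 <= (c * e0 ^+ 2 + cv) / (b - b').
  by rewrite divr_ge0 ?(ltW bb0)// addr_ge0// mulr_ge0// sqr_ge0.
have T0 n : 0 <= T n by rewrite mulr_ge0 ?powR_ge0.
pose B0 : R := ((c * e0 ^+ 2 + cv) / (b - b')) `^ q.
have B00 : 0 <= B0 by exact: powR_ge0.
have ufin n : (\int[P]_w (s n w)%:E \is a fin_num)%E.
  by rewrite ge0_fin_numE ?error_moment_lty// expect_ge0.
pose u n := fine (\int[P]_w (s n w)%:E)%E.
have uE n : (\int[P]_w (s n w)%:E = (u n)%:E)%E by rewrite fineK.
have u0 n : 0 <= u n by rewrite fine_ge0// expect_ge0.
(* B0 lets the bound dominate T^q, the sum covers the steps before the contraction sets in, and 1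
   gives positivity. *)
pose B := B0 + 1 + \sum_(i < n0.+1) u i.+1 * i.+1%:R `^ (rho * p).
have S0 : 0 <= \sum_(i < n0.+1) u i.+1 * i.+1%:R `^ (rho * p).
  by rewrite sumr_ge0// => i _; rewrite mulr_ge0 ?powR_ge0.
have B_gt0 : 0 < B by rewrite /B ltr_pwDl// ltr_wpDl.
exists B => // n; rewrite uE lee_fin.
have small m : (m <= n0)%N -> u m.+1 <= B * m.+1%:R `^ (- (rho * p)).
  move=> mn; rewrite powRN ler_pdivlMr ?powR_gt0// /B.
  have ltm : (m < n0.+1)%N by [].
  rewrite (bigD1 (Ordinal ltm))//=.
  rewrite addrCA lerDl !addr_ge0// sumr_ge0// => i _.
  by rewrite mulr_ge0 ?powR_ge0.
elim: n => [|n IH]; first exact: small.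
have [nn|nn] := leqP n.+1 n0; first exact: small.
have n1n : (n1 <= n.+1)%N by rewrite (leq_trans _ (ltnW nn))// leq_maxl.
have n2n : (n2 <= n.+1)%N.
  by rewrite (leq_trans _ (ltnW nn))// (leq_trans _ (leq_maxr _ _))// leq_maxl.
have n3n : (n3 <= n.+1)%N.
  by rewrite (leq_trans _ (ltnW nn))// (leq_trans _ (leq_maxr _ _))// leq_maxr.
have [_ lam] := gr _ n2n; have [bn1 _] := gr3 _ n3n.
set N := n.+2%:R : R; have N0 : 0 < N by rewrite ltr0n.
pose l := 1 - b' / N.
pose w1 := 1 - b / N; pose w2 := (b - b') / N.
have w10 : 0 <= w1 by rewrite subr_ge0.
have w20 : 0 < w2 by rewrite divr_gt0.
have lE : w1 + w2 = l by rewrite /w1 /w2 /l; ring.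
have l0 : 0 < l by rewrite -lE ltr_wpDl.
pose k := l `^ (q - 1).
have k0 : 0 <= k by exact: powR_ge0.
have step : u n.+2 <= k * (w1 * u n.+1 + w2 * T n.+1 `^ q).
  rewrite -lee_fin -uE; apply: le_trans (error_step n.+1) _.
  apply: (@le_trans _ _ (\int[P]_w (k * w1 * s n.+1 w + k * w2 * T n.+1 `^ q)%:E)%E).
    apply: le_expect => //.
    - by move=> w; exact: powR_ge0.
    - by apply: measurable_funD => //; exact: measurable_funM.
    move=> w; have := contr _ n1n _ _ _ (h_f n.+1 (theta n.+1 w)).
    rewrite -/(err _ _) -/(drifted _ _) -/N => cw.
    apply: (@le_trans _ _ ((w1 * nm (err n.+1 w) ^+ 2 + w2 * T n.+1) `^ q)).
      apply: le_powR; [exact: ltW|by rewrite addr_ge0 ?sqr_ge0|].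
      apply: le_trans (lerD cw (lexx _)) _; rewrite -addrA lerD2l.
      have NE : (N `^ (- rho)) ^+ 2 = N `^ (- (2 * rho)).
        by rewrite -powR_mulrn ?powR_ge0// -powRrM mulNr mulrC.
      rewrite /noise_var -/N exprMn NE.
      rewrite le_eqVlt; apply/orP; left; apply/eqP; rewrite /w2 /T -/N.
      by field; rewrite !gt_eqF.
    have W0 : 0 < w1 + w2 by rewrite lE.
    apply: le_trans (powR_weighted2 q1 w10 (ltW w20) W0 (sqr_ge0 _) (T0 _)) _.
    by rewrite lE sqr_p ?dot_norm_ge0// mulrDr !mulrA.
  have kw1 : 0 <= k * w1 by rewrite mulr_ge0.
  have kw2 : 0 <= k * w2 * T n.+1 `^ q.
    by rewrite mulr_ge0 ?powR_ge0// mulr_ge0// ltW.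
  rewrite expectD//; last 2 first.
  - by move=> w; rewrite mulr_ge0.
  - exact: measurable_funM.
  rewrite expectZ// expect_cst uE -EFinM -EFinD lee_fin.
  by rewrite [leRHS]mulrDr [k * (w1 * _)]mulrA [k * (w2 * _)]mulrA.
apply: (le_trans step).
pose D := B * n.+1%:R `^ (- (rho * p)).
have TD : T n.+1 `^ q <= D.
  rewrite /T powRM ?powR_ge0// -powRrM -/B0.
  have -> : - (2 * rho) * q = - (rho * p) by field.
  apply: ler_pM; rewrite ?powR_ge0//.
    by rewrite /B -addrA lerDl addr_ge0.
  rewrite !powRN lef_pV2 ?posrE ?powR_gt0//.
  by apply: le_powR; rewrite ?ler_nat// mulr_ge0 ?ltW.
have D0 : 0 <= D by rewrite mulr_ge0 ?powR_ge0// ltW.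
(* Both u and T^q are at most D: the weights contribute l and Jensen's inequality l^(q-1), in total
   l^q, which is at most ((n+1)/(n+2))^(rho p). *)
apply: (@le_trans _ _ (k * (l * D))).
  have -> : l * D = w1 * D + w2 * D by rewrite -mulrDl lE.
  apply: ler_wpM2l => //; apply: lerD; apply: ler_wpM2l => //.
  exact: ltW.
rewrite mulrA [k * l]mulrC (mulr_powRB1 (ltW l0) q0).
apply: (@le_trans _ _ (((n.+1%:R / N) `^ (2 * rho)) `^ q * D)).
  by rewrite ler_wpM2r//; apply: le_powR => //; exact: ltW.
rewrite -powRrM /D mulrCA.
have -> : 2 * rho * q = rho * p by field.
rewrite powRM ?invr_ge0// powRN (powRV _ (ltW N0)) -powRN mulrAC.
by rewrite mulfV ?mul1r// gt_eqF// powR_gt0.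
Qed.

(** Noise of the steps N + 1, ..., N + i. It vanishes for i = 0, which starts the induction in
    [doob_maximal]. *)
Let mart N i w := \sum_(j < i) W (N + j).+1 w.
Let mart_norm N w i := nm (mart N i w).
Let mart_max N i w := running_max (mart_norm N w) i.

Let martS N i w : mart N i.+1 w = mart N i w + W (N + i).+1 w.
Proof. by rewrite /mart big_ord_recr. Qed.

Let m_mart N i : measurable_fun [set: family_sigma X (J (N + i))] (mart N i).
Proof.
elim: i => [|i IH].
  by rewrite /mart; under eq_fun do rewrite big_ord0; exact: measurable_cst.
rewrite addnS (_ : mart N i.+1 = fun w => mart N i w + W (N + i).+1 w); last first.
  by apply/funext => w; exact: martS.
apply: measurable_rV_add; last exact: m_W.
exact: measurable_fun_familyS (@JS _) IH.
Qed.

Let m_mart_max N i : measurable_fun [set: family_sigma X (J (N + i))] (mart_max N i).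
Proof.
elim: i => [|i IH].
  exact: (measurable_dot_norm dot (@m_mart N 0)).
rewrite (_ : mart_max N i.+1 =
    (mart_max N i \max (fun w => nm (mart N i.+1 w)))); last by [].
apply: measurable_maxr; last exact: (measurable_dot_norm dot (@m_mart N i.+1)).
by rewrite addnS; exact: measurable_fun_familyS (@JS _) IH.
Qed.

Let mart_max_ge0 N i w : 0 <= mart_max N i w.
Proof.
by case: i => [|i]; rewrite /mart_max /mart_norm/= ?le_max dot_norm_ge0 ?orbT.
Qed.

Let mart_max_ge N w i j : (j <= i)%N -> nm (mart N j w) <= mart_max N i w.
Proof.
elim: i => [|i IH]; first by rewrite leqn0 => /eqP ->.
rewrite leq_eqVlt ltnS => /orP[/eqP ->|/IH ji].
  by rewrite /mart_max/= le_max lexx orbT.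
by rewrite /mart_max/= le_max ji.
Qed.

Let m_norm_p N i : measurable_fun setT (fun w => nm (mart N i w) `^ p).
Proof.
apply: (measurableT_comp (measurable_powR _)).
exact: measurable_fun_family (measurable_dot_norm dot (@m_mart N i)).
Qed.

Let m_max_p N i a : measurable_fun setT (fun w => mart_max N i w `^ a).
Proof.
apply: (measurableT_comp (measurable_powR _)).
exact: measurable_fun_family (@m_mart_max N i).
Qed.

(** The last increment is removed first, and its variance moves into c; hence c is general in the
    induction. *)
Lemma noise_moment N i c : 0 <= c ->
  (\int[P]_w ((nm (mart N i w) ^+ 2 + c) `^ q)%:E <=
   ((c + \sum_(j < i) noise_var (N + j)) `^ q)%:E)%E.
Proof.
elim: i c => [|i IH] c c0.
  rewrite /mart; under eq_integral do rewrite big_ord0 dot_norm0 expr0n/= add0r.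
  by rewrite big_ord0 addr0 expect_cst.
under eq_integral do rewrite martS.
apply: le_trans (condM (c := fun=> c) _ (@m_mart N i) (measurable_cst _)) _ => //.
under eq_integral do rewrite -addrA.
apply: le_trans (IH _ _) _; first by rewrite addr_ge0.
by rewrite big_ord_recr/= -addrA [noise_var _ + _]addrC.
Qed.

Lemma noise_moment_lty N i : (\int[P]_w (nm (mart N i w) `^ p)%:E < +oo)%E.
Proof.
have := noise_moment N i (lexx 0).
under eq_integral do rewrite addr0 sqr_p ?dot_norm_ge0//.
by move=> /le_lt_trans; apply; rewrite ltry.
Qed.

Lemma mart_max_lty N i : (\int[P]_w (mart_max N i w `^ p)%:E < +oo)%E.
Proof.
elim: i => [|i IH].
  exact: noise_moment_lty N 0.
apply: (@le_lt_trans _ _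
   (\int[P]_w (mart_max N i w `^ p + nm (mart N i.+1 w) `^ p)%:E)%E).
  apply: le_expect => //.
  - by move=> w; exact: powR_ge0.
  - exact: measurable_funD.
  move=> w; rewrite /mart_max/= -/(mart_max N i w).
  by case: (leP (running_max _ _)) => _; rewrite (lerDl, lerDr) powR_ge0.
rewrite expectD//; last 2 first.
- by move=> w; exact: powR_ge0.
- by move=> w; exact: powR_ge0.
by apply: lte_add_pinfty; [exact: IH|exact: noise_moment_lty].
Qed.

(** The constant 2^p replaces the sharper (p / (p - 1))^p, which suffices and comes out of
    [doob_young]. *)
Lemma doob_maximal N i :
  (\int[P]_w (mart_max N i w `^ p)%:E <=
   (2 `^ p)%:E * \int[P]_w (nm (mart N i w) `^ p)%:E)%E.
Proof.
pose m k w := mart_max N k w; pose S k w := nm (mart N k w).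
have m0 k w : 0 <= m k w by exact: mart_max_ge0.
have S0 k w : 0 <= S k w by exact: dot_norm_ge0.
have mS k : measurable_fun setT (S k).
  exact: measurable_fun_family (measurable_dot_norm dot (@m_mart N k)).
pose a := (p - 1) / p; have a0 : 0 < a by rewrite divr_gt0// subr_gt0.
have a0' := ltW a0.
have mA k : measurable_fun setT (fun w => m k w `^ p) by exact: m_max_p.
have mSp k : measurable_fun setT (fun w => S k w `^ p) by exact: m_norm_p.
have mZ (F : Omega -> R) z : measurable_fun setT F -> measurable_fun setT (fun w => z * F w).
  by move=> mF; exact: measurable_funM.
have mprod k l : measurable_fun setT (fun w => m k w `^ (p - 1) * S l w).
  by apply: measurable_funM => //; exact: m_max_p.
have prod0 k l w : 0 <= m k w `^ (p - 1) * S l w.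
  by rewrite mulr_ge0// powR_ge0.
have prod_lty k l : (l <= k.+1)%N ->
    (\int[P]_w (m k w `^ (p - 1) * S l w)%:E \is a fin_num)%E.
  move=> lk; rewrite ge0_fin_numE; last exact: expect_ge0.
  apply: le_lt_trans (mart_max_lty N k.+1).
  apply: le_expect; [exact: prod0|exact: mprod|exact: m_max_p|].
  move=> w; rewrite -(mulr_powRB1 (mart_max_ge0 _ _ _) p0) mulrC.
  apply: ler_pM; rewrite ?powR_ge0//; first exact: mart_max_ge.
  apply: le_powR => //; first by rewrite subr_ge0 ltW.
  by rewrite /m /mart_max/= le_max lexx.
have A_fin k : (\int[P]_w (m k w `^ p)%:E \is a fin_num)%E.
  by rewrite ge0_fin_numE ?mart_max_lty//; apply: expect_ge0 => w; exact: powR_ge0.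
have S_fin k : (\int[P]_w (S k w `^ p)%:E \is a fin_num)%E.
  by rewrite ge0_fin_numE ?noise_moment_lty//; apply: expect_ge0 => w; exact: powR_ge0.
(* All these integrals are finite and are replaced by reals, so that terms can be subtracted and
   absorbed. *)
have [A AE] : exists A, forall k, (\int[P]_w (m k w `^ p)%:E = (A k)%:E)%E.
  by exists (fun k => fine (\int[P]_w (m k w `^ p)%:E)%E) => k; rewrite (fineK (A_fin k)).
have [B BE] : exists B, forall k l, (l <= k.+1)%N ->
    (\int[P]_w (m k w `^ (p - 1) * S l w)%:E = (B k l)%:E)%E.
  exists (fun k l => fine (\int[P]_w (m k w `^ (p - 1) * S l w)%:E)%E) => k l lk.
  by rewrite (fineK (prod_lty _ _ lk)).
have [T TE] : exists T, forall k, (\int[P]_w (S k w `^ p)%:E = (T k)%:E)%E.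
  by exists (fun k => fine (\int[P]_w (S k w `^ p)%:E)%E) => k; rewrite (fineK (S_fin k)).
have A0 k : 0 <= A k.
  by rewrite -lee_fin -AE; apply: expect_ge0 => w; exact: powR_ge0.
have T0 k : 0 <= T k.
  by rewrite -lee_fin -TE; apply: expect_ge0 => w; exact: powR_ge0.
have mp0 k w : 0 <= m k w `^ p by exact: powR_ge0.
have Sp0 k w : 0 <= S k w `^ p by exact: powR_ge0.
have Zge0 z (F : Omega -> R) : 0 <= z -> (forall w, 0 <= F w) ->
    forall w, 0 <= z * F w.
  by move=> z0 F0 w; exact: mulr_ge0.
have potential k : a * A k <= B k k.
  elim: k => [|k IH].
    have SE w : S 0%N w = 0 by rewrite /S /mart big_ord0 dot_norm0.
    have mE w : m 0%N w = 0 by exact: SE.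
    have -> : A 0%N = 0.
      apply: EFin_inj; rewrite -AE.
      by under eq_integral do rewrite mE powR0 ?gt_eqF//; rewrite expect_cst.
    have -> : B 0%N 0%N = 0.
      apply: EFin_inj; rewrite -BE//.
      by under eq_integral do rewrite SE mulr0; rewrite expect_cst.
    by rewrite mulr0.
  (* Submartingale property of the norm, weighted by m_k^(p-1), which depends on the past only. *)
  have Bk : B k k <= B k k.+1.
    rewrite -lee_fin -!BE//.
    rewrite /S; under [leRHS]eq_integral do rewrite martS.
    apply: (condN _ (@m_mart N k)); first by move=> w; exact: powR_ge0.
    exact: (measurableT_comp (measurable_powR _) (@m_mart_max N k)).
  have : a * A k.+1 + B k k.+1 <= a * A k + B k.+1 k.+1.
    have E1 := expectD P (Zge0 a _ a0' (mp0 k.+1)) (mZ _ a (mA k.+1))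
      (prod0 k k.+1) (mprod k k.+1).
    have E2 := expectD P (Zge0 a _ a0' (mp0 k)) (mZ _ a (mA k))
      (prod0 k.+1 k.+1) (mprod k.+1 k.+1).
    move: E1 E2; rewrite (expectZ P a0' (mp0 k.+1) (mA k.+1)) (expectZ P a0' (mp0 k) (mA k)).
    rewrite !AE !BE// -!EFinM -!EFinD => E1 E2.
    rewrite -lee_fin -E1 -E2; apply: le_expect.
    - by move=> w; exact: addr_ge0 (Zge0 a _ a0' (mp0 k.+1) w) (prod0 k k.+1 w).
    - exact: measurable_funD (mZ _ a (mA k.+1)) (mprod k k.+1).
    - exact: measurable_funD (mZ _ a (mA k)) (mprod k.+1 k.+1).
    by move=> w; exact: (doob_step p1 (m0 k w) (S0 k.+1 w)).
  move: IH Bk; lra.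
have young : p * B i i <= 2 `^ (p - 1) * T i + (p - 1) / 2 * A i.
  have p120 : 0 <= (p - 1) / 2 by rewrite divr_ge0// subr_ge0 ltW.
  have E1 := expectD P (Zge0 _ _ (powR_ge0 2 (p - 1)) (Sp0 i)) (mZ _ _ (mSp i))
    (Zge0 _ _ p120 (mp0 i)) (mZ _ _ (mA i)).
  move: E1; rewrite (expectZ P (powR_ge0 _ _) (Sp0 i) (mSp i)) (expectZ P p120 (mp0 i) (mA i)).
  rewrite AE TE -!EFinM -!EFinD => E1.
  have E2 := expectZ P (ltW p0) (prod0 i i) (mprod i i).
  move: E2; rewrite BE// -EFinM => E2.
  rewrite -lee_fin -E1 -E2; apply: le_expect.
  - exact: Zge0 _ _ (ltW p0) (prod0 i i).
  - exact: mZ _ _ (mprod i i).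
  - exact: measurable_funD (mZ _ _ (mSp i)) (mZ _ _ (mA i)).
  by move=> w; rewrite mulrA; exact: (doob_young p1 (m0 i w) (S0 i w)).
rewrite -[leLHS]/(\int[P]_w (m i w `^ p)%:E)%E AE.
rewrite -[X in (_ * X)%E]/(\int[P]_w (S i w `^ p)%:E)%E TE -EFinM lee_fin.
have := potential i; rewrite /a mulrAC ler_pdivrMr// [B i i * p]mulrC => pot.
(* Combines (p - 1) A <= p B with Young's bound on p B and absorbs half of the left side; p - 1 >= 1
   finishes. *)
have h2 : (p - 1) * A i <= 2 `^ p * T i.
  rewrite -(mulr_powRB1 (ler0n R 2) p0); move: pot young; lra.
by apply: le_trans h2; rewrite -[leLHS]mul1r ler_wpM2r//; move: hp; lra.
Qed.

Let errD N i w : err (N + i) w = err N w +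
  \sum_(j < i) (g0 / (N + j).+1%:R) *: h (N + j).+1 (theta (N + j) w) + mart N i w.
Proof.
elim: i => [|i IH]; first by rewrite addn0 /mart !big_ord0 !addr0.
have aux (a b c x y : 'rV[R]_d) : a + b + c + x + y = a + (b + x) + (c + y).
  by rewrite (addrAC (a + b)) !addrA.
by rewrite addnS errS /drifted IH martS big_ord_recr/= aux.
Qed.

(* Majorant of the error on the block [N, 2N]: there the drift is at most
   |err|/L' plus the bias, and Jensen turns its sum into an average. *)
Let block_bound N w : R :=
  let k := 2 `^ (p - 1) in
  k * (k * (s N w + (g0 / L') `^ p * (N%:R^-1 * \sum_(0 <= j < N) s (N + j) w)) +
       k * ((g0 * e0) `^ p * N%:R `^ (- (rho * p)) + mart_max N N w `^ p)).

Let m_block_bound N : measurable_fun setT (block_bound N).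
Proof.
have mZ (F : Omega -> R) z : measurable_fun setT F -> measurable_fun setT (fun w => z * F w).
  by move=> mF; exact: measurable_funM.
apply: (mZ); apply: measurable_funD; apply: (mZ); apply: measurable_funD.
- exact: m_s.
- by apply: (mZ); apply: (mZ); apply: measurable_sum => j; exact: m_s.
- exact: measurable_cst.
- exact: m_max_p.
Qed.

Let g0L'_ge0 : 0 <= g0 / L'.
Proof. by rewrite divr_ge0// ltW. Qed.

Lemma block_bound_ge N i w : (0 < N)%N -> (i <= N)%N -> s (N + i) w <= block_bound N w.
Proof.
move=> N0 iN; have N0r : 0 < N%:R :> R by rewrite ltr0n.
have pN : N%:R `^ (- rho) `^ p = N%:R `^ (- (rho * p)) by rewrite -powRrM mulNr.
pose a := nm (err N w).
pose b := N%:R^-1 * \sum_(0 <= j < N) (g0 / L') * nm (err (N + j) w).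
pose c := g0 * e0 * N%:R `^ (- rho).
have a0 : 0 <= a by exact: dot_norm_ge0.
have b0 : 0 <= b.
  rewrite mulr_ge0 ?invr_ge0// sumr_ge0// => j _.
  by rewrite mulr_ge0 ?dot_norm_ge0.
have c0 : 0 <= c by rewrite mulr_ge0 ?powR_ge0// mulr_ge0// ltW.
have m0 : 0 <= mart_max N N w by [].
have le1 : nm (err (N + i) w) <= (a + b) + (c + mart_max N N w).
  rewrite errD; apply: le_trans (dot_norm_triangle _ _ _) _.
  rewrite addrA; apply: lerD; last exact: mart_max_ge.
  apply: le_trans (dot_norm_triangle _ _ _) _; rewrite -addrA lerD2l.
  apply: le_trans (dot_norm_sum dot (index_enum 'I_i) xpredT
    (fun j : 'I_i => (g0 / (N + j).+1%:R) *: h (N + j).+1 (theta (N + j) w))) _.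
  (* On the block every step size is at most g0 / N, and h is f, of size at most |err| / L', plus a
     bias of at most e0 N^(-rho). *)
  pose F j := N%:R^-1 * ((g0 / L') * nm (err (N + j) w)) +
              N%:R^-1 * (g0 * e0 * N%:R `^ (- rho)).
  have F0 j : 0 <= F j.
    have g0' := ltW g00; have L'0' := ltW L'0.
    by rewrite addr_ge0 ?mulr_ge0 ?invr_ge0 ?dot_norm_ge0 ?powR_ge0.
  apply: (@le_trans _ _ (\sum_(0 <= j < i) F j)).
    rewrite big_mkord; apply: ler_sum => j _; rewrite dot_normZ.
    have Nj : N%:R <= (N + j).+1%:R :> R by rewrite ler_nat -addnS leq_addr.
    have Nj0 : 0 < (N + j).+1%:R :> R by rewrite ltr0n.
    have gle : `|g0 / (N + j).+1%:R| <= g0 / N%:R.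
      rewrite ger0_norm ?divr_ge0 ?(ltW g00)//.
      by rewrite ler_pM2l// lef_pV2// posrE.
    have hle : nm (h (N + j).+1 (theta (N + j) w)) <=
        nm (err (N + j) w) / L' + e0 * N%:R `^ (- rho).
      have -> : h (N + j).+1 (theta (N + j) w) = f (theta (N + j) w) +
          (h (N + j).+1 (theta (N + j) w) - f (theta (N + j) w)).
        by rewrite addrC subrK.
      apply: le_trans (dot_norm_triangle _ _ _) _; apply: lerD.
        exact: drift_lipschitz.
      apply: le_trans (h_f _ _) _; rewrite ler_wpM2l// !powRN.
      by rewrite lef_pV2 ?posrE ?powR_gt0//; apply: le_powR => //; exact: ltW.
    apply: le_trans (ler_pM (normr_ge0 _) (dot_norm_ge0 _ _) gle hle) _.
    by rewrite /F le_eqVlt; apply/orP; left; apply/eqP; ring.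
  (* Nonnegative terms are added up to the full block: the bound becomes independent of i, and the
     weights 1/N sum to 1. *)
  apply: (@le_trans _ _ (\sum_(0 <= j < N) F j)).
    by rewrite [leRHS](big_cat_nat (n := i))//= lerDl sumr_ge0.
  rewrite big_split/= -mulr_sumr -/b lerD2l sumr_const_nat subn0 -/c.
  by rewrite -[_ *+ N]mulr_natr mulrAC mulVf ?mul1r// gt_eqF.
have k0 : 0 <= 2 `^ (p - 1) :> R by exact: powR_ge0.
apply: le_trans (le_powR (ltW p0) (dot_norm_ge0 _ _) le1) _.
apply: le_trans (powR_add_le (ltW p1) (addr_ge0 a0 b0) (addr_ge0 c0 m0)) _.
rewrite /block_bound ler_wpM2l//; apply: lerD.
  apply: le_trans (powR_add_le (ltW p1) a0 b0) _.
  rewrite ler_wpM2l// lerD2l /b.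
  have N10 (j : nat) : j \in index_iota 0 N -> 0 <= N%:R^-1 :> R.
    by rewrite invr_ge0.
  have x0 (j : nat) : j \in index_iota 0 N -> 0 <= g0 / L' * nm (err (N + j) w).
    by move=> _; rewrite mulr_ge0 ?dot_norm_ge0.
  have N11 : \sum_(0 <= j < N) N%:R^-1 = 1 :> R.
    by rewrite sumr_const_nat subn0 -[_ *+ N]mulr_natr mulVf// gt_eqF.
  have := powR_jensen (ltW p1) N10 x0 N11; rewrite -!mulr_sumr => J1.
  apply: le_trans J1 _.
  rewrite mulrCA ler_wpM2l ?invr_ge0// mulr_sumr; apply: ler_sum => j _.
  by rewrite powRM ?dot_norm_ge0.
apply: le_trans (powR_add_le (ltW p1) c0 m0) _.
rewrite ler_wpM2l// lerD2r /c powRM ?powR_ge0//; last by rewrite mulr_ge0// ltW.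
by rewrite pN.
Qed.

Lemma block_moment : exists2 K : R, 0 < K & forall N, (0 < N)%N ->
  (\int[P]_w (block_bound N w)%:E <= (K * N%:R `^ (- (rho * p)))%:E)%E.
Proof.
have [B B0 hB] := error_moment.
have rp0 : 0 <= rho * p by rewrite mulr_ge0 ?ltW.
pose k : R := 2 `^ (p - 1); have k0 : 0 <= k by exact: powR_ge0.
pose c1 := (g0 / L') `^ p; have c10 : 0 <= c1 by exact: powR_ge0.
pose c2 := (g0 * e0) `^ p; have c20 : 0 <= c2 by exact: powR_ge0.
pose c3 := 2 `^ p * cv `^ q; have c30 : 0 <= c3 by rewrite mulr_ge0 ?powR_ge0.
(* The summand 1 only secures positivity. *)
exists (k * (k * (B + c1 * B) + k * (c2 + c3)) + 1).
  apply: ltr_wpDl => //; have B0' := ltW B0.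
  by repeat first [assumption | apply: mulr_ge0 | apply: addr_ge0].
move=> N N0; have N0r : 0 < N%:R :> R by rewrite ltr0n.
set x := N%:R `^ (- (rho * p)); have x0 : 0 <= x by exact: powR_ge0.
have sB j : (\int[P]_w (s (N + j) w)%:E <= (B * x)%:E)%E.
  rewrite -(prednK N0) addSn; apply: le_trans (hB _) _; rewrite lee_fin.
  rewrite ler_pM2l// le_powRN//.
  by rewrite -{1}(prednK N0) ler_nat ltnS leq_addr.
have mxB : (\int[P]_w (mart_max N N w `^ p)%:E <= (c3 * x)%:E)%E.
  apply: le_trans (doob_maximal N N) _.
  rewrite /c3 -mulrA EFinM; apply: lee_wpmul2l; first by rewrite lee_fin powR_ge0.
  have := noise_moment N N (lexx 0).
  under eq_integral do rewrite addr0 sqr_p ?dot_norm_ge0//.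
  move=> /le_trans; apply; rewrite add0r lee_fin.
  have -> : x = (N%:R `^ (- (2 * rho))) `^ q.
    by rewrite /x -powRrM; congr (_ `^ _); field.
  rewrite -powRM ?powR_ge0//; apply: le_powR.
  - exact: ltW.
  - by rewrite sumr_ge0.
  (* The N increments each have variance at most cv N^(-1 - 2 rho), in total cv N^(-2 rho). *)
  apply: (@le_trans _ _ (\sum_(j < N) cv * (N%:R^-1 * N%:R `^ (- (2 * rho))))).
    apply: ler_sum => j _; rewrite /noise_var ler_wpM2l//.
    have Nj : N%:R <= (N + j).+1%:R :> R by rewrite ler_nat -addnS leq_addr.
    apply: ler_pM; rewrite ?powR_ge0 ?invr_ge0//.
      by rewrite lef_pV2 ?posrE// ltr0n.
    by rewrite le_powRN// mulr_ge0// ltW.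
  rewrite sumr_const card_ord -[_ *+ N]mulr_natr -mulrA ler_wpM2l//.
  by rewrite mulrAC mulVf ?mul1r// gt_eqF.
have mZ (F : Omega -> R) z : measurable_fun setT F -> measurable_fun setT (fun w => z * F w).
  by move=> mF; exact: measurable_funM.
have Zge0 z (F : Omega -> R) : 0 <= z -> (forall w, 0 <= F w) ->
    forall w, 0 <= z * F w.
  by move=> z0 F0 w; exact: mulr_ge0.
have Dge0 (F G : Omega -> R) : (forall w, 0 <= F w) -> (forall w, 0 <= G w) ->
    forall w, 0 <= F w + G w.
  by move=> F0 G0 w; exact: addr_ge0.
have EZ z (F : Omega -> R) b : 0 <= z -> (forall w, 0 <= F w) -> measurable_fun setT F ->
    (\int[P]_w (F w)%:E <= b%:E)%E -> (\int[P]_w (z * F w)%:E <= (z * b)%:E)%E.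
  by move=> z0 F0 mF Fb; rewrite expectZ// EFinM; apply: lee_wpmul2l.
have ED (F G : Omega -> R) a b : (forall w, 0 <= F w) -> (forall w, 0 <= G w) ->
    measurable_fun setT F -> measurable_fun setT G ->
    (\int[P]_w (F w)%:E <= a%:E)%E -> (\int[P]_w (G w)%:E <= b%:E)%E ->
    (\int[P]_w (F w + G w)%:E <= (a + b)%:E)%E.
  by move=> F0 G0 mF mG Fa Gb; rewrite expectD// EFinD; exact: leeD.
pose Sm w : R := \sum_(0 <= j < N) s (N + j) w.
have Sm0 w : 0 <= Sm w by rewrite sumr_ge0.
have mSm : measurable_fun setT Sm by apply: measurable_sum => j; exact: m_s.
have SmB : (\int[P]_w (Sm w)%:E <= (N%:R * (B * x))%:E)%E.
  rewrite (expect_sum _ _ (fun j => s0 (N + j)) (fun j => m_s (N + j))).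
  apply: (@le_trans _ _ (\sum_(0 <= j < N) (B * x)%:E)%E).
    by apply: lee_sum => j _; exact: sB.
  by rewrite sumEFin sumr_const_nat subn0 lee_fin -(mulr_natl (B * x)).
have Ni0 : 0 <= N%:R^-1 :> R by rewrite invr_ge0.
pose F1 w : R := c1 * (N%:R^-1 * Sm w).
have F10 : forall w, 0 <= F1 w := Zge0 c1 _ c10 (Zge0 _ _ Ni0 Sm0).
have mF1 : measurable_fun setT F1 := mZ _ c1 (mZ _ N%:R^-1 mSm).
have F1B : (\int[P]_w (F1 w)%:E <= (c1 * (N%:R^-1 * (N%:R * (B * x))))%:E)%E :=
  EZ c1 _ _ c10 (Zge0 _ _ Ni0 Sm0) (mZ _ _ mSm) (EZ _ _ _ Ni0 Sm0 mSm SmB).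
have sN : (\int[P]_w (s N w)%:E <= (B * x)%:E)%E by have := sB 0%N; rewrite addn0.
pose F2 w : R := k * (s N w + F1 w).
have F20 : forall w, 0 <= F2 w := Zge0 k _ k0 (Dge0 _ _ (s0 N) F10).
have msF1 := measurable_funD (@m_s N) mF1.
have mF2 : measurable_fun setT F2 := mZ _ k msF1.
have F2B : (\int[P]_w (F2 w)%:E <= (k * (B * x + c1 * (N%:R^-1 * (N%:R * (B * x)))))%:E)%E :=
  EZ k _ _ k0 (Dge0 _ _ (s0 N) F10) msF1 (ED _ _ _ _ (s0 N) F10 (@m_s N) mF1 sN F1B).
pose F3 w : R := k * (c2 * x + mart_max N N w `^ p).
have m3 : measurable_fun setT (fun w => mart_max N N w `^ p) by exact: m_max_p.
have p3 w : 0 <= mart_max N N w `^ p by exact: powR_ge0.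
have c2x (w : Omega) : 0 <= c2 * x by exact: mulr_ge0.
have mc2x : measurable_fun setT (fun w : Omega => c2 * x) by [].
have c2B : (\int[P]_w (c2 * x)%:E <= (c2 * x)%:E)%E by rewrite expect_cst.
have F30 : forall w, 0 <= F3 w := Zge0 k _ k0 (Dge0 _ _ c2x p3).
have mF3 : measurable_fun setT F3 := mZ _ k (measurable_funD mc2x m3).
have F3B : (\int[P]_w (F3 w)%:E <= (k * (c2 * x + c3 * x))%:E)%E :=
  EZ k _ _ k0 (Dge0 _ _ c2x p3) (measurable_funD mc2x m3)
    (ED _ _ _ _ c2x p3 mc2x m3 c2B mxB).
have := EZ k _ _ k0 (Dge0 _ _ F20 F30) (measurable_funD mF2 mF3)
  (ED _ _ _ _ F20 F30 mF2 mF3 F2B F3B).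
move=> /le_trans; apply; rewrite lee_fin mulrDl mul1r -subr_ge0.
have -> : N%:R^-1 * (N%:R * (B * x)) = B * x by rewrite mulKf// gt_eqF.
apply: le_trans x0 _; rewrite le_eqVlt; apply/orP; left; apply/eqP; ring.
Qed.

Lemma sup_moment eta : 0 < eta < rho -> exists2 kappa : R, 0 < kappa &
  forall n, (0 < n)%N ->
    ((\int[P]_w ereal_sup [set (k%:R `^ (eta * p) * nm (theta k w - ts) `^ p)%:E
        | k in [set k : nat | (n <= k)%N]]) `^ p^-1 <=
     (kappa * n%:R `^ (- (rho - eta)))%:E)%E.
Proof.
move=> /andP[eta0 eta_rho]; have [K K0 hK] := block_moment.
pose dl := (rho - eta) * p; have dl0 : 0 < dl by rewrite mulr_gt0// subr_gt0.
(* Block j starts at n 2^j and contributes at most a constant times n^(-dl) z^j; z < 1 because eta <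
   rho. *)
pose z : R := 2 `^ (- dl).
have z0 : 0 < z by exact: powR_gt0.
have z1 : z < 1.
  rewrite /z powRN invf_lt1 ?powR_gt0//.
  have /(_ 1 2) := gt0_ltr_powR dl0.
  by rewrite powR1; apply; rewrite ?nnegrE// ltr1n.
pose c := K * 2 `^ (eta * p) / (1 - z).
have c0 : 0 < c by rewrite divr_gt0 ?subr_gt0// mulr_gt0// powR_gt0.
exists (c `^ p^-1); first exact: powR_gt0.
move=> n n0; have n0r : 0 < n%:R :> R by rewrite ltr0n.
have ep0 : 0 < eta * p by rewrite mulr_gt0.
(* The weight k^(eta p) at the right end of block j, where it is largest. *)
pose a j : R := (n * 2 ^ j.+1)%:R `^ (eta * p).
have a0 j : 0 <= a j by exact: powR_ge0.
pose G j w := (a j * block_bound (n * 2 ^ j) w)%:E.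
have bb0 N w : 0 <= block_bound N w.
  have k0 := powR_ge0 (2 : R) (p - 1).
  apply: mulr_ge0 => //; apply: addr_ge0; apply: mulr_ge0 => //; apply: addr_ge0 => //.
  - apply: mulr_ge0; first exact: powR_ge0.
    by rewrite mulr_ge0 ?invr_ge0// sumr_ge0.
  - by rewrite mulr_ge0 ?powR_ge0.
  - exact: powR_ge0.
have G0 j w : (0 <= G j w)%E by rewrite lee_fin mulr_ge0.
have mG j : measurable_fun setT (G j).
  by apply/measurable_EFinP; apply: measurable_funM => //; exact: m_block_bound.
pose S w := ereal_sup [set (k%:R `^ (eta * p) * s k w)%:E
        | k in [set k : nat | (n <= k)%N]].
have S0 w : (0 <= S w)%E.
  apply: le_ereal_sup_tmp; exists (n%:R `^ (eta * p) * s n w)%:E; first by exists n => /=.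
  by rewrite lee_fin mulr_ge0 ?powR_ge0.
have mS : measurable_fun setT S.
  apply: (@measurable_fun_esups _ _ _ setT (fun k w => (k%:R `^ (eta * p) * s k w)%:E) _ n).
  by move=> k; apply/measurable_EFinP; apply: measurable_funM => //; exact: m_s.
have SG w : (S w <= \sum_(0 <= j <oo) G j w)%E.
  apply: ge_ereal_sup => _ [k /= nk <-].
  have kn0 : (0 < k %/ n)%N by rewrite divn_gt0.
  (* The index of the block that contains k. *)
  pose j := trunc_log 2 (k %/ n).
  have /andP[j1 j2] : (2 ^ j <= k %/ n < 2 ^ j.+1)%N by exact: trunc_log_bounds.
  have nj : (n * 2 ^ j <= k)%N.
    by rewrite (leq_trans _ (leq_trunc_div k n))// mulnC leq_mul2r j1 orbT.
  have nj1 : (k < n * 2 ^ j.+1)%N by rewrite mulnC -ltn_divLR.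
  apply: (@le_trans _ _ (G j w)).
    rewrite lee_fin; apply: ler_pM; rewrite ?powR_ge0//.
      by apply: le_powR; [exact: ltW|exact: ler0n|rewrite ler_nat ltnW].
    rewrite -{1}(subnKC nj); apply: block_bound_ge; first by rewrite muln_gt0 n0 expn_gt0.
    by rewrite leq_subLR addnn -muln2 -mulnA -expnSr ltnW.
  apply: le_trans (nneseries_lim_ge j.+1 _); last by move=> i _ _.
  rewrite big_nat_recr//= leeDr// sume_ge0// => i _; exact: G0.
have EG j : (\int[P]_w G j w <=
    (K * 2 `^ (eta * p) * n%:R `^ (- dl) * z ^+ j)%:E)%E.
  have nj0 : (0 < n * 2 ^ j)%N by rewrite muln_gt0 n0 expn_gt0.
  rewrite /G expectZ//; apply: le_trans (lee_wpmul2l _ (hK _ nj0)) _.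
    by rewrite lee_fin.
  rewrite -EFinM lee_fin le_eqVlt; apply/orP; left; apply/eqP.
  pose Y : R := (n * 2 ^ j)%:R; have Y0 : 0 < Y by rewrite ltr0n.
  have -> : a j = Y `^ (eta * p) * 2 `^ (eta * p).
    by rewrite /a expnSr mulnA natrM powRM.
  have YD : Y `^ (eta * p) * Y `^ (- (rho * p)) = Y `^ (- dl).
    rewrite -powRD ?(gt_eqF Y0) ?implybT//; congr (_ `^ _).
    by rewrite /dl; ring.
  have Yz : Y `^ (- dl) = n%:R `^ (- dl) * z ^+ j.
    by rewrite /Y natrM powRM// natrX -powR_mulrn// powRAC powR_mulrn// powR_ge0.
  transitivity (K * 2 `^ (eta * p) * (Y `^ (eta * p) * Y `^ (- (rho * p)))); first by ring.
  by rewrite YD Yz !mulrA.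
have EGsum : (\int[P]_w S w <= (c * n%:R `^ (- dl))%:E)%E.
  apply: (@le_trans _ _ (\int[P]_w (\sum_(0 <= j <oo) G j w))%E).
    apply: ge0_le_integral => //.
    by apply: ge0_emeasurable_sum => // j w _ _; exact: G0.
  rewrite integral_nneseries//.
  apply: lime_le.
    by apply: is_cvg_nneseries => j _ _; apply: integral_ge0 => w _; exact: G0.
  apply: nearW => m.
  apply: (@le_trans _ _ (\sum_(0 <= j < m)
      (K * 2 `^ (eta * p) * n%:R `^ (- dl) * z ^+ j)%:E)%E).
    by apply: lee_sum => j _; exact: EG.
  rewrite sumEFin lee_fin.
  have cn0 : 0 <= K * 2 `^ (eta * p) * n%:R `^ (- dl).
    by rewrite !mulr_ge0 ?powR_ge0// ltW.
  have := geometric_le_lim m cn0 z0; rewrite gtr0_norm// => /(_ z1).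
  move=> /le_trans; apply; rewrite /c le_eqVlt; apply/orP; left; apply/eqP; ring.
have cn0 : 0 <= c * n%:R `^ (- dl) by rewrite mulr_ge0 ?powR_ge0// ltW.
have -> : (c `^ p^-1 * n%:R `^ (- (rho - eta)) = (c * n%:R `^ (- dl)) `^ p^-1)%R.
  rewrite powRM ?powR_ge0 ?(ltW c0)// -powRrM; congr (_ * _ `^ _).
  by rewrite /dl; field; rewrite gt_eqF.
rewrite -poweR_EFin; apply: gt0_ler_poweR => //.
- by rewrite invr_ge0 ltW.
- by rewrite in_itv/= leey andbT; apply: integral_ge0 => w _; exact: S0.
- by rewrite in_itv/= leey andbT lee_fin.
Qed.

(** [error_moment] starts at n = 1, so the moment of the initial value is added; the cost of the
    first step depends on it. *)
Lemma uniform_moment : exists2 B : R, 0 < B & forall n,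
  (\int[P]_w ((1 + nm (theta n w)) `^ p)%:E <= B%:E)%E.
Proof.
have [B B0 hB] := error_moment.
have [B' hB'] : exists B', (\int[P]_w (s 0 w)%:E = B'%:E)%E.
  exists (fine (\int[P]_w (s 0 w)%:E)%E); rewrite fineK//.
  by rewrite ge0_fin_numE ?error_moment_lty// expect_ge0.
have B'0 : 0 <= B' by rewrite -lee_fin -hB' expect_ge0.
have sB n : (\int[P]_w (s n w)%:E <= (B + B')%:E)%E.
  case: n => [|n]; first by rewrite hB' lee_fin lerDr ltW.
  apply: le_trans (hB n) _; rewrite lee_fin -[leLHS]addr0 lerD//.
  (* Writes 1 as a power of 1, so that monotonicity in the base bounds n.+1 to the power - rho p by
     1. *)
  rewrite -[leRHS]mulr1 ler_pM2l// -[X in _ <= X](congr1 (fun h => h (- (rho * p))) (powR1 R)).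
  by rewrite le_powRN// ?ler1n// mulr_ge0// ltW.
pose k : R := 2 `^ (p - 1); have k0 : 0 < k by exact: powR_gt0.
pose a := (1 + nm ts) `^ p; have a0 : 0 <= a by exact: powR_ge0.
exists (k * a + k * (B + B')).
  by rewrite ltr_wpDl ?mulr_ge0 ?(ltW k0)// mulr_gt0// ltr_pwDl.
move=> n; apply: (@le_trans _ _ (\int[P]_w (k * a + k * s n w)%:E)%E).
  apply: le_expect.
  - by move=> w; exact: powR_ge0.
  - apply: (measurableT_comp (measurable_powR _)); apply: measurable_funD => //.
    by apply: measurable_dot_norm; exact: measurable_fun_family (@m_theta n).
  - apply: measurable_funD => //; apply: measurable_funM => //; exact: m_s.
  move=> w; rewrite -mulrDr; have n1 : 0 <= 1 + nm ts by rewrite addr_ge0 ?dot_norm_ge0.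
  apply: le_trans (powR_add_le (ltW p1) n1 (dot_norm_ge0 dot (err n w))).
  apply: le_powR; first exact: ltW.
    by rewrite addr_ge0 ?dot_norm_ge0.
  rewrite -addrA lerD2l -{1}(subrK ts (theta n w)) addrC.
  exact: dot_norm_triangle.
have ka0 : 0 <= k * a by rewrite mulr_ge0// ltW.
have ks0 w : 0 <= k * s n w by rewrite mulr_ge0// ltW.
have mks : measurable_fun setT (fun w => k * s n w).
  by apply: measurable_funM => //; exact: m_s.
rewrite (expectD P (F := fun=> k * a) (fun=> ka0) _ ks0 mks)//.
rewrite expect_cst (expectZ P (ltW k0) (s0 n) (@m_s n)) EFinD [(k * (B + B'))%:E]EFinM.
by rewrite leeD2l//; apply: lee_wpmul2l; rewrite ?lee_fin ?(ltW k0).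
Qed.

Lemma sup_almost_surely delta : 0 < delta ->
  {ae P, forall w, (n%:R `^ (rho - delta) * nm (theta n w - ts)) @[n --> \oo] --> (0 : R)}.
Proof.
move=> delta0.
(* The bound rho / 2 keeps eta positive; delta / 2 makes the exponent rho - delta - eta at most -
   delta / 2. *)
pose dl := Num.min (delta / 2) (rho / 2).
have dl0 : 0 < dl by rewrite lt_min !divr_gt0.
pose eta := rho - dl.
have eta_rho : 0 < eta < rho.
  rewrite /eta subr_gt0 gtrBl dl0 andbT /dl gt_min; apply/orP; right.
  by rewrite ltr_pdivrMr// ltr_pMr// ltr1n.
have eta_dl : rho - delta - eta < 0.
  have : dl <= delta / 2 by rewrite /dl ge_min lexx.
  by rewrite /eta; lra.
(* For n = 1 the supremum is integrable, hence almost surely finite, and its value bounds the whole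
   trajectory. *)
have [kappa kappa0 /(_ 1%N isT)] := sup_moment eta_rho.
set S := (fun w => ereal_sup _) => ES.
have S0 w : (0 <= S w)%E.
  apply: le_ereal_sup_tmp; exists (1%:R `^ (eta * p) * nm (theta 1 w - ts) `^ p)%:E.
    by exists 1%N.
  by rewrite lee_fin mulr_ge0 ?powR_ge0.
have mS : measurable_fun setT S.
  apply: (@measurable_fun_esups _ _ _ setT (fun k w => (k%:R `^ (eta * p) * s k w)%:E) _ 1).
  by move=> k; apply/measurable_EFinP; apply: measurable_funM => //; exact: m_s.
have iS : P.-integrable setT S.
  apply/integrableP; split => //; under eq_integral do rewrite gee0_abs//.
  apply: (@lty_poweRy _ _ p^-1); first by rewrite invr_eq0 gt_eqF.
  exact: le_lt_trans ES (ltry _).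
have := integrable_ae measurableT iS; apply: filterS => w /(_ Logic.I) Sfin.
pose c := fine (S w) `^ p^-1; have c0 : 0 <= c by exact: powR_ge0.
have bound n : (0 < n)%N -> n%:R `^ (rho - delta) * nm (theta n w - ts) <=
    c * n%:R `^ (rho - delta - eta).
  move=> n0; have n0r : 0 < n%:R :> R by rewrite ltr0n.
  have h1 : n%:R `^ (eta * p) * nm (theta n w - ts) `^ p <= fine (S w).
    rewrite -lee_fin fineK//; apply: ereal_sup_ubound; by exists n.
  have h2 : n%:R `^ eta * nm (theta n w - ts) <= c.
    have x0 : 0 <= n%:R `^ eta * nm (theta n w - ts).
      by rewrite mulr_ge0 ?powR_ge0 ?dot_norm_ge0.
    have xp : n%:R `^ eta * nm (theta n w - ts) =
        ((n%:R `^ eta * nm (theta n w - ts)) `^ p) `^ p^-1.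
      by rewrite -powRrM mulfV ?gt_eqF// powRr1.
    rewrite [leLHS]xp; apply: le_powR; rewrite ?powR_ge0 ?invr_ge0 ?(ltW p0)//.
    by rewrite powRM ?powR_ge0 ?dot_norm_ge0// -powRrM.
  have -> : n%:R `^ (rho - delta) = n%:R `^ (rho - delta - eta) * n%:R `^ eta.
    by rewrite -powRD ?(gt_eqF n0r) ?implybT// subrK.
  by rewrite -mulrA [leRHS]mulrC ler_wpM2l// powR_ge0.
apply/cvgr0Pnorm_lt => ep ep0.
pose x := (c + 1) / ep; have x0 : 0 < x by rewrite divr_gt0// ltr_wpDl.
pose b := - (rho - delta - eta); have b0 : 0 < b by rewrite oppr_gt0.
exists (Num.truncn (x `^ b^-1)).+1 => // n /= nn.
have n0 : (0 < n)%N by exact: leq_trans nn.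
have nx : x `^ b^-1 < n%:R.
  have := truncn_itv (powR_ge0 x b^-1) => /andP[_ hlt].
  by apply: lt_le_trans hlt _; rewrite ler_nat.
rewrite ger0_norm ?mulr_ge0 ?powR_ge0 ?dot_norm_ge0//.
apply: le_lt_trans (bound n n0) _.
have n0r : 0 < n%:R :> R by rewrite ltr0n.
have -> : rho - delta - eta = - b by rewrite opprK.
have xn : x < n%:R `^ b.
  have := gt0_ltr_powR b0 (powR_ge0 x b^-1) (ltW n0r) nx.
  by rewrite -powRrM mulVf ?gt_eqF// powRr1// ltW.
rewrite powRN ltr_pdivrMr ?powR_gt0//.
have : c < ep * x by rewrite /x mulrC divfK ?gt_eqF// ltrDl.
by move=> /lt_trans; apply; rewrite ltr_pM2l.
Qed.

End stochastic_approximation.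

(** * Computational cost *)

Section level_cost.
Context {R : realType} {d : nat} (dot : {dot 'rV[R]_d for idfun}).
Variables (G1 G2 : 'rV[R]_d -> R) (M K K1 alpha beta beta1 p r rho sig0 eps0 : R)
  (eps sig C : nat -> R).
Local Notation nm := (dot_norm dot).
Local Notation lvl := (ml_level G2 M alpha eps).
Local Notation rep := (ml_reps G1 G2 M alpha beta eps sig).
Local Notation kap := (ml_kappa G1 G2 M alpha beta eps sig).
Hypotheses (hp : 2 <= p) (G1_gt0 : forall t, 0 < G1 t) (G2_gt0 : forall t, 0 < G2 t)
  (M1 : 1 < M) (K0 : 0 < K) (K10 : 0 < K1) (alpha0 : 0 < alpha) (beta0 : 0 < beta)
  (beta1_neq : beta != 1 / 2 -> 0 <= beta1 <= Num.min beta (1 / 2))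
  (beta1_eq : beta = 1 / 2 -> 0 <= beta1 < 1 / 2)
  (C_gt0 : forall k, (0 < k)%N -> 0 < C k)
  (cond_iii : forall k, (0 < k)%N -> C k <= K * M ^+ k)
  (cond_iv1 : forall t, G1 t <= K1 * (1 + nm t) `^ (beta1 * p))
  (cond_iv2 : forall t, G2 t <= K1 * (1 + nm t) `^ (alpha * p))
  (rho_def : rho = 1 / 2 * (1 + r))
  (sig00 : 0 < sig0) (eps00 : 0 < eps0)
  (sig_gt0 : forall n, (0 < n)%N -> 0 < sig n)
  (sig_def : forall n, (0 < n)%N -> sig n ^+ 2 = sig0 ^+ 2 * (1 / n%:R `^ r))
  (eps_def : forall n, (0 < n)%N -> eps n = eps0 * (1 / n%:R `^ rho))
  (b_alpha : Num.min beta (1 / 2) < alpha)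
  (b_r : Num.min beta (1 / 2) / (alpha - Num.min beta (1 / 2)) < r).

Definition step_cost (j : nat) (t : 'rV[R]_d) : R :=
  \sum_(1 <= k < (lvl j t).+1) (rep j k t)%:R * C k.

(** The power r of j comes from sigma_j^(-2), the other factor from the square of [level_weight],
    where M^m is of order j^(rho / alpha). *)
Definition cost_rate (j : nat) : R :=
  if 1 / 2 < beta then j%:R `^ r
  else if beta == 1 / 2 then j%:R `^ r * ln j.+1%:R ^+ 2
  else j%:R `^ (r + rho / alpha * (1 - 2 * beta)).

Let M0 : 0 < M. Proof. exact: lt_trans M1. Qed.
Let p0 : 0 < p. Proof. by apply: lt_le_trans hp. Qed.

Let b0 := Num.min beta (1 / 2).
Let b0_gt0 : 0 < b0. Proof. by rewrite lt_min beta0 divr_gt0. Qed.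

Let r_gt0 : 0 < r.
Proof. by apply: lt_trans b_r; rewrite divr_gt0// subr_gt0. Qed.

Let rho_gt0 : 0 < rho. Proof. by rewrite rho_def mulr_gt0 ?divr_gt0 ?addr_gt0. Qed.

(** The assumption r > b0 / (alpha - b0) means r alpha > b0 (1 + r), and 1 + r = 2 rho. *)
Let rho_b0 : rho / alpha * (2 * b0) < r.
Proof.
have : b0 < r * (alpha - b0) by rewrite -ltr_pdivrMr ?subr_gt0.
rewrite mulrAC ltr_pdivrMr// rho_def; lra.
Qed.

Let T t := 1 + nm t.
Let T1 t : 1 <= T t. Proof. by rewrite /T lerDl dot_norm_ge0. Qed.
Let T0 t : 0 < T t. Proof. exact: lt_le_trans (T1 t). Qed.
Let Tp1 t a : 0 <= a -> 1 <= T t `^ a.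
Proof. exact: powR_ge1. Qed.

Let growth j t := T t `^ p * j%:R `^ (rho / alpha).

Let growth_ge1 j t : (0 < j)%N -> 1 <= growth j t.
Proof.
move=> j0; apply: mulr_ege1; first exact: Tp1 (ltW p0).
by rewrite powR_ge1 ?ler1n// divr_ge0// ltW.
Qed.

Let cM := M * (1 + (K1 / eps0) `^ alpha^-1).

Let cM_ge1 : 1 <= cM.
Proof.
apply: le_trans (ltW M1) _; rewrite -[leLHS]mulr1 ler_pM2l//.
by rewrite lerDl powR_ge0.
Qed.

Let cM_gt0 : 0 < cM. Proof. exact: lt_le_trans cM_ge1. Qed.

(** The root of order alpha turns the exponents alpha p and rho into p and rho / alpha. *)
Lemma level_growth j t : (0 < j)%N -> M ^+ lvl j t <= cM * growth j t.
Proof.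
move=> j0; have j0r : 0 < j%:R :> R by rewrite ltr0n.
have eps_gt0 : 0 < eps j by rewrite eps_def// !mulr_gt0// invr_gt0 powR_gt0.
have g1 := growth_ge1 t j0; have g0 : 0 < growth j t by exact: lt_le_trans g1.
pose x := alpha^-1 * (ln (G2 t / eps j) / ln M).
have Gx : 0 < G2 t / eps j by rewrite divr_gt0.
have Mx : M `^ x = (G2 t / eps j) `^ alpha^-1.
  rewrite /powR !gt_eqF// /x; congr expR.
  by rewrite -mulrA divfK// gt_eqF// ln_gt0.
have Gle : (G2 t / eps j) `^ alpha^-1 <= (K1 / eps0) `^ alpha^-1 * growth j t.
  have -> : (K1 / eps0) `^ alpha^-1 * growth j t =
      (K1 / eps0 * (T t `^ (alpha * p) * j%:R `^ rho)) `^ alpha^-1.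
    rewrite [RHS]powRM ?divr_ge0 ?mulr_ge0 ?powR_ge0 ?(ltW K10) ?(ltW eps00)//.
    rewrite [(T t `^ _ * _) `^ _]powRM ?powR_ge0// -!powRrM.
    by congr (_ * (_ `^ _ * _)); rewrite mulrAC divff ?mul1r// gt_eqF.
  apply: le_powR; rewrite ?invr_ge0 ?(ltW alpha0) ?(ltW Gx)//.
  rewrite eps_def// ler_pdivrMr; last by rewrite !mulr_gt0// invr_gt0 powR_gt0.
  apply: le_trans (cond_iv2 t) _; rewrite le_eqVlt; apply/orP; left; apply/eqP.
  by rewrite /T; field; rewrite !gt_eqF// powR_gt0.
have MxG : M * M `^ x <= M * ((K1 / eps0) `^ alpha^-1 * growth j t).
  by rewrite ler_pM2l// Mx.
have h1 : M <= M * growth j t by rewrite -[leLHS]mulr1 ler_pM2l.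
have K1e : 0 <= (K1 / eps0) `^ alpha^-1 * growth j t.
  by apply: mulr_ge0; [exact: powR_ge0|exact: ltW].
rewrite /cM -powR_mulrn ?(ltW M0)// ml_level_real -/x.
(* The two summands of [cM] serve the two cases: rounding x up costs at most a factor M, and
   otherwise the level is 1. *)
have [h|h] := leP 1 ((Num.ceil x)%:~R : R).
  apply: (@le_trans _ _ (M `^ (x + 1))).
    rewrite ler_powR ?(ltW M1)// -lerBlDr.
    by have /andP[/ltW + _] := ceil_itv x; rewrite intrB.
  rewrite powRD ?(gt_eqF M0) ?implybT// powRr1 ?(ltW M0)// mulrC.
  rewrite -mulrA mulrDl mul1r [leRHS]mulrDr; apply: le_trans MxG _.
  by rewrite lerDr mulr_ge0 ?ltW.
rewrite powRr1 ?(ltW M0)// -mulrA mulrDl mul1r [leRHS]mulrDr.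
by apply: le_trans h1 _; rewrite lerDl; exact: mulr_ge0 (ltW M0) K1e.
Qed.

Lemma step_cost_ge0 j t : 0 <= step_cost j t.
Proof.
rewrite /step_cost big_nat_cond sumr_ge0// => k; rewrite andbT => /andP[k0 _].
by rewrite mulr_ge0// ltW// C_gt0.
Qed.

Let w j t := level_weight M beta (lvl j t).

(** A count is at most its unrounded value plus 1. The unrounded part weighted by C_k gives the
    level sum again, hence the square of the weight already present in kappa; the units give the sum
    of the M^k. *)
Lemma step_cost_le j t : (0 < j)%N -> step_cost j t <=
  K * (level_const M beta / sig0 ^+ 2 * (j%:R `^ r * G1 t ^+ 2 * w j t ^+ 2) +
       M / (M - 1) * cM * growth j t).
Proof.
move=> j0; have j0r : 0 < j%:R :> R by rewrite ltr0n.
have eps_gt0 n : (0 < n)%N -> 0 < eps n.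
  by move=> n0; rewrite eps_def// !mulr_gt0// invr_gt0 powR_gt0// ltr0n.
apply: (@le_trans _ _ (\sum_(1 <= k < (lvl j t).+1)
   (K * (kap j t * M `^ (k%:R * (1 / 2 - beta))) + K * M ^+ k))).
  rewrite /step_cost big_nat_cond [leRHS]big_nat_cond ler_sum// => k.
  rewrite andbT => /andP[k0 _].
  have h1 : (rep j k t)%:R <= kap j t * M `^ (- (k%:R * (beta + 1 / 2))) + 1.
    exact: ml_reps_le.
  apply: le_trans (ler_pM (ler0n _ _) (ltW (C_gt0 k0)) h1 (cond_iii k0)) _.
  have -> : M `^ (k%:R * (1 / 2 - beta)) = M `^ (- (k%:R * (beta + 1 / 2))) * M ^+ k.
    rewrite -powR_mulrn ?(ltW M0)// -powRD ?(gt_eqF M0) ?implybT//.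
    by congr (_ `^ _); field.
  by rewrite le_eqVlt; apply/orP; left; apply/eqP; ring.
rewrite big_split/= -!mulr_sumr -mulrDr ler_pM2l//; apply: lerD.
  have k0 : 0 <= kap j t by apply/ltW/ml_kappa_gt0.
  apply: le_trans (ler_wpM2l k0 (level_sum_le beta M1 (lvl j t))) _.
  rewrite ml_kappaE expr_div_n sig_def// -/(w j t) le_eqVlt; apply/orP; left; apply/eqP.
  by field; rewrite !gt_eqF// powR_gt0.
apply: le_trans (cost_sum_le M1 _) _; rewrite -[leRHS]mulrA ler_wpM2l//.
  by rewrite divr_ge0 ?subr_ge0 ?ltW.
exact: level_growth.
Qed.

Let G1_sqr t b : beta1 <= b -> G1 t ^+ 2 <= K1 ^+ 2 * T t `^ (2 * b * p).
Proof.
move=> bb; have -> : T t `^ (2 * b * p) = (T t `^ (b * p)) ^+ 2.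
  by rewrite -powR_mulrn ?powR_ge0// -powRrM; congr (_ `^ _); ring.
rewrite -exprMn ler_pXn2r// ?nnegrE ?mulr_ge0 ?powR_ge0 ?(ltW K10) ?(ltW (G1_gt0 t))//.
apply: le_trans (cond_iv1 t) _; rewrite ler_pM2l//.
by apply: (ler_powR (T1 t)); rewrite ler_wpM2r// ltW.
Qed.

Lemma cost_main_term : exists2 c : R, 0 <= c & forall j t, (0 < j)%N ->
  j%:R `^ r * G1 t ^+ 2 * w j t ^+ 2 <= c * (cost_rate j * T t `^ p).
Proof.
rewrite /cost_rate /w /level_weight; have [b_gt|b_lt|b_eq] := ltgtP (1 / 2) beta.
(* The level weight is 1, and beta1 <= 1/2 leaves at most the power p in Gamma_1^2. *)
- have bn : beta != 1 / 2 by rewrite gt_eqF.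
  exists (K1 ^+ 2); first exact: sqr_ge0.
  move=> j t j0; rewrite ?(negbTE bn)/= max_r; last by rewrite subr_le0 ltW.
  rewrite mulr0 powRr0 expr1n mulr1 [leRHS]mulrCA ler_wpM2l ?powR_ge0//.
  have /andP[_] := beta1_neq bn; rewrite le_min => /andP[_ /(G1_sqr t)].
  by have -> : 2 * (1 / 2) * p = p by field.
(* Since beta1 <= beta, the powers 2 beta p from Gamma_1^2 and p (1 - 2 beta) from the squared
   weight add up to p. *)
- have bn : beta != 1 / 2 by rewrite lt_eqF.
  exists (K1 ^+ 2 * cM `^ (1 - 2 * beta)).
    by rewrite mulr_ge0 ?powR_ge0 ?sqr_ge0.
  move=> j t j0; rewrite ?(negbTE bn)/= max_l; last by rewrite subr_ge0 ltW.
  have j0r : 0 < j%:R :> R by rewrite ltr0n.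
  have b2 : 0 <= 1 - 2 * beta by lra.
  have -> : (M `^ ((lvl j t)%:R * (1 / 2 - beta))) ^+ 2 = (M ^+ lvl j t) `^ (1 - 2 * beta).
    rewrite -powR_mulrn ?powR_ge0// -powRrM -(powR_mulrn _ (ltW M0)) -powRrM.
    by congr (_ `^ _); field.
  have h1 : (M ^+ lvl j t) `^ (1 - 2 * beta) <= cM `^ (1 - 2 * beta) *
      (T t `^ (p * (1 - 2 * beta)) * j%:R `^ (rho / alpha * (1 - 2 * beta))).
    apply: le_trans (le_powR b2 (exprn_ge0 _ (ltW M0)) (level_growth t j0)) _.
    rewrite powRM ?(ltW cM_gt0) ?mulr_ge0 ?powR_ge0// /growth.
    by rewrite powRM ?powR_ge0// -!powRrM.
  have /andP[_] := beta1_neq bn; rewrite le_min => /andP[/(G1_sqr t) h2 _].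
  have h3 := ler_pM (sqr_ge0 (G1 t)) (powR_ge0 _ _) h2 h1.
  rewrite -mulrA; apply: le_trans (ler_wpM2l (powR_ge0 _ r) h3) _.
  have -> : T t `^ p = T t `^ (2 * beta * p) * T t `^ (p * (1 - 2 * beta)).
    rewrite -powRD ?(gt_eqF (T0 t)) ?implybT//; congr (_ `^ _); ring.
  rewrite powRD ?(gt_eqF j0r) ?implybT//.
  by rewrite le_eqVlt; apply/orP; left; apply/eqP; ring.
- have /andP[beta10 beta1lt] := beta1_eq (esym b_eq).
  (* The squared level contains the square of ln (1 + |t|). The strict bound beta1 < 1/2 leaves the
     power 2 a = p - 2 beta1 p to absorb it. *)
  pose a := p * (1 - 2 * beta1) / 2.
  have a0 : 0 < a by rewrite divr_gt0// mulr_gt0//; lra.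
  have ln2 : 0 < ln 2 :> R by rewrite ln_gt0// ltr1n.
  have lM : 0 < ln M by rewrite ln_gt0.
  (* Division by ln 2 <= ln (j + 1) lets a sum of logarithms be bounded by the product (1 + ln (T
     t)) ln (j + 1). *)
  pose c' := (ln cM / ln 2 + p / ln 2 + rho / alpha) / ln M.
  have lcM : 0 <= ln cM by rewrite ln_ge0.
  have c'0 : 0 <= c'.
    by rewrite divr_ge0 ?(ltW lM)// !addr_ge0// divr_ge0// ltW.
  exists (K1 ^+ 2 * (c' * (1 + a^-1)) ^+ 2); first by rewrite mulr_ge0 ?sqr_ge0.
  move=> j t j0 /=.
  have j0r : 0 < j%:R :> R by rewrite ltr0n.
  have ljS : ln 2 <= ln j.+1%:R :> R by rewrite ler_ln ?posrE// ?ler_nat ?ltr0n.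
  have lj : ln j%:R <= ln j.+1%:R :> R by rewrite ler_ln ?posrE ?ler_nat ?ltr0n.
  have lj1 : 0 < ln j.+1%:R :> R by exact: lt_le_trans ljS.
  have lT : 0 <= ln (T t) by rewrite ln_ge0.
  have m_le : (lvl j t)%:R <= c' * (1 + ln (T t)) * ln j.+1%:R.
    have h : (lvl j t)%:R * ln M <= ln cM + (p * ln (T t) + rho / alpha * ln j%:R).
      rewrite -[(lvl j t)%:R * _]ln_powR powR_mulrn ?(ltW M0)//.
      have gr0 : 0 < growth j t by exact: lt_le_trans (growth_ge1 t j0).
      rewrite -!ln_powR -lnM ?posrE ?powR_gt0// -lnM ?posrE//.
      rewrite ler_ln ?posrE ?exprn_gt0//; first exact: level_growth.
      by apply: mulr_gt0 => //; apply: mulr_gt0; exact: powR_gt0.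
    rewrite -(ler_pM2r lM); apply: le_trans h _.
    have -> : c' * (1 + ln (T t)) * ln j.+1%:R * ln M =
        (ln cM / ln 2 + p / ln 2 + rho / alpha) * (1 + ln (T t)) * ln j.+1%:R.
      by rewrite /c'; field; rewrite !gt_eqF.
    pose l := ln j.+1%:R : R; pose lt := ln (T t).
    have x1 : ln cM <= ln cM / ln 2 * l.
      by rewrite mulrAC ler_pdivlMr// ler_wpM2l.
    have x2 : p * lt <= p / ln 2 * lt * l.
      have -> : p / ln 2 * lt * l = p * lt * (l / ln 2) by ring.
      rewrite -[leLHS]mulr1 ler_wpM2l ?mulr_ge0 ?(ltW p0)//.
      by rewrite ler_pdivlMr// mul1r.
    have x3 : rho / alpha * ln j%:R <= rho / alpha * l.
      by rewrite ler_wpM2l// divr_ge0// ltW.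
    have y1 : 0 <= ln cM / ln 2 * lt * l.
      by rewrite !mulr_ge0 ?invr_ge0 ?(ltW ln2) ?(ltW lj1).
    have y2 : 0 <= p / ln 2 * l.
      by rewrite !mulr_ge0 ?invr_ge0 ?(ltW ln2) ?(ltW lj1) ?(ltW p0).
    have y3 : 0 <= rho / alpha * lt * l.
      by rewrite !mulr_ge0 ?invr_ge0 ?(ltW rho_gt0) ?(ltW alpha0) ?(ltW lj1).
    have -> : (ln cM / ln 2 + p / ln 2 + rho / alpha) * (1 + ln (T t)) * ln j.+1%:R =
      ln cM / ln 2 * l + p / ln 2 * lt * l + rho / alpha * l +
      (ln cM / ln 2 * lt * l + p / ln 2 * l + rho / alpha * lt * l).
      by rewrite /l /lt; ring.
    move: x1 x2 x3 y1 y2 y3; rewrite -/lt; lra.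
  have lT_le : 1 + ln (T t) <= (1 + a^-1) * T t `^ a.
    rewrite mulrDl mul1r; apply: lerD; first exact: Tp1 (ltW a0).
    rewrite ler_pdivlMl// -ln_powR.
    by apply/ltW/ln_sublinear; rewrite powR_gt0.
  have m2 : (lvl j t)%:R ^+ 2 <= (c' * (1 + a^-1)) ^+ 2 * (T t `^ (2 * a) * ln j.+1%:R ^+ 2).
    have -> : T t `^ (2 * a) = T t `^ a ^+ 2.
      by rewrite -powR_mulrn ?powR_ge0// -powRrM mulrC.
    have base : (lvl j t)%:R <= c' * (1 + a^-1) * (T t `^ a * ln j.+1%:R).
      apply: le_trans m_le _; rewrite mulrA ler_pM2r// -mulrA.
      by rewrite ler_wpM2l.
    rewrite -!exprMn ler_pXn2r// nnegrE; first exact: ler0n.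
    exact: le_trans (ler0n _ _) base.
  have h2 := G1_sqr t (lexx beta1).
  have h3 := ler_pM (sqr_ge0 (G1 t)) (sqr_ge0 _) h2 m2.
  rewrite -mulrA; apply: le_trans (ler_wpM2l (powR_ge0 _ r) h3) _.
  have -> : T t `^ p = T t `^ (2 * beta1 * p) * T t `^ (2 * a).
    by rewrite -powRD ?(gt_eqF (T0 t)) ?implybT//; congr (_ `^ _); rewrite /a; field.
  by rewrite le_eqVlt; apply/orP; left; apply/eqP; ring.
Qed.

(** The cost of rounding up is dominated by the rate: here the lower bound on r enters, through
    [rho_b0]. For beta = 1/2 the constant compensates the smallest logarithm, ln 2. *)
Lemma cost_rate_ge j : (0 < j)%N ->
  j%:R `^ (rho / alpha) <= Num.max 1 (ln 2 ^+ 2)^-1 * cost_rate j.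
Proof.
move=> j0; have j1 : 1 <= j%:R :> R by rewrite ler1n.
have m1 : 1 <= Num.max 1 (ln 2 ^+ 2)^-1 :> R by rewrite le_max lexx.
have ra0 : 0 < rho / alpha by rewrite divr_gt0.
have := rho_b0; rewrite /b0 /cost_rate; have [b_gt|b_lt|b_eq] := ltgtP (1 / 2) beta.
- move=> h; apply: le_trans (ler_peMl (powR_ge0 _ _) m1).
  by apply: ler_powR => //; lra.
- move=> h; apply: le_trans (ler_peMl (powR_ge0 _ _) m1).
  by apply: ler_powR => //; lra.
- rewrite -?b_eq => h.
  have ln2 : 0 < ln 2 :> R by rewrite ln_gt0// ltr1n.
  have ljS : ln 2 <= ln j.+1%:R :> R by rewrite ler_ln ?posrE// ?ler_nat ?ltr0n.
  apply: (@le_trans _ _ (j%:R `^ r)); first by apply: ler_powR => //; lra.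
  rewrite mulrCA -[leLHS]mulr1 ler_wpM2l ?powR_ge0//.
  apply: (@le_trans _ _ ((ln 2 ^+ 2)^-1 * ln 2 ^+ 2)).
    by rewrite mulVf// expf_neq0// gt_eqF.
  apply: ler_pM; rewrite ?invr_ge0 ?sqr_ge0 ?le_max ?lexx ?orbT//.
  by rewrite ler_pXn2r// nnegrE ltW// (lt_le_trans ln2).
Qed.

Lemma cost_rate_ge0 j : 0 <= cost_rate j.
Proof.
rewrite /cost_rate; case: ifPn => _; first exact: powR_ge0.
case: ifPn => _; last exact: powR_ge0.
by apply: mulr_ge0; [exact: powR_ge0|exact: sqr_ge0].
Qed.

Lemma step_cost_bound : exists2 c : R, 0 < c & forall j t, (0 < j)%N ->
  step_cost j t <= c * cost_rate j * (1 + nm t) `^ p.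
Proof.
have [c c0 hc] := cost_main_term.
pose a := level_const M beta / sig0 ^+ 2.
have a0 : 0 <= a by rewrite divr_ge0 ?sqr_ge0// ltW// level_const_gt0.
pose e : R := M / (M - 1) * cM * Num.max 1 (ln 2 ^+ 2)^-1.
have e0 : 0 < e.
  have mx : 0 < Num.max 1 (ln 2 ^+ 2)^-1 :> R by rewrite lt_max ltr01.
  by apply: mulr_gt0 => //; apply: mulr_gt0 => //; rewrite divr_gt0 ?subr_gt0.
exists (K * (a * c + e)); first by rewrite mulr_gt0// ltr_wpDl// mulr_ge0.
move=> j t j0; apply: le_trans (step_cost_le t j0) _.
have p1 : 0 <= M / (M - 1) * cM.
  by apply: mulr_ge0; [rewrite divr_ge0 ?subr_ge0 ?ltW|exact: ltW].
have h1 := ler_wpM2l a0 (hc j t j0).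
have h2 := ler_wpM2l p1 (ler_wpM2l (powR_ge0 (T t) p) (cost_rate_ge j0)).
have -> : K * (a * c + e) * cost_rate j * (1 + nm t) `^ p =
   K * (a * (c * (cost_rate j * T t `^ p)) + M / (M - 1) * cM *
     (T t `^ p * (Num.max 1 (ln 2 ^+ 2)^-1 * cost_rate j))).
  by rewrite /e /T; ring.
by rewrite ler_pM2l//; exact: lerD.
Qed.

(** The rate is nondecreasing, so the sum is at most n times its last term; the exponents match by 1
    + r = 2 rho. *)
Lemma cost_rate_sum n : (0 < n)%N ->
  \sum_(1 <= j < n.+1) cost_rate j <=
  (if 1 / 2 < beta then n%:R `^ (2 * rho)
   else if beta == 1 / 2 then n%:R `^ (2 * rho) * ln (n.+1)%:R ^+ 2
   else n%:R `^ (2 * rho * (1 + (1 - 2 * beta) / (2 * alpha)))).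
Proof.
move=> n0; have n0r : 0 < n%:R :> R by rewrite ltr0n.
have rE : 2 * rho = 1 + r by rewrite rho_def; field.
have -> : (if 1 / 2 < beta then n%:R `^ (2 * rho)
   else if beta == 1 / 2 then n%:R `^ (2 * rho) * ln (n.+1)%:R ^+ 2
   else n%:R `^ (2 * rho * (1 + (1 - 2 * beta) / (2 * alpha)))) = n%:R * cost_rate n.
  have nD (a : R) : n%:R `^ (1 + a) = n%:R * n%:R `^ a.
    by rewrite -[X in X * _](powRr1 (ltW n0r)) -powRD// (gt_eqF n0r) implybT.
  rewrite /cost_rate; case: ifPn => _; first by rewrite rE nD.
  case: ifPn => _; first by rewrite rE nD mulrA.
  rewrite -nD; congr (_ `^ _); rewrite addrA -rE.
  by field; rewrite gt_eqF.
apply: (@le_trans _ _ (\sum_(1 <= j < n.+1) cost_rate n)); last first.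
  by rewrite sumr_const_nat subn1/= mulr_natl.
rewrite big_nat_cond [leRHS]big_nat_cond ler_sum// => j; rewrite andbT ltnS => /andP[j0 jn].
have jn' : j%:R <= n%:R :> R by rewrite ler_nat.
rewrite /cost_rate; case: ifPn => [_|b1]; first exact: le_powR (ltW r_gt0) (ler0n _ _) jn'.
have b2 : beta <= 1 / 2 by rewrite leNgt.
case: ifPn => _.
  apply: ler_pM; rewrite ?powR_ge0 ?sqr_ge0//.
    exact: le_powR (ltW r_gt0) (ler0n _ _) jn'.
  have l0 (m : nat) : 0 <= ln m.+1%:R :> R by rewrite ln_ge0// ler1n.
  by rewrite ler_pXn2r ?nnegrE// ler_ln ?posrE ?ltr0n// ler_nat.
apply: le_powR => //; rewrite addr_ge0 ?(ltW r_gt0)// mulr_ge0//; last by lra.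
by rewrite divr_ge0// ltW.
Qed.

End level_cost.

(** * The multilevel scheme as an instance of the abstract recursion *)

Theorem theorem3p1
  (R : realType) (d : nat) (dO dV : measure_display)
  (Omega : measurableType dO) (P : probability Omega R)
  (V : measurableType dV) (U : {RV P >-> V})
  (dot : {dot 'rV[R]_d for idfun})
  (p : R) (hp : 2 <= p)
  (F : 'rV[R]_d -> V -> 'rV[R]_d)
  (F_meas : measurable_fun [set: 'rV[R]_d * V] (fun x => F x.1 x.2))
  (F_int : forall t, vintegrable P (fun w => F t (U w)))
  (f : 'rV[R]_d -> 'rV[R]_d)
  (f_def : forall t, f t = vexpectation P (fun w => F t (U w)))
  (ts : 'rV[R]_d) (f_ts : f ts = 0) (ts_uniq : forall t, f t = 0 -> t = ts)
  (Fk : nat -> 'rV[R]_d -> V -> 'rV[R]_d)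
  (Fk0 : forall t u, Fk 0%N t u = 0)
  (Fk_meas : forall k, (0 < k)%N ->
     measurable_fun [set: 'rV[R]_d * V] (fun x => Fk k x.1 x.2))
  (Fk_int : forall k t, (0 < k)%N -> vintegrable P (fun w => Fk k t (U w)))
  (C : nat -> R) (C_gt0 : forall k, (0 < k)%N -> 0 < C k)
  (L L' : R) (L_gt0 : 0 < L) (L'_gt0 : 0 < L')
  (f_mon : forall t, dot (t - ts) (f t) <= - L * dot_norm dot (t - ts) ^+ 2)
  (f_bnd : forall t, dot (t - ts) (f t) <= - L' * dot_norm dot (f t) ^+ 2)
  (G1 G2 : 'rV[R]_d -> R)
  (G1_meas : measurable_fun [set: 'rV[R]_d] G1)
  (G2_meas : measurable_fun [set: 'rV[R]_d] G2)
  (G1_gt0 : forall t, 0 < G1 t) (G2_gt0 : forall t, 0 < G2 t)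
  (M K K1 alpha beta beta1 : R)
  (M_gt1 : 1 < M) (K_gt0 : 0 < K) (K1_gt0 : 0 < K1)
  (alpha_gt0 : 0 < alpha) (beta_gt0 : 0 < beta) (le_beta_alpha : beta <= alpha)
  (beta1_neq : beta != 1 / 2 -> 0 <= beta1 <= Num.min beta (1 / 2))
  (beta1_eq : beta = 1 / 2 -> 0 <= beta1 < 1 / 2)
  (cond_i : forall k t, (0 < k)%N ->
     (('E_P[fun w =>
        (dot_norm dot
          (Fk k t (U w) - Fk k.-1 t (U w)
           - vexpectation P (fun w' => Fk k t (U w') - Fk k.-1 t (U w'))) `^ p)%R])
        `^ p^-1 <= (G1 t * M `^ (- (k%:R * beta)))%:E)%E)
  (cond_ii : forall k t, (0 < k)%N ->
     dot_norm dot (vexpectation P (fun w => Fk k t (U w) - F t (U w)))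
       <= G2 t * M `^ (- (k%:R * alpha)))
  (cond_iii : forall k, (0 < k)%N -> C k <= K * M ^+ k)
  (cond_iv1 : forall t, G1 t <= K1 * (1 + dot_norm dot t) `^ (beta1 * p))
  (cond_iv2 : forall t, G2 t <= K1 * (1 + dot_norm dot t) `^ (alpha * p))
  (theta0 : 'rV[R]_d) (r : R) (r_gtN1 : -1 < r)
  (gam0 : R) (gam0_gt : (1 + r) / (2 * L) < gam0)
  (sig0 eps0 : R) (sig0_gt0 : 0 < sig0) (eps0_gt0 : 0 < eps0)
  (rho : R) (rho_def : rho = 1 / 2 * (1 + r))
  (gam sig eps : nat -> R)
  (gam_def : forall n, (0 < n)%N -> gam n = gam0 * (1 / n%:R))
  (sig_gt0 : forall n, (0 < n)%N -> 0 < sig n)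
  (sig_def : forall n, (0 < n)%N -> sig n ^+ 2 = sig0 ^+ 2 * (1 / n%:R `^ r))
  (eps_def : forall n, (0 < n)%N -> eps n = eps0 * (1 / n%:R `^ rho))
  (Uc : nat -> nat -> nat -> {RV P >-> V})
  (Uc_iid : independent_copies U Uc)
  (theta : nat -> Omega -> 'rV[R]_d)
  (theta_def :
     theta = ml_robbins_monro G1 G2 M alpha beta eps sig Fk Uc gam theta0) :
  [/\ forall eta : R, 0 < eta < rho ->
        exists2 kappa : R, 0 < kappa &
          forall n : nat, (0 < n)%N ->
            ((\int[P]_w
               ereal_sup [set (k%:R `^ (eta * p)
                               * dot_norm dot (theta k w - ts) `^ p)%:E
                         | k in [set k : nat | (n <= k)%N]]) `^ p^-1
             <= (kappa * n%:R `^ (- (rho - eta)))%:E)%E,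
      forall delta : R, 0 < delta ->
        {ae P, forall w,
          (n%:R `^ (rho - delta) * dot_norm dot (theta n w - ts))
            @[n --> \oo] --> (0 : R)} &
      Num.min beta (1 / 2) < alpha ->
      Num.min beta (1 / 2) / (alpha - Num.min beta (1 / 2)) < r ->
      exists2 kappa' : R, 0 < kappa' &
        forall n : nat, (0 < n)%N ->
          (ml_cost P G1 G2 M alpha beta eps sig C theta n <=
           (kappa' *
             (if 1 / 2 < beta then n%:R `^ (2 * rho)
              else if beta == 1 / 2 then n%:R `^ (2 * rho) * ln (n.+1)%:R ^+ 2
              else n%:R `^ (2 * rho * (1 + (1 - 2 * beta) / (2 * alpha)))))%:E)%E ].
Proof.
have eps_gt0 n : (0 < n)%N -> 0 < eps n.
  by move=> n0; rewrite eps_def// !mulr_gt0// invr_gt0 powR_gt0// ltr0n.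
have rho0 : 0 < rho by rewrite rho_def; lra.
have gam00 : 0 < gam0.
  by apply: lt_trans gam0_gt; rewrite divr_gt0 ?mulr_gt0//; lra.
have gam_gt0 n : (0 < n)%N -> 0 < gam n.
  by move=> n0; rewrite gam_def// !mulr_gt0// invr_gt0 ltr0n.
have g0L : rho < L * gam0.
  by move: gam0_gt; rewrite ltr_pdivrMr ?mulr_gt0// rho_def; lra.
have q1 : 1 <= p / 2 by rewrite ler_pdivlMr// mul1r.
pose X := copies Uc; pose J := copies_upto; pose K' := copies_at.
pose lvl := ml_level G2 M alpha eps.
pose N n t w := ml_noise U Fk G1 G2 M alpha beta eps sig Uc n t w.
pose h n t := level_mean U Fk (lvl n t) t.
(* Step n evaluates its noise at the previous iterate; the value 0 at n = 0 is a default. *)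
pose W n w := if n is n'.+1 then gam n *: N n (theta n' w) w else 0.
have thetaS n w : theta n.+1 w =
    theta n w + (gam0 / n.+1%:R) *: h n.+1 (theta n w) + W n.+1 w.
  rewrite theta_def/= -theta_def (@ml_estimatorE _ _ _ _ _ P V U)//.
  by rewrite scalerDr addrA gam_def// mul1r.
have theta_0 w : theta 0%N w = theta0 by rewrite theta_def.
have JS n : J n `<=` J n.+1.
  by move=> i [iD ?]; split => //; exact: leqW.
have KJ n : K' n `<=` J n by move=> i [iD e]; split => //; rewrite e.
(* A step draws only samples carrying its own first index, none of which an earlier step has
   used. *)
have JK n i : J n i -> K' n.+1 i -> False.
  by move=> [_ le] [_ e]; move: le; rewrite e ltnn.
have mN n : (0 < n)%N ->
    measurable_fun [set: 'rV[R]_d * family_sigma X (K' n)] (fun z => N n z.1 z.2).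
  by move=> n0; exact: measurable_ml_noise.
have mgN n : (0 < n)%N ->
    measurable_fun [set: 'rV[R]_d * family_sigma X (K' n)] (fun z => gam n *: N n z.1 z.2).
  by move=> n0; apply: measurable_rV_scale => //; exact: mN.
have m_h n : measurable_fun setT (h n).
  apply: (@measurable_nat_choice _ _ _ _ (lvl n) (level_mean U Fk)).
    exact: measurable_ml_level.
  by move=> k; exact: measurable_level_mean.
have m_WS n : measurable_fun [set: family_sigma X (J n)] (theta n) ->
    measurable_fun [set: family_sigma X (J n.+1)] (W n.+1).
  (* The sample point enters twice: through theta n, measurable in the past, and as an argument of
     the noise, with the sigma-field of step n + 1. *)
  move=> mt; apply: (measurableT_comp (g := fun w : family_sigma X (J n.+1) =>
    (theta n w, w : family_sigma X (K' n.+1))) (mgN n.+1 isT)).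
  apply: measurable_fun_pair; first exact: measurable_fun_familyS (@JS n) mt.
  have mid : measurable_fun [set: family_sigma X (K' n.+1)]
      (idfun : Omega -> family_sigma X (K' n.+1)) by exact: measurable_id.
  exact: measurable_fun_familyS (@KJ n.+1) mid.
have m_theta n : measurable_fun [set: family_sigma X (J n)] (theta n).
  elim: n => [|n IH].
    rewrite (_ : theta 0%N = fun=> theta0); last exact/funext.
    exact: measurable_cst.
  rewrite (_ : theta n.+1 = fun w =>
    theta n w + (gam0 / n.+1%:R) *: h n.+1 (theta n w) + W n.+1 w); last exact/funext.
  apply: measurable_rV_add; last exact: m_WS.
  have IH' := measurable_fun_familyS (@JS n) IH.
  apply: measurable_rV_add => //; apply: measurable_rV_scale => //.
  exact: measurableT_comp IH'.
have m_W n : measurable_fun [set: family_sigma X (J n.+1)] (W n.+1).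
  exact: m_WS.
pose cv := noise_const p M beta * gam0 ^+ 2 * sig0 ^+ 2.
have nc0 : 0 < noise_const p M beta by exact: noise_const_gt0.
have cv0 : 0 <= cv.
  by apply: mulr_ge0; [apply: mulr_ge0; [exact: ltW|exact: sqr_ge0]|exact: sqr_ge0].
have varE n : noise_const p M beta * gam n.+1 ^+ 2 * sig n.+1 ^+ 2 = noise_var cv rho n.
  have n0 : 0 < n.+1%:R :> R by rewrite ltr0n.
  rewrite /noise_var /cv gam_def// sig_def//.
  have -> : - (2 * rho) = - 1 + - r by rewrite rho_def; field.
  rewrite powRD ?(gt_eqF n0) ?implybT// powR_inv1 ?ler0n// powRN.
  by field; rewrite !gt_eqF// powR_gt0.
have condM n (Z : Omega -> 'rV[R]_d) (c : Omega -> R) : (forall w, 0 <= c w) ->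
    measurable_fun [set: family_sigma X (J n)] Z ->
    measurable_fun [set: family_sigma X (J n)] c ->
    (\int[P]_w ((dot_norm dot (Z w + W n.+1 w) ^+ 2 + c w) `^ (p / 2))%:E <=
     \int[P]_w ((dot_norm dot (Z w) ^+ 2 + c w + noise_var cv rho n) `^ (p / 2))%:E)%E.
  move=> c0 mZ mc.
  apply: (@conditional_moment _ _ _ _ _ _ _ X copies_dom d dot (p / 2) Uc_iid.2
    (J n) (K' n.+1) (fun t w => gam n.+1 *: N n.+1 t w)) => //.
  - exact: copies_upto_dom.
  - exact: copies_at_dom.
  - exact: JK.
  - exact: mgN.
  move=> t x c1 c10; rewrite -varE.
  by apply: ml_noise_moment => //; exact: gam_gt0.
have condN n (Z : Omega -> 'rV[R]_d) (a : Omega -> R) : (forall w, 0 <= a w) ->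
    measurable_fun [set: family_sigma X (J n)] Z ->
    measurable_fun [set: family_sigma X (J n)] a ->
    (\int[P]_w (a w * dot_norm dot (Z w))%:E <=
     \int[P]_w (a w * dot_norm dot (Z w + W n.+1 w))%:E)%E.
  move=> a0 mZ ma.
  apply: (@conditional_norm _ _ _ _ _ _ _ X copies_dom d dot Uc_iid.2
    (J n) (K' n.+1) (fun t w => gam n.+1 *: N n.+1 t w)) => //.
  - exact: copies_upto_dom.
  - exact: copies_at_dom.
  - exact: JK.
  - exact: mgN.
  by move=> t; apply: centeredZ; exact: centered_ml_noise.
have h_f n t : dot_norm dot (h n.+1 t - f t) <= eps0 * n.+1%:R `^ (- rho).
  have l0 : (0 < lvl n.+1 t)%N by exact: ml_level_gt0.
  rewrite f_def /h /level_mean -vexpectationB//; last exact: Fk_int.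
  apply: le_trans (cond_ii _ t l0) _.
  apply: le_trans (ml_level_bias M_gt1 alpha_gt0 (G2_gt0 t) (eps_gt0 n.+1 isT)) _.
  by rewrite eps_def// mul1r powRN.
split.
- move=> eta eta_rho.
  exact: (sup_moment hp L_gt0 L'_gt0 rho0 (ltW eps0_gt0) cv0 g0L f_mon f_bnd JS
    m_theta m_W m_h theta_0 thetaS h_f condM condN eta_rho).
- move=> delta delta0.
  exact: (sup_almost_surely hp L_gt0 L'_gt0 rho0 (ltW eps0_gt0) cv0 g0L f_mon f_bnd JS
    m_theta m_W m_h theta_0 thetaS h_f condM condN delta0).
move=> b_alpha b_r.
have [B B0 hB] := uniform_moment hp L_gt0 L'_gt0 rho0 (ltW eps0_gt0) cv0 g0L f_mon
  f_bnd m_theta m_h theta_0 thetaS h_f condM.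
have [c c0 hc] := step_cost_bound hp G1_gt0 G2_gt0 M_gt1 K_gt0 K1_gt0 alpha_gt0
  beta_gt0 beta1_neq beta1_eq C_gt0 cond_iii cond_iv1 cond_iv2 rho_def sig0_gt0
  eps0_gt0 sig_gt0 sig_def eps_def b_alpha b_r.
exists (c * B); first exact: mulr_gt0.
move=> n n0.
pose S j t := step_cost G1 G2 M alpha beta eps sig C j t.
have S0 j t : 0 <= S j t by exact: step_cost_ge0.
have mS j : measurable_fun setT (S j.+1).
  apply: (@measurable_nat_choice _ _ _ _ (lvl j.+1) (fun m t =>
    \sum_(1 <= k < m.+1) (ml_reps G1 G2 M alpha beta eps sig j.+1 k t)%:R * C k)).
    exact: measurable_ml_level.
  move=> m; apply: measurable_sum => k; apply: measurable_funM => //.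
  apply: (measurableT_comp (f := fun i : nat => i%:R : R)) => //.
  exact: measurable_ml_reps.
have mt j : measurable_fun setT (theta j) by exact: measurable_fun_family (@m_theta j).
pose T j w := (1 + dot_norm dot (theta j w)) `^ p.
have T0 j w : 0 <= T j w by exact: powR_ge0.
have mT j : measurable_fun setT (T j).
  apply: (measurableT_comp (measurable_powR _)); apply: measurable_funD => //.
  exact: measurable_dot_norm.
pose rate j := cost_rate alpha beta r rho j.
have rate0 j : 0 <= rate j by exact: cost_rate_ge0.
(* Indices are shifted: step j + 1 starts from theta j, whose p-th moments are bounded uniformly in
   j, including j = 0. *)
apply: (@le_trans _ _ (\sum_(0 <= j < n) (c * rate j.+1 * B)%:E)%E); last first.
  rewrite sumEFin lee_fin -mulr_suml -mulr_sumr mulrAC ler_wpM2l//.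
    by rewrite mulr_ge0// ltW.
  rewrite -(big_add1 _ _ 0 n.+1 xpredT rate).
  exact: cost_rate_sum.
rewrite /ml_cost unlock.
apply: (@le_trans _ _ (\int[P]_w (\sum_(0 <= j < n) c * rate j.+1 * T j w)%:E)%E).
  under eq_integral do rewrite big_add1/=.
  apply: le_expect.
  - by move=> w; apply: sumr_ge0 => j _; exact: S0.
  - by apply: measurable_sum => j; exact: (measurableT_comp (@mS j) (@mt j)).
  - by apply: measurable_sum => j; exact: measurable_funM.
  - by move=> w; apply: ler_sum => j _; exact: hc.
have cr0 j : 0 <= c * rate j.+1 by rewrite mulr_ge0// ltW.
rewrite expect_sum//; last 2 first.
- by move=> j w; rewrite mulr_ge0.
- by move=> j; exact: measurable_funM.
apply: lee_sum => j _; rewrite expectZ// [X in (_ <= X)%E]EFinM.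
by apply: lee_wpmul2l; [rewrite lee_fin|exact: hB].
Qed.
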